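(* Let $d\ge 2$ and $m\in\mathbb{N}$. Suppose $\{\mathbf{V}_n:n\in\mathbb{N}_0\}$ is a sequence of independent $m$-variate random vectors with $\mathsf{E}[\mathbf{V}_n]=\mathbf{0}$ and $\operatorname{cov}(\mathbf{V}_n,\mathbf{V}_n)=a_n^2\mathsf{I}_m$; $\mathbf{U}$ is a random element uniformly distributed on $\mathbb{M}^d$, independent of $\{\mathbf{V}_n\}$; and $\{\mathsf{B}_n:n\in\mathbb{N}_0\}$ is a sequence of $m\times m$ symmetric nonnegative-definite matrices such that $\sum_{n=0}^\infty \mathsf{B}_nP_n^{(\alpha,\beta)}(1)$ converges (entrywise). Then the series \[ \mathbf{Z}(\mathbf{x})=\sum_{n=0}^\infty \mathsf{B}_n^{1/2}\mathbf{V}_nP_n^{(\alpha,\beta)}(\cos\rho(\mathbf{x},\mathbf{U})),\qquad \mathbf{x}\in\mathbb{M}^d, \] converges in mean square for each $\mathbf{x}$ and defines a centred $m$-variate isotropic random field on $\mathbb{M}^d$ with covariance matrix function \[ \operatorname{cov}(\mathbf{Z}(\mathbf{x}_1),\mathbf{Z}(\mathbf{x}_2))=\sum_{n=0}^\infty \mathsf{B}_nP_n^{(\alpha,\beta)}(\cos\rho(\mathbf{x}_1,\mathbf{x}_2)),\qquad \mathbf{x}_1,\mathbf{x}_2\in\mathbb{M}^d. \] Moreover, distinct terms of the series are uncorrelated: for $i\neq j$ and all $\mathbf{x}_1,\mathbf{x}_2\in\mathbb{M}^d$, $\operatorname{cov}\big(\mathsf{B}_i^{1/2}\mathbf{V}_iP_i^{(\alpha,\beta)}(\cos\rho(\mathbf{x}_1,\mathbf{U})),\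 \mathsf{B}_j^{1/2}\mathbf{V}_jP_j^{(\alpha,\beta)}(\cos\rho(\mathbf{x}_2,\mathbf{U}))\big)=\mathbf{0}$.
   Context: A compact connected two-point homogeneous space $\mathbb{M}^d$ of real dimension $d$ is one of: the sphere $\mathbb{S}^d$, the real projective space $\mathbb{P}^d(\mathbb{R})$, the complex projective space $\mathbb{P}^d(\mathbb{C})$ ($d$ even, $d\ge4$), the quaternionic projective space $\mathbb{P}^d(\mathbb{H})$ ($d=8,12,\dots$), or the octonionic projective plane $\mathbb{P}^{16}(\mathbb{O})$. Each is a Riemannian manifold all of whose geodesics are closed; the metric is normalized so that every closed geodesic has length $2\pi$ (as for the unit sphere $\mathbb{S}^d\subset\mathbb{R}^{d+1}$ with $\rho(\mathbf{x}_1,\mathbf{x}_2)=\arccos(\mathbf{x}_1^\top\mathbf{x}_2)$). $\rho$ denotes the induced geodesic distance, $\mu$ the canonical Riemannian volume measure, $\omega_d=\mu(\mathbb{M}^d)$. The parameters $(\alpha,\beta)$ are: for $\mathbb{S}^d$, $\alpha=\beta=\frac{d-2}{2}$; for $\mathbb{P}^d(\mathbb{R})$, $\alpha=\frac{d-2}{2}$, $\beta=-\frac12$; for $\mathbb{P}^d(\mathbb{C})$, $\alpha=\frac{d-2}{2}$, $\beta=0$; for $\mathbb{P}^d(\mathbb{H})$, $\alpha=\frac{d-2}{2}$, $\beta=1$; for $\mathbb{P}^{16}(\mathbb{O})$, $\alpha=7$, $\beta=3$. $P_n^{(\alpha,\beta)}$ is the Jacobi polynomial of degree $n$ in the standard normalization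 $P_n^{(\alpha,\beta)}(1)=\frac{\Gamma(n+\alpha+1)}{\Gamma(n+1)\Gamma(\alpha+1)}$. The constants are $a_n=\left(\frac{\Gamma(\beta+1)(2n+\alpha+\beta+1)\Gamma(n+\alpha+\beta+1)}{\Gamma(\alpha+\beta+2)\Gamma(n+\beta+1)}\right)^{1/2}$. A random element $\mathbf{U}$ of $\mathbb{M}^d$ is uniformly distributed if its law is invariant under all isometries of $\mathbb{M}^d$; equivalently its law is $\mu/\omega_d$. An $m$-variate random field on $\mathbb{M}^d$ is isotropic if its mean is constant and its covariance matrix $\operatorname{cov}(\mathbf{Z}(\mathbf{x}_1),\mathbf{Z}(\mathbf{x}_2))=\mathsf{E}[(\mathbf{Z}(\mathbf{x}_1)-\mathsf{E}\mathbf{Z}(\mathbf{x}_1))(\mathbf{Z}(\mathbf{x}_2)-\mathsf{E}\mathbf{Z}(\mathbf{x}_2))^\top]$ depends only on $\rho(\mathbf{x}_1,\mathbf{x}_2)$. For a symmetric nonnegative-definite matrix $\mathsf{B}=\mathsf{S}\mathsf{D}\mathsf{S}^{-1}$ ($\mathsf{S}$ orthogonal, $\mathsf{D}$ diagonal), $\mathsf{B}^{1/2}=\mathsf{S}\mathsf{D}^{1/2}\mathsf{S}^{-1}$. A series of matrices converges if each entry converges. *)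

(* Defs.v *)
From HB Require Import structures.
From mathcomp Require Import all_boot all_order all_algebra.
From mathcomp Require Import all_classical all_reals all_analysis.
Set Implicit Arguments. Unset Strict Implicit. Unset Printing Implicit Defensive.
Import Order.TTheory GRing.Theory Num.Theory.
Import numFieldNormedType.Exports.
Local Open Scope ring_scope.
Local Open Scope classical_set_scope.

Definition Gamma {R : realType} (x : R) : R :=
  fine (\int[@lebesgue_measure R]_(t in [set t : R | (0 < t)%R])
          ((powR t (x - 1) * expR (- t))%R)%:E)%E.

Definition gbinom {R : realType} (a : R) (k : nat) : R :=
  (\prod_(i < k) (a - i%:R)) / (k`!)%:R.

(* Jacobi polynomial P_n^(al,be)(x) (standard normalization,
   P_n^(al,be)(1) = binom(n+al, n)). *)
Definition jacobiP {R : realType} (n : nat) (al be x : R) : R :=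
  \sum_(s < n.+1)
     gbinom (n%:R + al) (n - s) * gbinom (n%:R + be) s
     * ((x - 1) / 2) ^+ s * ((x + 1) / 2) ^+ (n - s).

Definition a_const {R : realType} (al be : R) (n : nat) : R :=
  Num.sqrt ((Gamma (be + 1) * (2 * n%:R + al + be + 1) * Gamma (n%:R + al + be + 1))
            / (Gamma (al + be + 2) * Gamma (n%:R + be + 1))).

(* Cayley--Dickson algebras: CD 0 = R, CD 1 = C, CD 2 = H, CD 3 = O    *)

Fixpoint CD (R : Type) (j : nat) : Type :=
  match j with 0 => R | j'.+1 => (CD R j' * CD R j')%type end.

Fixpoint cd_zero {R : realType} (j : nat) : CD R j :=
  match j return CD R j with 0 => 0 | j'.+1 => (cd_zero j', cd_zero j') end.

Fixpoint cd_add {R : realType} (j : nat) : CD R j -> CD R j -> CD R j :=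
  match j return CD R j -> CD R j -> CD R j with
  | 0 => fun a b => a + b
  | j'.+1 => fun a b => (cd_add a.1 b.1, cd_add a.2 b.2)
  end.

Fixpoint cd_opp {R : realType} (j : nat) : CD R j -> CD R j :=
  match j return CD R j -> CD R j with
  | 0 => fun a => - a
  | j'.+1 => fun a => (cd_opp a.1, cd_opp a.2)
  end.

Fixpoint cd_conj {R : realType} (j : nat) : CD R j -> CD R j :=
  match j return CD R j -> CD R j with
  | 0 => fun a => a
  | j'.+1 => fun a => (cd_conj a.1, cd_opp a.2)
  end.

Fixpoint cd_mul {R : realType} (j : nat) : CD R j -> CD R j -> CD R j :=
  match j return CD R j -> CD R j -> CD R j with
  | 0 => fun a b => a * b
  | j'.+1 => fun a b =>
      (cd_add (cd_mul a.1 b.1) (cd_opp (cd_mul (cd_conj b.2) a.2)),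
       cd_add (cd_mul b.2 a.1) (cd_mul a.2 (cd_conj b.1)))
  end.

Fixpoint cd_re {R : realType} (j : nat) : CD R j -> R :=
  match j return CD R j -> R with
  | 0 => fun a => a
  | j'.+1 => fun a => cd_re a.1
  end.

Definition sph_pt (R : realType) (d : nat) : Type :=
  {x : 'I_d.+1 -> R | \sum_i x i ^+ 2 = 1}.

Definition sph_rho {R : realType} {d : nat} (x y : sph_pt R d) : R :=
  acos (\sum_i proj1_sig x i * proj1_sig y i).

(* Projective space P^(j-level)( (n+1) x (n+1) ): the rank-one Hermitian
   idempotents (P^* = P, P P = P, tr P = 1) with entries in CD j;
   for CD 3 (octonions) and n = 2 this is the Freudenthal model of the
   Cayley plane (primitive idempotents of the Albert algebra). *)
Definition proj_mx (R : Type) (j n : nat) : Type := 'I_n.+1 -> 'I_n.+1 -> CD R j.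

Definition is_proj_pt {R : realType} {j n : nat} (P : proj_mx R j n) : Prop :=
  [/\ (forall i k, P k i = cd_conj (P i k)),
      (forall i k, \big[@cd_add R j/cd_zero j]_(l < n.+1) cd_mul (P i l) (P l k) = P i k)
    & \sum_i cd_re (P i i) = 1].

Definition proj_pt (R : realType) (j n : nat) : Type :=
  {P : proj_mx R j n | is_proj_pt P}.

(* Re tr(P Q) *)
Definition proj_inner {R : realType} {j n : nat} (P Q : proj_mx R j n) : R :=
  \sum_i \sum_k cd_re (cd_mul (P i k) (cd_conj (Q i k))).

(* geodesic distance, normalized so that closed geodesics have length 2 pi:
   cos(rho/2)^2 = Re tr(PQ), i.e. rho = arccos(2 Re tr(PQ) - 1). *)
Definition proj_rho {R : realType} {j n : nat} (P Q : proj_pt R j n) : R :=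
  acos (2 * proj_inner (proj1_sig P) (proj1_sig Q) - 1).

Inductive tph_kind := KS | KR | KC | KH | KO.

Definition valid_dim (K : tph_kind) (d : nat) : bool :=
  match K with
  | KS => (2 <= d)%N
  | KR => (2 <= d)%N
  | KC => (4 <= d)%N && ~~ odd d
  | KH => (8 <= d)%N && (4 %| d)%N
  | KO => d == 16%N
  end.

Definition tph_point (R : realType) (K : tph_kind) (d : nat) : Type :=
  match K with
  | KS => sph_pt R d
  | KR => proj_pt R 0 d
  | KC => proj_pt R 1 (d %/ 2)
  | KH => proj_pt R 2 (d %/ 4)
  | KO => proj_pt R 3 (d %/ 8)
  end.

Definition rho {R : realType} {K : tph_kind} {d : nat} :
  tph_point R K d -> tph_point R K d -> R :=
  match K as K0 return tph_point R K0 d -> tph_point R K0 d -> R with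
  | KS => @sph_rho R d
  | KR => @proj_rho R 0 d
  | KC => @proj_rho R 1 (d %/ 2)
  | KH => @proj_rho R 2 (d %/ 4)
  | KO => @proj_rho R 3 (d %/ 8)
  end.

Definition alpha {R : realType} (K : tph_kind) (d : nat) : R :=
  match K with KO => 7 | _ => (d%:R - 2) / 2 end.

Definition beta {R : realType} (K : tph_kind) (d : nat) : R :=
  match K with
  | KS => (d%:R - 2) / 2
  | KR => - (1 / 2)
  | KC => 0
  | KH => 1
  | KO => 3
  end.

Definition isometry {M : Type} {R : realType} (dist : M -> M -> R) (g : M -> M) : Prop :=
  bijective g /\ forall x y, dist (g x) (g y) = dist x y.

Definition ball_sets {M : Type} {R : realType} (dist : M -> M -> R) : set (set M) :=
  [set A | exists x r, A = [set y | dist x y < r]].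

Definition borel_sets {M : Type} {R : realType} (dist : M -> M -> R) : set (set M) :=
  <<s ball_sets dist >>.

Definition Expe {R : realType} {dT : measure_display} {T : measurableType dT}
  (P : probability T R) (f : T -> R) : R := fine (\int[P]_w (f w)%:E)%E.

Definition rvec_L2 {R : realType} {dT : measure_display} {T : measurableType dT}
  (P : probability T R) {m : nat} (X : T -> 'cV[R]_m) : Prop :=
  forall i, measurable_fun setT (fun w => X w i 0)
            /\ P.-integrable setT (fun w => ((X w i 0) ^+ 2)%:E).

Definition Evec {R : realType} {dT : measure_display} {T : measurableType dT}
  (P : probability T R) {m : nat} (X : T -> 'cV[R]_m) : 'cV[R]_m :=
  \col_i Expe P (fun w => X w i 0).

Definition covmx {R : realType} {dT : measure_display} {T : measurableType dT}
  (P : probability T R) {m : nat} (X Y : T -> 'cV[R]_m) : 'M[R]_m :=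
  \matrix_(i, j) Expe P (fun w => (X w i 0 - Expe P (fun w => X w i 0))
                                  * (Y w j 0 - Expe P (fun w => Y w j 0))).

Definition sigma_rvec {R : realType} {dT : measure_display} {T : measurableType dT}
  {m : nat} (X : T -> 'cV[R]_m) : set (set T) :=
  <<s [set A | exists i B, measurable B /\ A = (fun w => X w i 0) @^-1` B] >>.

Definition random_element {M : Type} {R : realType} {dT : measure_display}
  {T : measurableType dT} (dist : M -> M -> R) (U : T -> M) : Prop :=
  forall A, borel_sets dist A -> measurable (U @^-1` A).

Definition sigma_el {M : Type} {R : realType} {T : Type}
  (dist : M -> M -> R) (U : T -> M) : set (set T) :=
  [set U @^-1` A | A in borel_sets dist].

Definition uniform_el {M : Type} {R : realType} {dT : measure_display}
  {T : measurableType dT} (P : probability T R) (dist : M -> M -> R) (U : T -> M) : Prop :=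
  forall g, isometry dist g ->
    forall A, borel_sets dist A -> P (U @^-1` A) = P ((g \o U) @^-1` A).

Definition indep_family {R : realType} {dT : measure_display} {T : measurableType dT}
  (P : probability T R) {I : eqType} (F : I -> set (set T)) : Prop :=
  forall J : seq I, uniq J -> forall A : I -> set T,
    (forall j, j \in J -> F j (A j)) ->
    P (\bigcap_(j in [set` J]) A j) = (\prod_(j <- J) P (A j))%E.

Definition indep2 {R : realType} {dT : measure_display} {T : measurableType dT}
  (P : probability T R) (F G : set (set T)) : Prop :=
  forall A B, F A -> G B -> P (A `&` B) = (P A * P B)%E.

Definition sym_nnd {R : realType} {m : nat} (B : 'M[R]_m) : Prop :=
  B^T = B /\ forall v : 'cV[R]_m, 0 <= (v^T *m B *m v) 0 0.

Definition sqrt_decomp {R : realType} {m : nat} (B : 'M[R]_m) (p : 'M[R]_m * 'M[R]_m) : Prop :=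
  [/\ p.1 *m p.1^T = 1%:M, is_diag_mx p.2 & B = p.1 *m p.2 *m invmx p.1].

Definition msqrt {R : realType} {m : nat} (B : 'M[R]_m) : 'M[R]_m :=
  let p := xget (0, 0) (sqrt_decomp B) in
  p.1 *m map_mx Num.sqrt p.2 *m invmx p.1.

(* Main.v *)
(* Write t(x, y) = (1 + cos rho(x, y)) / 2, a squared modulus of a Hermitian product in homogeneous
   coordinates. Invariance of the law of U under enough explicit isometries (reflections, phases,
   triality maps in the octonionic case) determines every joint moment E[t(x, U)^i t(y, U)^k], by
   comparing coefficients in rotation identities. The moments are those of a Beta-type law, and
   finite-difference orthogonality of Jacobi polynomials against them gives the reproducing formula
   E[P_n(cos rho(x, U)) P_n(cos rho(y, U))] = a_n^-2 P_n(cos rho(x, y)). No integration over the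
   space is needed.

   Independence of U and the V_n then makes the terms orthogonal, with covariance
   B_n P_n(cos rho(x, y)). The squared L^2 distance of two partial sums at x is a difference of
   partial sums of the convergent series of diagonal entries of B_n P_n(1), so the series converges
   by completeness of L^2, and covariances pass to the limit by Cauchy-Schwarz. *)
Require Import Defs.
From HB Require Import structures.
From mathcomp Require Import all_boot all_order all_algebra.
From mathcomp Require Import all_classical all_reals all_analysis.
From mathcomp Require Import ring lra zify measurable_realfun.
From mathcomp Require complex.
Import Defs.
Set Implicit Arguments. Unset Strict Implicit. Unset Printing Implicit Defensive.
Import Order.TTheory GRing.Theory Num.Theory.
Import numFieldNormedType.Exports.
Local Open Scope ring_scope.
Local Open Scope classical_set_scope.


(** * Rising factorials *)

(** Uniformity is given only as invariance of a law under isometries, and over the octonions no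
    unitary group acts on coordinate vectors. The geometry is therefore reduced to the values of t
    at a finite frame: two vertices [E0], [E1], and points [Q m] that recover the real components of
    u_0 times the conjugate of u_1. What isometries must do to the frame is listed once; spheres,
    associative projective spaces and the Cayley plane differ only in how they supply it.

    Three facts fix the moments. The product |u_0|^2 |u_1|^2 is the sum of the squared components,
    and phase changes make these components interchangeable, so an even power of one component
    trades for a power of the product. Real rotations in the plane of u_0 and u_1 reduce E[p^i q^j]
    to E[p^(i+j)]. Unit trace gives the ratio of consecutive moments of p.

    A rotation by (x, y) on the circle is rewritten for the direction (1, y) with the factor sqrt(1
    + y^2) cleared. Both sides are then polynomials in a free real y, which is what makes
    coefficients comparable. *)

Definition rising {R : nzRingType} (x : R) (n : nat) : R := \prod_(i < n) (x + i%:R).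
Definition falling {R : nzRingType} (x : R) (n : nat) : R := \prod_(i < n) (x - i%:R).

Section Rising.
Variable R : realFieldType.
Implicit Types (x y : R) (n k : nat).

Lemma rising0 x : rising x 0 = 1.
Proof. by rewrite /rising big_ord0. Qed.

Lemma risingSr x n : rising x n.+1 = rising x n * (x + n%:R).
Proof. by rewrite /rising big_ord_recr. Qed.

Lemma risingSl x n : rising x n.+1 = x * rising (x + 1) n.
Proof.
rewrite /rising big_ord_recl addr0; congr (_ * _).
by apply: eq_bigr => i _; rewrite -addrA nat1r.
Qed.

Lemma risingD x m n : rising x (m + n) = rising x m * rising (x + m%:R) n.
Proof.
elim: n => [|n IH]; first by rewrite addn0 rising0 mulr1.
by rewrite addnS !risingSr IH natrD addrA mulrA.
Qed.

Lemma rising_gt0 x n : 0 < x -> 0 < rising x n.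
Proof.
move=> x0; elim: n => [|n IH]; first by rewrite rising0.
by rewrite risingSr mulr_gt0// ltr_pwDl.
Qed.

Lemma rising_neq0 x n : 0 < x -> rising x n != 0.
Proof. by move=> x0; rewrite gt_eqF// rising_gt0. Qed.

Lemma falling0 x : falling x 0 = 1.
Proof. by rewrite /falling big_ord0. Qed.

Lemma fallingSr x n : falling x n.+1 = falling x n * (x - n%:R).
Proof. by rewrite /falling big_ord_recr. Qed.

Lemma fallingSl x n : falling x n.+1 = x * falling (x - 1) n.
Proof.
rewrite /falling big_ord_recl subr0; congr (_ * _).
by apply: eq_bigr => i _; rewrite -addrA -opprD nat1r.
Qed.

Lemma falling_rising x n : falling (x + n%:R - 1) n = rising x n.
Proof.
elim: n => [|n IH]; first by rewrite falling0 rising0.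
rewrite fallingSl risingSr mulrC.
have -> : x + n.+1%:R - 1 = x + n%:R by rewrite -natr1; ring.
by rewrite IH.
Qed.

Lemma falling_nat n k : falling n%:R k = (n ^_ k)%:R :> R.
Proof.
elim: k => [|k IH]; first by rewrite falling0.
rewrite fallingSr IH ffactnSr natrM.
have [kn|nk] := leqP k n; first by rewrite natrB.
by rewrite ffact_small// !mul0r.
Qed.

Lemma sum_binS (f : nat -> R) n :
  \sum_(l < n.+2) 'C(n.+1, l)%:R * f l =
  \sum_(l < n.+1) 'C(n, l)%:R * f l + \sum_(l < n.+1) 'C(n, l)%:R * f l.+1.
Proof.
rewrite big_ord_recl bin0 mul1r.
under eq_bigr => l _ do rewrite lift0 binS natrD mulrDl.
rewrite big_split /= addrA; congr (_ + _).
rewrite big_ord_recr /= bin_small // mul0r addr0.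
by rewrite [in RHS]big_ord_recl bin0 mul1r.
Qed.

(** Pascal's rule splits the sum at n + 1 into the sum at n for (s, y) and y / s times the sum at n
    for (s + 1, y - 1). Both pairs have the same s + y, so induction with [s] and [y] general
    closes. It serves twice: for the leading Jacobi coefficient and for resumming the joint
    moments. *)
Lemma chu_vandermonde (s y : R) n : 0 < s ->
  \sum_(l < n.+1) 'C(n, l)%:R * (falling y l / rising s l) =
  rising (s + y) n / rising s n.
Proof.
elim: n s y => [|n IH] s y s0.
  by rewrite big_ord1 falling0 !rising0 divr1 bin0 mul1r.
rewrite (sum_binS (fun l => falling y l / rising s l)) IH//.
have -> : \sum_(l < n.+1) 'C(n, l)%:R * (falling y l.+1 / rising s l.+1) =
    y / s * \sum_(l < n.+1) 'C(n, l)%:R * (falling (y - 1) l / rising (s + 1) l).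
  rewrite mulr_sumr; apply: eq_bigr => l _.
  by rewrite fallingSl risingSl invfM; ring.
rewrite IH ?ltr_wpDr//.
have -> : s + 1 + (y - 1) = s + y by ring.
have sn0 : s + n%:R != 0 by rewrite gt_eqF// ltr_pwDl.
have := risingSr s n; rewrite risingSl => e.
rewrite !risingSr.
have -> : rising (s + 1) n = rising s n * (s + n%:R) / s.
  by rewrite -e mulrC mulKf// gt_eqF.
field; rewrite sn0 rising_neq0//= gt_eqF//.
Qed.

Lemma rising_diff y k : rising (y + 1) k.+1 - rising y k.+1 = k.+1%:R * rising (y + 1) k.
Proof. by rewrite risingSr risingSl -natr1; ring. Qed.

(** Each difference lowers the degree of a rising factorial by one ([rising_diff]), so the n-th
    difference kills degrees below n. This is the source of Jacobi orthogonality. *)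
Lemma finite_difference_rising y n k :
  \sum_(s < n.+1) 'C(n, s)%:R * ((-1) ^+ s * rising (y + (n - s)%:R) k) =
  if (k < n)%N then 0 else (k ^_ n)%:R * rising (y + n%:R) (k - n).
Proof.
elim: n y k => [|n IH] y k.
  by rewrite big_ord1 ffactn0 bin0 expr0 !mul1r subn0.
rewrite (sum_binS (fun s => (-1) ^+ s * rising (y + (n.+1 - s)%:R) k)).
have -> : \sum_(l < n.+1) 'C(n, l)%:R * ((-1) ^+ l * rising (y + (n.+1 - l)%:R) k) =
   \sum_(l < n.+1) 'C(n, l)%:R * ((-1) ^+ l * rising (y + 1 + (n - l)%:R) k).
  apply: eq_bigr => l _; congr (_ * (_ * rising _ _)).
  by rewrite (subSn (ltnSE (ltn_ord l))) -natr1; ring.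
under [X in _ + X]eq_bigr => l _ do rewrite exprS mulN1r mulNr mulrN subSS.
rewrite sumrN -sumrB.
case: k => [|k].
  by rewrite /= big1 // => i _; rewrite !rising0 subrr.
have -> : \sum_(i < n.+1)
   ('C(n, i)%:R * ((-1) ^+ i * rising (y + 1 + (n - i)%:R) k.+1) -
    'C(n, i)%:R * ((-1) ^+ i * rising (y + (n - i)%:R) k.+1)) =
   k.+1%:R * \sum_(i < n.+1) 'C(n, i)%:R * ((-1) ^+ i * rising (y + 1 + (n - i)%:R) k).
  rewrite mulr_sumr; apply: eq_bigr => i _.
  rewrite -!mulrBr.
  have -> : y + 1 + (n - i)%:R = y + (n - i)%:R + 1 by ring.
  by rewrite rising_diff; ring.
rewrite IH ltnS subSS; case: ifP => _; first by rewrite mulr0.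
by rewrite mulrA -natrM ffactSS -natr1; congr (_ * rising _ _); ring.
Qed.

End Rising.

(** * Jacobi polynomials *)

Section PolyMoment.
Variables (R : nzRingType) (mu : nat -> R).

Definition poly_mom (f : {poly R}) : R := \sum_(i < size f) f`_i * mu i.

Lemma poly_momE (f : {poly R}) n : (size f <= n)%N ->
  poly_mom f = \sum_(i < n) f`_i * mu i.
Proof.
move=> fn; rewrite /poly_mom (big_ord_widen n (fun i => f`_i * mu i))//.
rewrite big_mkcond; apply: eq_bigr => i _; case: ltnP => // si.
by rewrite nth_default// mul0r.
Qed.

Lemma poly_mom_is_linear : scalar poly_mom.
Proof.
move=> a f g.
have h1 : (size (a *: f + g)%R <= maxn (size f) (size g))%N.
  rewrite (leq_trans (size_polyD _ _))// geq_max leq_maxr andbT.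
  by rewrite (leq_trans (size_scale_leq _ _))// leq_maxl.
rewrite (poly_momE h1) (poly_momE (leq_maxl (size f) (size g))).
rewrite (poly_momE (leq_maxr (size f) (size g))) mulr_sumr -big_split /=.
by apply: eq_bigr => i _; rewrite coefD coefZ mulrDl mulrA.
Qed.

HB.instance Definition _ := GRing.isLinear.Build R {poly R} R *%R poly_mom
  poly_mom_is_linear.

Lemma poly_momXn n : poly_mom 'X^n = mu n.
Proof.
rewrite /poly_mom size_polyXn (bigD1 ord_max)//= coefXn eqxx mul1r big1 ?addr0//.
move=> i; rewrite -val_eqE /= => /negbTE ni.
by rewrite coefXn ni mul0r.
Qed.

End PolyMoment.

Section Jacobi.
Variables (R : realType) (al be : R).
Hypotheses (al_gt : 0 < al + 1) (be_gt : 0 < be + 1).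
Local Notation A := (al + 1).
Local Notation B := (be + 1).
Local Notation AB := (al + be + 2).

Let AB_gt : 0 < AB. Proof. assert (AB = A + B) as ->; [ring|exact: addr_gt0]. Qed.

(** The variable is r = (1 + x) / 2, so that x = cos rho corresponds to r = [half_cos]. *)
Definition jacobi_poly (n : nat) : {poly R} :=
  \sum_(s < n.+1) (gbinom (n%:R + al) (n - s) * gbinom (n%:R + be) s) *:
     (('X - 1%:P) ^+ s * 'X^(n - s)).

Lemma jacobiP_horner n (r : R) : jacobiP n al be (2 * r - 1) = (jacobi_poly n).[r].
Proof.
rewrite /jacobiP horner_sum; apply: eq_bigr => s _.
rewrite hornerZ hornerM !horner_exp !hornerE.
have -> : (2 * r - 1 - 1) / 2 = r - 1 by field.
have -> : (2 * r - 1 + 1) / 2 = r by field.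
by [].
Qed.

Lemma size_jacobi_poly n : (size (jacobi_poly n) <= n.+1)%N.
Proof.
apply: (leq_trans (size_sum _ _ _)); apply/bigmax_leqP => s _.
apply: (leq_trans (size_scale_leq _ _)).
rewrite size_Mmonic ?monicXn// ?expf_neq0 ?polyXsubC_eq0//.
rewrite size_exp_XsubC size_polyXn; have := ltn_ord s; lia.
Qed.

Lemma gbinom_rising (x : R) n s : (s <= n)%N -> 0 < x + 1 ->
  gbinom (n%:R + x) (n - s) = rising (x + 1) n / (rising (x + 1) s * (n - s)`!%:R).
Proof.
move=> sn x0; rewrite /gbinom -/(falling _ _).
have -> : n%:R + x = (x + 1 + s%:R) + (n - s)%:R - 1 by rewrite natrB//; ring.
have := risingD (x + 1) s (n - s); rewrite subnKC// falling_rising => ->.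
by rewrite invfM mulrACA mulfV ?mul1r// rising_neq0.
Qed.

Lemma coef_fact n s : (s <= n)%N ->
  (s`!%:R)^-1 * ((n - s)`!%:R)^-1 = 'C(n, s)%:R / n`!%:R :> R.
Proof.
move=> sn; rewrite -(bin_fact sn) !natrM.
have fact_neq0 k : k`!%:R != 0 :> R by rewrite pnatr_eq0 -lt0n fact_gt0.
have : 'C(n, s)%:R != 0 :> R by rewrite pnatr_eq0 -lt0n bin_gt0.
by move=> ?; field; rewrite !fact_neq0.
Qed.

(** Once the factors independent of s are pulled out, the denominators left are those that cancel
    against the Beta moments of [mom_XnC]. *)
Lemma jacobi_coef n s : (s <= n)%N ->
  gbinom (n%:R + al) (n - s) * gbinom (n%:R + be) s =
  rising A n * rising B n / n`!%:R * ('C(n, s)%:R / (rising A s * rising B (n - s))).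
Proof.
move=> sn; rewrite gbinom_rising//.
have := gbinom_rising (leq_subr s n) be_gt; rewrite (subKn sn) => ->.
rewrite !invfM.
transitivity (rising A n * rising B n * ((rising A s)^-1 * (rising B (n - s))^-1) *
  ((s`!%:R)^-1 * ((n - s)`!%:R)^-1)); first by ring.
by rewrite coef_fact//; ring.
Qed.

Lemma jacobi_polyE n : jacobi_poly n =
  (rising A n * rising B n / n`!%:R) *:
  \sum_(s < n.+1) ('C(n, s)%:R / (rising A s * rising B (n - s))) *:
     (('X - 1%:P) ^+ s * 'X^(n - s)).
Proof.
rewrite scaler_sumr; apply: eq_bigr => s _.
by rewrite (jacobi_coef (ltnSE (ltn_ord s))) scalerA.
Qed.

Lemma lead_XsubC1_Xn n (s : 'I_n.+1) : (('X - 1%:P) ^+ s * 'X^(n - s) : {poly R})`_n = 1.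
Proof.
rewrite coefMXn ltnNge leq_subr /= (subKn (ltnSE (ltn_ord s))).
have := monic_exp s (monicXsubC (1 : R)).
by rewrite monicE /lead_coef size_exp_XsubC /= => /eqP.
Qed.

(** Every (X - 1)^s X^(n-s) is monic of degree n, so the leading coefficient is the sum of all the
    coefficients, a Chu-Vandermonde sum after 1 / (B)_(n-s) is written over the common denominator
    (B)_n. *)
Lemma jacobi_lead n : (jacobi_poly n)`_n = rising (n%:R + al + be + 1) n / n`!%:R.
Proof.
rewrite jacobi_polyE coefZ coef_sum.
under eq_bigr => s _ do rewrite coefZ lead_XsubC1_Xn mulr1.
have -> : \sum_(s < n.+1) 'C(n, s)%:R / (rising A s * rising B (n - s)) =
   (rising B n)^-1 * \sum_(s < n.+1) 'C(n, s)%:R * (falling (n%:R + be) s / rising A s).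
  rewrite mulr_sumr; apply: eq_bigr => s _.
  have sn : (s <= n)%N by rewrite -ltnS.
  have -> : falling (n%:R + be) s = rising (B + (n - s)%:R) s.
    by rewrite -falling_rising; congr falling; rewrite natrB//; ring.
  have := risingD B (n - s) s; rewrite subnK// => ->.
  have r1 : rising (B + (n - s)%:R) s != 0 by rewrite rising_neq0// ltr_wpDr.
  have r2 := rising_neq0 s al_gt; have r3 := rising_neq0 (n - s) be_gt.
  by field; rewrite r1 r2 r3.
rewrite chu_vandermonde//.
have -> : A + (n%:R + be) = n%:R + al + be + 1 by ring.
have ? := rising_neq0 n al_gt; have ? := rising_neq0 n be_gt.
have ? : n`!%:R != 0 :> R by rewrite pnatr_eq0 -lt0n fact_gt0.
by field; apply/and3P.
Qed.

(** The moments of the Beta law on [0, 1] with parameters [B] and [A]. *)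
Let mu (i : nat) : R := rising B i / rising AB i.

(** The Beta integral, by induction on j through (1 - X)^(j+1) = (1 - X)^j - X (1 - X)^j. *)
Lemma mom_XnC i j :
  poly_mom mu ('X^i * (1 - 'X) ^+ j) = rising B i * rising A j / rising AB (i + j).
Proof.
elim: j i => [|j IH] i.
  by rewrite expr0 mulr1 poly_momXn rising0 mulr1 addn0.
have -> : 'X^i * (1 - 'X) ^+ j.+1 =
   'X^i * (1 - 'X) ^+ j - 'X^(i.+1) * (1 - 'X) ^+ j :> {poly R} by rewrite !exprS; ring.
rewrite linearB /= !IH addSn addnS !risingSr.
have ? := rising_neq0 (i + j) AB_gt.
have ? : AB + (i + j)%:R != 0 by rewrite gt_eqF// ltr_wpDr.
by rewrite natrD; field; rewrite -natrD; apply/andP.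
Qed.

Lemma exp_1subX j : (1 - 'X) ^+ j = (-1) ^+ j *: ('X - 1%:P) ^+ j :> {poly R}.
Proof. by rewrite -mul_polyC rmorphXn rmorphN rmorph1 -exprMn mulN1r opprB. Qed.

(** After cancellation each term keeps a sign (-1)^s, a binomial and a rising factorial of degree k
    at B + (n - s): an n-th finite difference, from which both branches of the conditional come. *)
Lemma mom_jacobi n k : poly_mom mu (jacobi_poly n * 'X^k) =
  if (k < n)%N then 0 else
  rising A n * rising B n / n`!%:R / rising AB (n + k) *
    ((k ^_ n)%:R * rising (B + n%:R) (k - n)).
Proof.
rewrite -[X in if _ then X else _](mulr0 (rising A n * rising B n / n`!%:R / rising AB (n + k))).
rewrite -(fun_if (fun x => _ * x)) -finite_difference_rising.
rewrite jacobi_polyE -scalerAl linearZ /= -[RHS]mulrA; congr (_ * _).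
rewrite mulr_suml linear_sum mulr_sumr /=; apply: eq_bigr => s _.
have sn : (s <= n)%N by rewrite -ltnS.
rewrite -scalerAl linearZ /= -[_ * 'X^(n - s) * 'X^k]mulrA -exprD.
have -> : ('X - 1%:P) ^+ s * 'X^(n - s + k) =
   (-1) ^+ s *: ('X^(n - s + k) * (1 - 'X) ^+ s) :> {poly R}.
  by rewrite exp_1subX -scalerAr scalerA -exprMn mulrNN mulr1 expr1n scale1r mulrC.
rewrite linearZ /= mom_XnC.
have -> : (n - s + k + s = n + k)%N by lia.
rewrite risingD.
have ? := rising_neq0 s al_gt; have ? := rising_neq0 (n - s) be_gt.
have ? := rising_neq0 (n + k) AB_gt.
by field; apply/and3P.
Qed.

Lemma mom_jacobi_poly n (g : {poly R}) : (size g <= n.+1)%N ->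
  poly_mom mu (jacobi_poly n * g) = g`_n * (rising A n * rising B n / rising AB (n + n)).
Proof.
move=> gn.
have -> : g = \sum_(l < n.+1) g`_l *: 'X^l.
  apply/polyP => i; rewrite coef_sum.
  under eq_bigr => l _ do rewrite coefZ coefXn.
  case: (ltnP i n.+1) => i_n.
    rewrite (bigD1 (Ordinal i_n))//= eqxx mulr1 big1 ?addr0// => l.
    by rewrite -val_eqE /= eq_sym => /negbTE ->; rewrite mulr0.
  rewrite nth_default ?(leq_trans gn)// big1// => l _.
  by rewrite gtn_eqF ?mulr0// (leq_trans (ltn_ord l)).
rewrite mulr_sumr linear_sum /= big_ord_recr /= big1 ?add0r; last first.
  by move=> l _; rewrite -scalerAr linearZ /= mom_jacobi ltn_ord mulr0.
rewrite -scalerAr linearZ /= mom_jacobi ltnn subnn rising0 mulr1 ffactnn.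
rewrite coef_sum.
under eq_bigr => l _ do rewrite coefZ coefXn.
rewrite (bigD1 ord_max)//= eqxx mulr1 big1 ?addr0; last first.
  by move=> l; rewrite -val_eqE /= eq_sym => /negbTE ->; rewrite mulr0.
congr (_ * _).
have ? : n`!%:R != 0 :> R by rewrite pnatr_eq0 -lt0n fact_gt0.
have ? := rising_neq0 (n + n) AB_gt.
by field; apply/andP.
Qed.

(** With c = t(x, y) this is the value of E[t(x, U)^i t(y, U)^k] established in [pair_mom_uniform].
    The factor [rising A j] is divided out and multiplied back in so that the last ratio is the Beta
    moment of X^(i+k-j) (1 - X)^j; sums over i then become [poly_mom] of a product. *)
Definition pair_mom (c : R) (i k : nat) : R :=
  \sum_(j < k.+1) 'C(k, j)%:R * c ^+ (k - j) * (1 - c) ^+ j *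
     (rising B k / (rising B (k - j) * rising A j)) *
     (rising B (i + (k - j)) * rising A j / rising AB (i + k)).

(** Leading coefficient of [jacobi_poly n] times the constant of [jacobi_pair_mom] at k = n;
    [a_const_sqr] identifies it with a_n^-2. *)
Definition jacobi_const n : R :=
  rising (n%:R + al + be + 1) n * rising B n / rising AB (n + n).

Lemma coef_Xn_1subXn n j : (j <= n)%N ->
  ('X^(n - j) * (1 - 'X) ^+ j : {poly R})`_n = (-1) ^+ j.
Proof.
move=> jn; rewrite mulrC coefMXn ltnNge leq_subr /= subKn//.
have := monic_exp j (monicXsubC (1 : R)).
rewrite monicE /lead_coef size_exp_XsubC /= => /eqP h.
by rewrite exp_1subX coefZ h mulr1.
Qed.

Lemma size_Xn_1subXn k j : (j <= k)%N ->
  (size (('X^(k - j) * (1 - 'X) ^+ j)%R : {poly R}) <= k.+1)%N.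
Proof.
move=> jk; rewrite mulrC size_Mmonic ?monicXn//; last first.
  by rewrite expf_neq0// -opprB oppr_eq0 polyXsubC_eq0.
by rewrite exp_1subX size_scale ?signr_eq0// size_exp_XsubC size_polyXn; lia.
Qed.

(** Summing over i turns the Beta moments into moments of [jacobi_poly n] times a polynomial of
    degree at most k, which only detect the coefficient of X^n. Nothing survives for k < n. For k =
    n that coefficient is (-1)^j, and (-1)^j (1 - c)^j = (c - 1)^j rebuilds the Jacobi polynomial at
    c. *)
Lemma jacobi_pair_mom (c : R) n k : (k <= n)%N ->
  \sum_(i < n.+1) (jacobi_poly n)`_i * pair_mom c i k =
  if (k < n)%N then 0 else
  n`!%:R * rising B n / rising AB (n + n) * (jacobi_poly n).[c].
Proof.
move=> kn.
have -> : \sum_(i < n.+1) (jacobi_poly n)`_i * pair_mom c i k =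
  \sum_(j < k.+1) 'C(k, j)%:R * c ^+ (k - j) * (1 - c) ^+ j *
     (rising B k / (rising B (k - j) * rising A j)) *
     poly_mom mu (jacobi_poly n * ('X^(k - j) * (1 - 'X) ^+ j)).
  rewrite /pair_mom; under eq_bigr => i _ do rewrite mulr_sumr.
  rewrite exchange_big /=; apply: eq_bigr => j _.
  have jk : (j <= k)%N by rewrite -ltnS.
  under eq_bigr => i _ do rewrite mulrCA.
  rewrite -mulr_sumr; congr (_ * _).
  have e : jacobi_poly n = \sum_(i < n.+1) (jacobi_poly n)`_i *: 'X^i.
    rewrite -poly_def; apply/polyP => i; rewrite coef_poly; case: ltnP => // ni.
    by rewrite nth_default// (leq_trans (size_jacobi_poly n)).
  rewrite [in RHS]e mulr_suml linear_sum; apply: eq_bigr => i _ /=.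
  rewrite -[in RHS]scalerAl [in RHS]linearZ /= [X in poly_mom _ X]mulrA -exprD mom_XnC.
  by have -> : (i + (k - j) + j = i + k)%N by lia.
case: ltnP => kn'.
  rewrite big1// => j _; have jk : (j <= k)%N by rewrite -ltnS.
  rewrite mom_jacobi_poly ?(leq_trans (size_Xn_1subXn jk))//.
  by rewrite nth_default ?mul0r ?mulr0// (leq_trans (size_Xn_1subXn jk)).
have {kn kn'} -> : k = n by lia.
rewrite [in RHS]jacobi_polyE hornerZ horner_sum !mulr_sumr; apply: eq_bigr => j _.
have jn : (j <= n)%N by rewrite -ltnS.
rewrite mom_jacobi_poly ?size_Xn_1subXn// coef_Xn_1subXn//.
rewrite hornerZ hornerM !horner_exp hornerXsubC hornerX -[c - 1]opprB [(- (1 - c)) ^+ j]exprNn.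
have ? := rising_neq0 j al_gt; have ? := rising_neq0 (n - j) be_gt.
have ? := rising_neq0 (n + n) AB_gt.
have ? : n`!%:R != 0 :> R by rewrite pnatr_eq0 -lt0n fact_gt0.
by field; apply/and4P.
Qed.

Lemma jacobi_reproducing (c : R) n :
  \sum_(k < n.+1) (jacobi_poly n)`_k *
     \sum_(i < n.+1) (jacobi_poly n)`_i * pair_mom c i k =
  jacobi_const n * (jacobi_poly n).[c].
Proof.
rewrite big_ord_recr /= big1 ?add0r; last first.
  by move=> k _; have kn := ltn_ord k; rewrite (jacobi_pair_mom _ (ltnW kn)) kn mulr0.
rewrite jacobi_pair_mom// ltnn jacobi_lead /jacobi_const.
have ? := rising_neq0 (n + n) AB_gt.
have ? : n`!%:R != 0 :> R by rewrite pnatr_eq0 -lt0n fact_gt0.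
by field; apply/andP.
Qed.

End Jacobi.

(** * The Gamma function *)

Section GammaFunction.
Context {R : realType}.
Notation mu := (@lebesgue_measure R).
Implicit Types (x a b t : R) (n : nat).

Let integrand x t : R := powR t (x - 1) * expR (- t).

(** Kept extended-real valued, because the functional equation is proved before finiteness and is
    used to deduce it. *)
Definition egamma x : \bar R := (\int[mu]_(t in [set t : R | (0 < t)%R]) (integrand x t)%:E)%E.

Let integrand_ge0 x t : 0 <= integrand x t.
Proof. by rewrite mulr_ge0 ?powR_ge0 ?expR_ge0. Qed.

Lemma egamma_ge0 x : (0 <= egamma x)%E.
Proof. by apply: integral_ge0 => t _; rewrite lee_fin. Qed.

Let is_derive_expN t : is_derive t 1 (fun t => - expR (- t) : R) (expR (- t)).
Proof.
by apply: is_derive_eq; rewrite mulrN1 opprK.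
Qed.

Let continuous_powR x t : 0 < t -> {for t, continuous (@powR R ^~ x)}.
Proof.
move=> t0; apply: differentiable_continuous; apply/derivable1_diffP.
by apply: derivable_powR; rewrite in_itv/= andbT.
Qed.

Let continuous_expN t : {for t, continuous (fun t => expR (- t) : R)}.
Proof. by apply: differentiable_continuous; apply/derivable1_diffP. Qed.

Lemma gamma_by_parts x a b : 0 <= x -> 0 < a -> a < b ->
  (\int[mu]_(t in `[a, b]) (powR t x * expR (- t))%:E =
   (powR a x * expR (- a) - powR b x * expR (- b))%:E +
   \int[mu]_(t in `[a, b]) (x * integrand x t)%:E)%E.
Proof.
move=> x0 a0 ab; have b0 : 0 < b by exact: lt_trans ab.
have pos t : t \in `[a, b]%R -> 0 < t.
  by rewrite in_itv/= => /andP[+ _]; exact: lt_le_trans.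
have poso t : t \in `]a, b[%R -> 0 < t.
  by rewrite in_itv/= => /andP[+ _]; exact: lt_trans.
rewrite (@integration_by_parts R (@powR R ^~ x) (fun t => - expR (- t))
   (fun t => x * powR t (x - 1)) (fun t => expR (- t)))//.
- congr (_ + _)%E; first by congr EFin; ring.
  rewrite -[RHS]oppeK; congr (- _)%E; rewrite -integral_ge0N; last first.
    by move=> t _; rewrite lee_fin mulr_ge0.
  by apply: eq_integral => t _; rewrite -EFinN /integrand; congr EFin; ring.
- apply: continuous_in_subspaceT => t /set_mem /= /pos t0.
  apply: cvgM; first exact: cvg_cst.
  exact: continuous_powR.
- split.
  + by move=> t /poso t0; apply: derivable_powR; rewrite in_itv/= andbT.
  + by apply/cvg_at_right_filter; apply: continuous_powR.
  + by apply/cvg_at_left_filter; apply: continuous_powR.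
- by move=> t /poso t0; rewrite powR_derive1// in_itv/= andbT.
- by apply: continuous_in_subspaceT => t _; exact: continuous_expN.
- split.
  + by move=> t _; exact: ex_derive.
  + by apply/cvg_at_right_filter; apply: cvgN; apply: continuous_expN.
  + by apply/cvg_at_left_filter; apply: cvgN; apply: continuous_expN.
- by move=> t _; rewrite derive1E; exact: derive_val.
Qed.

(** Compact intervals exhausting the positive half-line, away from the possible singularity at 0.
    The right end n + 2 makes the interval nondegenerate already at n = 0. *)
Let E n : set R := `[n.+1%:R^-1, n.+2%:R].

Let E_lt n : n.+1%:R^-1 < n.+2%:R :> R.
Proof.
rewrite (@le_lt_trans _ _ 1)//; last by rewrite ltr1n.
by rewrite invf_le1// ler1n.
Qed.

Let measurable_integrand x : measurable_fun [set: R] (integrand x).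
Proof.
apply: measurable_funM; first exact: measurable_powR.
by apply: measurableT_comp; [exact: measurable_expR|exact: oppr_measurable].
Qed.

Let E_bigcup : \bigcup_n E n = [set t : R | 0 < t].
Proof.
apply/seteqP; split => [t [n _]|t /= t0].
  by rewrite /E /= in_itv/= => /andP[+ _]; apply: lt_le_trans; rewrite invr_gt0.
exists (maxn (Num.truncn t) (Num.truncn t^-1)) => //; rewrite /E /= in_itv/=.
have nle k (y : R) : (Num.truncn y <= k)%N -> y <= k.+1%:R.
  by move=> yk; apply: ltW; rewrite -Num.Theory.truncn_le_nat.
apply/andP; split.
  by rewrite invf_ple ?posrE//; apply: nle; exact: leq_maxr.
by apply: (@le_trans _ _ (maxn (Num.truncn t) (Num.truncn t^-1)).+1%:R);
  [apply: nle; exact: leq_maxl | rewrite ler_nat].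
Qed.

Let nondecreasing_E : nondecreasing_seq E.
Proof.
move=> m n mn; rewrite subsetEset => t; rewrite /E /= !in_itv/= => /andP[h1 h2].
apply/andP; split.
  by apply: le_trans h1; rewrite lef_pV2 ?posrE// ler_nat.
by apply: (le_trans h2); rewrite ler_nat.
Qed.

Lemma egamma_cvg x : (\int[mu]_(t in E n) (integrand x t)%:E)%E @[n --> \oo] --> egamma x.
Proof.
rewrite /egamma -E_bigcup; apply: ge0_nondecreasing_set_cvg_integral.
- exact: nondecreasing_E.
- by move=> n; exact: measurable_itv.
- by move=> n; apply/measurable_EFinP; apply: measurable_funTS; exact: measurable_integrand.
- by move=> n t _; rewrite lee_fin.
Qed.

(** With y = n + 2 and an integer k >= x, the bound exp y >= y^(k+1) / (k+1)! gives y^x exp(-y) <=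
    (k+1)! / y. *)
Let powR_expN_cvg x : powR n.+2%:R x * expR (- n.+2%:R) @[n --> \oo] --> (0 : R).
Proof.
pose k := (Num.truncn x).+1.
have xk : x <= k%:R by apply: ltW; exact: Num.Theory.truncnS_gt.
apply: (@squeeze_cvgr _ _ _ _ (cst 0) (fun n => k.+1`!%:R * harmonic n)).
- apply: nearW => n; rewrite mulr_ge0 ?powR_ge0 ?expR_ge0//=.
  set y : R := n.+2%:R.
  have y0 : 0 < y by [].
  have y1 : 1 <= y by rewrite ler1n.
  apply: (@le_trans _ _ (y ^+ k * expR (- y))).
    rewrite ler_wpM2r ?expR_ge0//. rewrite -(powR_mulrn k (ltW y0)). exact: ler_powR.
  rewrite expRN.
  have h := expR_ge1Dxn k (ltW y0).
  have h2 : y ^+ k.+1 / k.+1`!%:R <= expR y by apply: le_trans h; rewrite lerDr.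
  have f0 : 0 < k.+1`!%:R :> R by rewrite ltr0n fact_gt0.
  rewrite ler_pdivrMr ?expR_gt0//.
  apply: (@le_trans _ _ (k.+1`!%:R * y^-1 * (y ^+ k.+1 / k.+1`!%:R))).
    rewrite exprS le_eqVlt; apply/orP; left; apply/eqP; field.
    by rewrite !gt_eqF.
  apply: ler_pM => //.
  + by rewrite mulr_ge0// ltW// invr_gt0.
  + by rewrite mulr_ge0// ?invr_ge0 ?exprn_ge0// ltW.
  + by rewrite ler_wpM2l ?(ltW f0)//= lef_pV2 ?posrE// ler_nat.
- exact: cvg_cst.
- have := cvgM (cvg_cst (k.+1`!%:R : R)) (@cvg_harmonic R).
  by rewrite mulr0; apply.
Qed.

Let powR_expN_cvg0 x : 0 < x ->
  powR n.+1%:R^-1 x * expR (- n.+1%:R^-1) @[n --> \oo] --> (0 : R).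
Proof.
move=> x0.
apply: (@squeeze_cvgr _ _ _ _ (cst 0) (fun n => powR n.+1%:R^-1 x)).
- apply: nearW => n; rewrite mulr_ge0 ?powR_ge0 ?expR_ge0//=.
  by rewrite ler_piMr ?powR_ge0// -expR0 ler_expR oppr_le0 invr_ge0.
- by apply: cvg_cst.
- have := powR_cvg0 x0; move/cvg_at_rightP; apply.
  by split=> [n|]; [rewrite invr_gt0|exact: cvg_harmonic].
Qed.

(** Integration by parts on [E n]; both boundary terms vanish in the limit, the one at the left end
    because x > 0. *)
Lemma egammaD1 x : 0 < x -> egamma (x + 1) = (x%:E * egamma x)%E.
Proof.
move=> x0.
have h1 := @egamma_cvg (x + 1).
have h2 : (\int[mu]_(t in E n) (integrand (x + 1) t)%:E)%E @[n --> \oo] -->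
   (0%E + x%:E * egamma x)%E.
  have -> : (fun n => \int[mu]_(t in E n) (integrand (x + 1) t)%:E)%E =
    (fun n => (powR n.+1%:R^-1 x * expR (- n.+1%:R^-1) -
              powR n.+2%:R x * expR (- n.+2%:R))%:E) \+
    (fun n => x%:E * \int[mu]_(t in E n) (integrand x t)%:E)%E.
    apply/funext => n.
    under eq_integral do rewrite /integrand addrK.
    rewrite gamma_by_parts ?invr_gt0 ?ltW//=; congr (_ + _)%E.
    under eq_integral do rewrite EFinM.
    rewrite ge0_integralZl_EFin ?ltW//.
    - by move=> t _; rewrite lee_fin.
    - by apply/measurable_EFinP; apply: measurable_funTS; exact: measurable_integrand.
  apply: cvgeD.
  - apply: ge0_adde_def; rewrite inE//.
    by apply: mule_ge0; [rewrite lee_fin ltW|exact: egamma_ge0].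
  - apply/cvg_EFin; first by apply: nearW.
    rewrite /comp /= -[0 in X in _ --> X](subr0 (0 : R)).
    by apply: cvgB; [exact: powR_expN_cvg0 | exact: powR_expN_cvg].
  - by apply: cvgeZl => //; exact: egamma_cvg.
rewrite add0e in h2.
exact: cvg_unique h1 h2.
Qed.

Lemma egamma1_le1 : (egamma 1 <= 1)%E.
Proof.
apply: (cvge_le _ (@egamma_cvg 1)); apply: nearW => n.
have := gamma_by_parts (lexx 0) (_ : 0 < n.+1%:R^-1) (E_lt n).
rewrite invr_gt0 ltr0n => /(_ isT).
rewrite [X in (_ + X)%E]integral0_eq; last by move=> t _; rewrite mul0r.
rewrite adde0 !powRr0 !mul1r /E /integrand subrr => ->.
by rewrite lee_fin lerBlDr ler_wpDr ?expR_ge0// -expR0 ler_expR oppr_le0 invr_ge0.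
Qed.

Let measurable_pos : measurable [set t : R | 0 < t].
Proof. by have -> : [set t : R | 0 < t] = `]0, +oo[ by apply/seteqP; split => t /=; rewrite in_itv/= andbT. Qed.

Lemma egamma_nat n : (egamma n.+1%:R < +oo)%E.
Proof.
elim: n => [|n IH]; first exact: le_lt_trans egamma1_le1 (ltry _).
rewrite -natr1 egammaD1// lte_mul_pinfty//; exact: egamma_ge0.
Qed.

(** For an argument at least 1 the integrand is dominated by the one for 1 when t <= 1 and by the
    one for a larger integer when t > 1. The functional equation then descends from x + 1 to any x >
    0. *)
Lemma egamma_lty x : 0 < x -> (egamma x < +oo)%E.
Proof.
have ge1 y : 1 <= y -> (egamma y < +oo)%E.
  move=> y1; pose k := (Num.truncn y).
  have yk : y <= k.+1%:R by apply: ltW; exact: Num.Theory.truncnS_gt.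
  apply: (@le_lt_trans _ _ (egamma 1 + egamma k.+1%:R)%E); last first.
    have h1 : (egamma 1 < +oo)%E by exact: le_lt_trans egamma1_le1 (ltry _).
    have h2 := egamma_nat k.
    exact: lte_add_pinfty.
  rewrite /egamma -ge0_integralD//; last 4 first.
  - by move=> t _; rewrite lee_fin.
  - by apply/measurable_EFinP; apply: measurable_funTS; exact: measurable_integrand.
  - by move=> t _; rewrite lee_fin.
  - by apply/measurable_EFinP; apply: measurable_funTS; exact: measurable_integrand.
  apply: ge0_le_integral => //.
  - by move=> t _; rewrite lee_fin.
  - by apply/measurable_EFinP; apply: measurable_funTS; exact: measurable_integrand.
  - by apply: emeasurable_funD; apply/measurable_EFinP; apply: measurable_funTS; exact: measurable_integrand.
  - move=> t /= t0; rewrite -EFinD lee_fin /integrand -mulrDl ler_wpM2r ?expR_ge0// subrr powRr0.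
    have [t1|t1] := leP t 1.
      rewrite ler_wpDr ?powR_ge0//.
      rewrite -[leRHS](powRr0 t).
      by apply: ger_powR; [rewrite t0 t1|rewrite subr_ge0].
    rewrite ler_wpDl//; apply: ler_powR; first exact: ltW.
    by rewrite lerD2r.
move=> x0; have h : (egamma (x + 1) < +oo)%E by apply: ge1; rewrite lerDr ltW.
move: h; rewrite egammaD1//.
have := egamma_ge0 x; case: (egamma x) => [r _ _|//|//]; first by rewrite ltry.
by rewrite gt0_muley ?lte_fin.
Qed.

(** For an argument at least 1 the integrand is at least exp(-2) on [1, 2]; the functional equation
    descends to any x > 0. *)
Lemma egamma_gt0 x : 0 < x -> (0 < egamma x)%E.
Proof.
have ge1 y : 1 <= y -> (0 < egamma y)%E.
  move=> y1; apply: (@lt_le_trans _ _ (\int[mu]_(t in `[1%R, 2%R]) (expR (- 2))%:E)%E).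
    rewrite integral_cst//= lebesgue_measure_itv/= lte_fin ltr1n/= -EFinB -EFinM lte_fin.
    by rewrite mulr_gt0 ?expR_gt0// subr_gt0 ltr1n.
  apply: (@le_trans _ _ (\int[mu]_(t in `[1%R, 2%R]) (integrand y t)%:E)%E).
    apply: ge0_le_integral => //.
    - by apply/measurable_EFinP; apply: measurable_funTS; exact: measurable_integrand.
    - move=> t; rewrite /= in_itv/= => /andP[t1 t2]; rewrite lee_fin /integrand.
      rewrite -[leLHS]mul1r ler_pM// ?expR_ge0//.
        by rewrite -[leLHS](powRr0 t); apply: ler_powR => //; rewrite subr_ge0.
      by rewrite ler_expR lerN2.
  apply: ge0_subset_integral => //.
  - by apply/measurable_EFinP; apply: measurable_funTS; exact: measurable_integrand.
  - by move=> t _; rewrite lee_fin.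
  - by move=> t /=; rewrite in_itv/= => /andP[t1 _]; exact: lt_le_trans t1.
move=> x0; have : (0 < egamma (x + 1))%E by apply: ge1; rewrite lerDr ltW.
by rewrite egammaD1// pmule_rgt0// lte_fin.
Qed.

Lemma Gamma_gt0 x : 0 < x -> 0 < Gamma x.
Proof. by move=> x0; rewrite fine_gt0// egamma_gt0// egamma_lty. Qed.

Lemma GammaD1 x : 0 < x -> Gamma (x + 1) = x * Gamma x.
Proof.
move=> x0; rewrite /Gamma -/(egamma (x + 1)) -/(egamma x) egammaD1// fineM//.
by rewrite ge0_fin_numE ?egamma_lty// egamma_ge0.
Qed.

End GammaFunction.

(** * Reflections and the spectral theorem *)

Section Reflections.
Variable R : realType.

Definition dot {n} (u v : 'cV[R]_n) : R := \sum_i u i 0 * v i 0.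

Lemma dotE n (u v : 'cV[R]_n) : u^T *m v = (dot u v)%:M.
Proof.
by apply/matrixP => i j; rewrite !ord1 !mxE; apply: eq_bigr => k _; rewrite mxE.
Qed.

Lemma dotC n (u v : 'cV[R]_n) : dot u v = dot v u.
Proof. by apply: eq_bigr => i _; rewrite mulrC. Qed.

Lemma dotBl n (u v w : 'cV[R]_n) : dot (u - v) w = dot u w - dot v w.
Proof. by rewrite /dot -sumrB; apply: eq_bigr => i _; rewrite !mxE mulrBl. Qed.

Lemma dotBr n (u v w : 'cV[R]_n) : dot w (u - v) = dot w u - dot w v.
Proof. by rewrite dotC dotBl !(dotC w). Qed.

Lemma dotZl n a (u w : 'cV[R]_n) : dot (a *: u) w = a * dot u w.
Proof. by rewrite /dot mulr_sumr; apply: eq_bigr => i _; rewrite !mxE mulrA. Qed.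

Lemma dot_ge0 n (u : 'cV[R]_n) : 0 <= dot u u.
Proof. by apply: sumr_ge0 => i _; rewrite -expr2 sqr_ge0. Qed.

Lemma dot_eq0 n (u : 'cV[R]_n) : dot u u = 0 -> u = 0.
Proof.
move=> h; apply/matrixP => i j; rewrite ord1 mxE.
have h0 k : true -> 0 <= u k 0 * u k 0 by rewrite -expr2 sqr_ge0.
by have /eqP := psumr_eq0P h0 h (i:=i) isT; rewrite mulf_eq0 orbb => /eqP.
Qed.

(* The Householder reflection in the bisecting hyperplane of [u] and [v]. *)
Lemma exists_reflection n (u v : 'cV[R]_n) : dot u u = dot v v ->
  exists O : 'M[R]_n, [/\ O^T = O, O *m O = 1%:M, O *m u = v
    & forall x, dot (u - v) x = 0 -> O *m x = x].
Proof.
move=> uv; have [w0|/eqP w0] := eqVneq (u - v) 0.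
  exists 1%:M; rewrite trmx1 mul1mx; split => // [|x _]; last by rewrite mul1mx.
  by rewrite mul1mx; apply/eqP; rewrite -subr_eq0 w0.
set w := u - v in w0 *; set s := dot w w.
have s0 : s != 0 by apply/eqP => /dot_eq0.
pose O := 1%:M - (2 / s) *: (w *m w^T).
have Ox x : O *m x = x - (2 / s * dot w x) *: w.
  by rewrite mulmxBl mul1mx -scalemxAl -mulmxA dotE -scalemx1 -scalemxAr mulmx1 scalerA.
have OT : O^T = O by rewrite linearB linearZ /= trmx1 trmx_mul trmxK.
have OO : O *m O = 1%:M.
  have WW : w *m w^T *m (w *m w^T) = s *: (w *m w^T).
    by rewrite mulmxA -(mulmxA w) dotE -/s -scalemx1 -scalemxAr mulmx1 -scalemxAl.
  rewrite /O mulmxBl mul1mx mulmxBr mulmx1 -scalemxAl -scalemxAr scalerA WW scalerA.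
  have -> : 2 / s * (2 / s) * s = 2 / s + 2 / s by field.
  by rewrite scalerDl opprB addrK subrK.
exists O; split => //; last by move=> x wx; rewrite Ox wx mulr0 scale0r subr0.
rewrite Ox (_ : 2 / s * dot w u = 1); first by rewrite scale1r /w opprB addrC subrK.
have e : s = 2 * dot w u by rewrite /s dotBr !dotBl uv (dotC v u); ring.
by rewrite mulrAC -e mulfV.
Qed.

End Reflections.

Section RealSpectral.
Variable R : realType.

Import complex.

(** Over the complex numbers the matrix is Hermitian and has a real eigenvalue. Being a root of a
    characteristic polynomial with real coefficients, it is already an eigenvalue over [R], with a
    real eigenvector to be normalized. *)
Lemma symmetric_real_eigenvalue n (A : 'M[R]_n.+1) : A^T = A ->
  exists2 v : 'cV[R]_n.+1, dot v v = 1 & exists l, A *m v = l *: v.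
Proof.
move=> AT; pose AC : 'M[R[i]]_n.+1 := map_mx (real_complex R) A.
have ACr : AC \is a realmx.
  by apply/mxOverP => i j; rewrite mxE; apply/complex_realP; exists (A i j).
have ACs : AC \is symmetricmx.
  by apply/is_hermitianmxP; rewrite expr0 scale1r; apply/matrixP => i j; rewrite !mxE -[in LHS]AT mxE.
have ACh := realsym_hermsym ACs ACr.
have /orthomx_spectralP AE := hermitian_normalmx ACh.
have /mxOverP/(_ 0 0)/RRe_real := hermitian_spectral_diag_real ACh.
set a := complex.Re _ => aE.
have : eigenvalue AC (a%:C)%C.
  apply/eigenvalueP; exists (row 0 (spectralmx AC)).
    have : spectralmx AC *m AC = diag_mx (spectral_diag AC) *m spectralmx AC.
      by rewrite [in X in _ *m X]AE !mulmxA mulmxV ?spectral_unit// mul1mx.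
    move/(congr1 (row 0)); rewrite row_mul => ->.
    by rewrite row_mul row_diag_mx -scalemxAl -rowE aE.
  apply/eqP => r0; have := spectral_unit AC.
  rewrite -row_free_unit => /row_freeP[B hB].
  have := congr1 (row 0) hB; rewrite row_mul r0 mul0mx => /matrixP/(_ 0 0).
  by rewrite !mxE eqxx => /esym/eqP; rewrite oner_eq0.
rewrite eigenvalue_root_char -map_char_poly fmorph_root -eigenvalue_root_char.
move=> /eigenvalueP[v vA v0]; pose u := v^T.
have u0 : dot u u != 0.
  by apply: contra v0 => /eqP/dot_eq0 h; rewrite -(trmxK v) -/u h trmx0.
have up : 0 < dot u u by rewrite lt0r u0 dot_ge0.
have Au : A *m u = a *: u by rewrite -[A]trmxK -trmx_mul AT vA linearZ.
exists ((Num.sqrt (dot u u))^-1 *: u).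
  rewrite dotZl dotC dotZl mulrA -expr2 exprVn sqr_sqrtr ?ltW//.
  by rewrite mulVf.
by exists a; rewrite -scalemxAr Au !scalerA mulrC.
Qed.

(** Deflation: the reflection exchanging the first basis vector with a unit eigenvector conjugates
    [A] to block diagonal form, and the lower block is symmetric of smaller size. *)
Lemma real_spectral n (A : 'M[R]_n) : A^T = A ->
  exists p : 'M[R]_n * 'M[R]_n,
    [/\ p.1 *m p.1^T = 1%:M, is_diag_mx p.2 & A = p.1 *m p.2 *m p.1^T].
Proof.
elim: n A => [|n IH] A AT.
  exists (1%:M, A) => /=; split.
  - by rewrite trmx1 mulmx1.
  - by apply/is_diag_mxP => -[].
  - by apply/matrixP => -[].
have [v v1 [l Av]] := symmetric_real_eigenvalue AT.
pose e : 'cV[R]_(1 + n) := delta_mx 0 0.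
have e1 : dot e e = 1.
  rewrite /dot (bigD1 0)//= !mxE eqxx mulr1 big1 ?addr0// => i i0.
  by rewrite !mxE (negbTE i0) mul0r.
have [Q [QT QQ Qe _]] := exists_reflection (etrans e1 (esym v1)).
pose A' : 'M[R]_(1 + n) := Q *m A *m Q.
have A't : A'^T = A' by rewrite !trmx_mul QT AT mulmxA.
have A'e : A' *m e = l *: e.
  rewrite /A' -mulmxA Qe -mulmxA Av -scalemxAr; congr (_ *: _).
  by rewrite -Qe mulmxA QQ mul1mx.
have A'0 i : A' i 0 = l * (i == 0)%:R.
  by have /matrixP/(_ i 0) := A'e; rewrite -colE !mxE eqxx andbT.
have l0 : lshift n (0 : 'I_1) = 0 by apply: val_inj.
have A'b : A' = block_mx l%:M 0 0 (drsubmx A').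
  rewrite -[LHS]submxK; congr block_mx; apply/matrixP => i j; rewrite ?ord1.
  - by rewrite mxE mxE l0 A'0 !mxE eqxx mulr1 mulr1n.
  - by rewrite -A't mxE mxE mxE l0 A'0 mxE mulr0.
  - by rewrite mxE mxE l0 A'0 mxE mulr0.
have [[S D] /= [SS DD AE]] : exists p : 'M[R]_n * 'M[R]_n,
    [/\ p.1 *m p.1^T = 1%:M, is_diag_mx p.2 & drsubmx A' = p.1 *m p.2 *m p.1^T].
  by apply: IH; rewrite trmx_drsub A't.
pose S' : 'M[R]_(1 + n) := block_mx 1%:M 0 0 S.
pose D' : 'M[R]_(1 + n) := block_mx l%:M 0 0 D.
have S'S' : S' *m S'^T = 1%:M.
  rewrite /S' tr_block_mx mulmx_block.
  rewrite trmx1 !trmx0 !mulmx0 !mul0mx !mulmx1 !addr0 add0r SS.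
  by rewrite -scalar_mx_block.
have D'd : is_diag_mx D'.
  apply/is_diag_mxP => i j; rewrite /D'.
  case: (split_ordP i) => i' ->; case: (split_ordP j) => j' -> ne.
  + by move: ne; rewrite !ord1 eqxx.
  + by rewrite block_mxEur mxE.
  + by rewrite block_mxEdl mxE.
  + rewrite block_mxEdr; move/is_diag_mxP: DD; apply.
    by apply: contra ne => /eqP ij; apply/eqP; congr (_ + _)%N.
have A'E : A' = S' *m D' *m S'^T.
  rewrite [LHS]A'b AE /S' /D' tr_block_mx !mulmx_block trmx1 !trmx0.
  by rewrite ?(mulmx0, mul0mx, mulmx1, mul1mx, addr0, add0r).
exists (Q *m S', D') => /=; split => //.
- by rewrite trmx_mul QT mulmxA -(mulmxA Q) S'S' mulmx1 QQ.
- have -> : A = Q *m A' *m Q by rewrite /A' !mulmxA QQ mul1mx -mulmxA QQ mulmx1.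
  by rewrite A'E trmx_mul QT !mulmxA.
Qed.

(** [msqrt] picks a decomposition by choice, so one has to exist: [real_spectral] provides it. The
    diagonal is nonnegative because [B] is tested on the columns of S. *)
Lemma msqrt_mul_trmx n (B : 'M[R]_n) : sym_nnd B -> msqrt B *m (msqrt B)^T = B.
Proof.
move=> [BT Bnn]; rewrite /msqrt.
have : exists p, sqrt_decomp B p.
  have [p [h1 h2 h3]] := real_spectral BT; exists p; split => //.
  have /mulmx1_unit[u _] := h1.
  by rewrite -[invmx _]mulmx1 -h1 mulKmx.
move=> [p /(xgetI (0, 0))].
case: xget => S D /= [SS DD BE].
have /mulmx1_unit[u _] := SS.
have SV : invmx S = S^T by rewrite -[invmx _]mulmx1 -SS mulKmx.
have SS' : S^T *m S = 1%:M by rewrite -SV mulVmx.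
rewrite SV in BE *.
have D0 i : 0 <= D i i.
  have := Bnn (S *m delta_mx i 0); rewrite BE trmx_mul !mulmxA -(mulmxA _ S^T) SS' mulmx1.
  rewrite -(mulmxA _ S^T S) SS' mulmx1 trmx_delta -rowE -colE !mxE.
  by [].
rewrite !trmx_mul trmxK !mulmxA -(mulmxA _ S^T S) SS' mulmx1.
rewrite [RHS]BE; congr (_ *m _); rewrite -mulmxA; congr (_ *m _).
(* Since the square root of 0 is 0, the entrywise root of a diagonal matrix is still diagonal. *)
apply/matrixP => i j; rewrite !mxE (bigD1 i)//= big1 ?addr0; last first.
  move=> k ki; rewrite !mxE; have /is_diag_mxP -> := DD; last by rewrite eq_sym.
  by rewrite sqrtr0 mul0r.
rewrite !mxE; have [<-|ij] := eqVneq i j; first by rewrite -expr2 sqr_sqrtr.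
have /is_diag_mxP DD' := DD.
by rewrite (DD' j i) 1?eq_sym// (DD' i j)// sqrtr0 mulr0.
Qed.

End RealSpectral.

(** * Expectations *)

Section Expectation.
Context {R : realType} {dT : measure_display} {T : measurableType dT}.
Variable P : probability T R.
Implicit Types (f g h : T -> R).

Definition intg f := P.-integrable setT (EFin \o f).

Lemma intg_measurable f : intg f -> measurable_fun setT f.
Proof. by move=> /integrableP[/measurable_EFinP]. Qed.

Lemma intg_le f g : measurable_fun setT f -> intg g ->
  (forall w, `|f w| <= `|g w|) -> intg f.
Proof.
move=> mf ig fg; apply: le_integrable ig => //; first exact/measurable_EFinP.
by move=> w _ /=; rewrite lee_fin.
Qed.

Lemma intg_cst (c : R) : intg (fun=> c).
Proof. exact: finite_measure_integrable_cst. Qed.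

Lemma intgD f g : intg f -> intg g -> intg (fun w => f w + g w).
Proof. by move=> i1 i2; have := integrableD measurableT i1 i2; apply: eq_integrable. Qed.

Lemma intgZ (c : R) f : intg f -> intg (fun w => c * f w).
Proof. by move=> i1; have := integrableZl measurableT c i1; apply: eq_integrable. Qed.

Lemma intgN f : intg f -> intg (fun w => - f w).
Proof. by move=> /(intgZ (-1)); under [X in intg X]eq_fun do rewrite mulN1r. Qed.

Lemma intgB f g : intg f -> intg g -> intg (fun w => f w - g w).
Proof. by move=> i1 /intgN; exact: intgD. Qed.

Lemma intg_sum I (s : seq I) (F : I -> T -> R) : (forall i, intg (F i)) ->
  intg (fun w => \sum_(i <- s) F i w).
Proof.
move=> h; elim: s => [|i s IH].
  by under [X in intg X]eq_fun do rewrite big_nil; exact: intg_cst.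
by under [X in intg X]eq_fun do rewrite big_cons; exact: intgD.
Qed.

Lemma intg_norm f : intg f -> intg (fun w => `|f w|).
Proof.
move=> i; apply: (intg_le _ i) => [|w]; last by rewrite normr_id.
by apply: measurableT_comp => //; exact: intg_measurable.
Qed.

Lemma Expe_cst c : Expe P (fun=> c) = c.
Proof.
by rewrite /Expe integral_cst//= probability_setT mule1.
Qed.

Lemma ExpeD f g : intg f -> intg g -> Expe P (fun w => f w + g w) = Expe P f + Expe P g.
Proof. by move=> i1 i2; exact: (RintegralD measurableT i1 i2). Qed.

Lemma ExpeZ (c : R) f : intg f -> Expe P (fun w => c * f w) = c * Expe P f.
Proof. by move=> i1; exact: (RintegralZl c measurableT i1). Qed.

Lemma ExpeN f : intg f -> Expe P (fun w => - f w) = - Expe P f.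
Proof.
move=> i; rewrite -mulN1r -ExpeZ//; congr (Expe P _).
by apply/funext => w; rewrite mulN1r.
Qed.

Lemma ExpeB f g : intg f -> intg g -> Expe P (fun w => f w - g w) = Expe P f - Expe P g.
Proof. by move=> i1 i2; rewrite ExpeD ?ExpeN//; exact: intgN. Qed.

Lemma Expe_sum I (s : seq I) (F : I -> T -> R) : (forall i, intg (F i)) ->
  Expe P (fun w => \sum_(i <- s) F i w) = \sum_(i <- s) Expe P (F i).
Proof.
move=> h; elim: s => [|i s IH].
  rewrite big_nil -[RHS](Expe_cst 0); congr (Expe P _).
  by apply/funext => w; rewrite big_nil.
rewrite big_cons -IH -ExpeD//; last exact: intg_sum.
by congr (Expe P _); apply/funext => w; rewrite big_cons.
Qed.

Lemma Expe_ge0 f : (forall w, 0 <= f w) -> 0 <= Expe P f.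
Proof. by move=> h; apply: fine_ge0; apply: integral_ge0 => w _; rewrite lee_fin. Qed.

Lemma Expe_le f g : intg f -> intg g -> (forall w, f w <= g w) -> Expe P f <= Expe P g.
Proof.
by move=> i1 i2 fg; rewrite -subr_ge0 -ExpeB//; apply: Expe_ge0 => w; rewrite subr_ge0.
Qed.

Lemma EFin_Expe f : intg f -> (Expe P f)%:E = (\int[P]_w (f w)%:E)%E.
Proof. by move=> i; rewrite fineK//; exact: integrable_fin_num. Qed.

(** Bounded measurable functions form an algebra of integrable functions, so polynomial moments need
    no separate integrability argument. *)
Definition bmf f := measurable_fun setT f /\ exists M, forall w, `|f w| <= M.

Lemma bmf_intg f : bmf f -> intg f.
Proof.
move=> [mf [M fM]]; apply: (intg_le mf (intg_cst M)) => w.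
by rewrite (le_trans (fM w))// ler_norm.
Qed.

Lemma bmf_cst c : bmf (fun=> c).
Proof. by split; [exact: measurable_cst | exists `|c|]. Qed.

Lemma bmfD f g : bmf f -> bmf g -> bmf (fun w => f w + g w).
Proof.
move=> [mf [M fM]] [mg [N gN]]; split; first exact: measurable_funD.
by exists (M + N) => w; rewrite (le_trans (ler_normD _ _))// lerD.
Qed.

Lemma bmfM f g : bmf f -> bmf g -> bmf (fun w => f w * g w).
Proof.
move=> [mf [M fM]] [mg [N gN]]; split; first exact: measurable_funM.
by exists (M * N) => w; rewrite normrM ler_pM.
Qed.

Lemma bmfX n f : bmf f -> bmf (fun w => f w ^+ n).
Proof.
move=> h; elim: n => [|n IH].
  by under [X in bmf X]eq_fun do rewrite expr0; exact: bmf_cst.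
by under [X in bmf X]eq_fun do rewrite exprS; exact: bmfM.
Qed.

Lemma bmf_sum I (s : seq I) (F : I -> T -> R) : (forall i, bmf (F i)) ->
  bmf (fun w => \sum_(i <- s) F i w).
Proof.
move=> h; elim: s => [|i s IH].
  by under [X in bmf X]eq_fun do rewrite big_nil; exact: bmf_cst.
by under [X in bmf X]eq_fun do rewrite big_cons; exact: bmfD.
Qed.

Lemma intg_bmfM f g : bmf f -> intg g -> intg (fun w => f w * g w).
Proof.
move=> [mf [M fM]] ig; apply: (intg_le _ (intgZ M (intg_norm ig))).
  by apply: measurable_funM => //; exact: intg_measurable.
move=> w; rewrite !normrM normr_id ler_pM//.
by rewrite (le_trans (fM w))// ler_norm.
Qed.

Lemma Expe_horner2 (p q : {poly R}) f g m n : bmf f -> bmf g ->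
  (size p <= m)%N -> (size q <= n)%N ->
  Expe P (fun w => p.[f w] * q.[g w]) =
  \sum_(k < n) q`_k * \sum_(i < m) p`_i * Expe P (fun w => f w ^+ i * g w ^+ k).
Proof.
move=> bf bg pm qn.
transitivity (Expe P (fun w => \sum_(k < n) q`_k * \sum_(i < m) p`_i * (f w ^+ i * g w ^+ k))).
  congr (Expe P _); apply/funext => w.
  rewrite (horner_coef_wide _ pm) (horner_coef_wide _ qn) mulrC mulr_suml.
  apply: eq_bigr => k _; rewrite -mulrA; congr (_ * _).
  by rewrite mulr_sumr; apply: eq_bigr => i _; ring.
have b i k : intg (fun w => f w ^+ i * g w ^+ k).
  by apply: bmf_intg; apply: bmfM; exact: bmfX.
rewrite Expe_sum; last by move=> k; apply: intgZ; apply: intg_sum => i; exact: intgZ.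
apply: eq_bigr => k _; rewrite ExpeZ; last by apply: intg_sum => i; exact: intgZ.
congr (_ * _); rewrite Expe_sum; last by move=> i; exact: intgZ.
by apply: eq_bigr => i _; rewrite ExpeZ.
Qed.

(** Both expectations are integrals of the identity against the pushforward laws, which agree. *)
Lemma Expe_same_law f g : measurable_fun setT f -> measurable_fun setT g ->
  intg f -> (forall B, measurable B -> P (f @^-1` B) = P (g @^-1` B)) ->
  intg g -> Expe P f = Expe P g.
Proof.
move=> mf mg i1 fg i2; rewrite /Expe; congr fine.
pose F : {mfun T >-> R} := HB.pack f (isMeasurableFun.Build _ _ _ _ f mf).
pose G : {mfun T >-> R} := HB.pack g (isMeasurableFun.Build _ _ _ _ g mg).
have mE : measurable_fun setT (@EFin R) by exact/measurable_EFinP.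
have e1 := @integral_distribution _ _ _ _ _ P F (@EFin R) mE i1.
have e2 := @integral_distribution _ _ _ _ _ P G (@EFin R) mE i2.
rewrite /comp /= in e1 e2; rewrite -e1 -e2.
by apply: eq_measure_integral => A mA _; exact: fg.
Qed.

(* The joint law of independent variables is the product of the marginals; conclude by Fubini. *)
Lemma Expe_indep_mul f g : intg f -> intg g -> intg (fun w => f w * g w) ->
  (forall A B, measurable A -> measurable B ->
     P (f @^-1` A `&` g @^-1` B) = (P (f @^-1` A) * P (g @^-1` B))%E) ->
  Expe P (fun w => f w * g w) = Expe P f * Expe P g.
Proof.
move=> i1 i2 i12 ind.
have mf := intg_measurable i1; have mg := intg_measurable i2.
pose F : {mfun T >-> R} := HB.pack f (isMeasurableFun.Build _ _ _ _ f mf).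
pose G : {mfun T >-> R} := HB.pack g (isMeasurableFun.Build _ _ _ _ g mg).
have mfg := measurable_fun_pair mf mg.
pose FG : {mfun T >-> (R * R)%type} := HB.pack (fun w => (f w, g w))
  (isMeasurableFun.Build _ _ _ _ (fun w => (f w, g w)) mfg).
have mE : measurable_fun setT (@EFin R) by exact/measurable_EFinP.
pose m (z : R * R) := (z.1 * z.2)%:E.
have mm : measurable_fun setT m.
  by apply/measurable_EFinP; exact: measurable_funM.
have iFG : (distribution P FG).-integrable setT m.
  exact: (@integrable_pushforward _ _ _ _ _ _ mfg P setT m mm i12 measurableT).
have prodE := @product_measure_unique _ _ _ _ R (distribution P F) (distribution P G)
  (distribution P FG) ind.
have iprod : (distribution P F \x distribution P G)%E.-integrable setT m.
  apply/integrableP; split => //; move/integrableP : iFG => [_]; apply: le_lt_trans.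
  rewrite le_eqVlt; apply/orP; left; apply/eqP.
  by apply: eq_measure_integral => A mA _; exact: prodE.
have e1 := @integral_distribution _ _ _ _ _ P F (@EFin R) mE i1.
have e2 := @integral_distribution _ _ _ _ _ P G (@EFin R) mE i2.
have iF := @integrable_pushforward _ _ _ _ _ _ mf P setT (@EFin R) mE i1 measurableT.
have iG := @integrable_pushforward _ _ _ _ _ _ mg P setT (@EFin R) mE i2 measurableT.
apply: EFin_inj; rewrite EFinM !EFin_Expe//.
transitivity (\int[distribution P FG]_z m z)%E.
  by rewrite (integral_distribution mm).
transitivity (\int[distribution P F \x distribution P G]_z m z)%E.
  by apply: eq_measure_integral => A mA _; rewrite [RHS]prodE.
rewrite -integral12_prod_meas1// /fubini_F /m /=.
transitivity (\int[distribution P F]_x ((Expe P g)%:E * x%:E))%E.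
  apply: eq_integral => x _.
  under eq_integral do rewrite EFinM.
  rewrite integralZl// muleC EFin_Expe//; congr (_ * _)%E.
  by rewrite e2.
rewrite integralZl// muleC EFin_Expe//; congr (_ * _)%E.
by rewrite e1.
Qed.

End Expectation.

(** * Square-integrable functions and completeness *)

Section SquareIntegrable.
Context {R : realType} {dT : measure_display} {T : measurableType dT}.
Variable P : probability T R.
Implicit Types (f g h : T -> R).

Definition L2 f := measurable_fun setT f /\ P.-integrable setT (fun w => ((f w) ^+ 2)%:E).

Definition norm2 f : R := Expe P (fun w => f w ^+ 2).

Lemma L2_sqr f : L2 f -> intg P (fun w => f w ^+ 2).
Proof. by case. Qed.

Lemma L2_mul f g : L2 f -> L2 g -> intg P (fun w => f w * g w).
Proof.
move=> [mf if2] [mg ig2].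
apply: (intg_le _ (intgD if2 ig2)); first exact: measurable_funM.
move=> w /=; rewrite (ger0_norm (addr_ge0 (sqr_ge0 _) (sqr_ge0 _))) ler_norml.
have h1 := sqr_ge0 (f w + g w); have h2 := sqr_ge0 (f w - g w).
have h3 := sqr_ge0 (f w); have h4 := sqr_ge0 (g w).
rewrite sqrrD in h1; rewrite sqrrB in h2; apply/andP; split; lra.
Qed.

Lemma L2_bmf f : bmf f -> L2 f.
Proof. by move=> bf; split; [case: bf|apply: bmf_intg; exact: bmfX]. Qed.

Lemma L2_intg f : L2 f -> intg P f.
Proof.
move=> h; have := L2_mul h (L2_bmf (bmf_cst 1)).
by under [X in intg _ X]eq_fun do rewrite mulr1.
Qed.

Lemma L2D f g : L2 f -> L2 g -> L2 (fun w => f w + g w).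
Proof.
move=> hf hg; split; first by apply: measurable_funD; [case: hf|case: hg].
have := intgD (intgD (L2_sqr hf) (L2_sqr hg)) (intgZ 2 (L2_mul hf hg)).
by apply: eq_integrable => // w _ /=; congr EFin; ring.
Qed.

Lemma L2_bmfM f g : bmf f -> L2 g -> L2 (fun w => f w * g w).
Proof.
move=> bf hg; split; first by apply: measurable_funM; [case: bf|case: hg].
have := intg_bmfM (bmfX 2 bf) (L2_sqr hg).
by apply: eq_integrable => // w _ /=; rewrite exprMn.
Qed.

Lemma L2Z c f : L2 f -> L2 (fun w => c * f w).
Proof. by move=> h; apply: L2_bmfM => //; exact: bmf_cst. Qed.

Lemma L2B f g : L2 f -> L2 g -> L2 (fun w => f w - g w).
Proof.
move=> hf hg; have := L2D hf (L2Z (-1) hg).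
by under [X in L2 X]eq_fun do rewrite mulN1r.
Qed.

Lemma L2_sum I (s : seq I) (F : I -> T -> R) : (forall i, L2 (F i)) ->
  L2 (fun w => \sum_(i <- s) F i w).
Proof.
move=> h; elim: s => [|i s IH].
  by under [X in L2 X]eq_fun do rewrite big_nil; apply: L2_bmf; exact: bmf_cst.
by under [X in L2 X]eq_fun do rewrite big_cons; exact: L2D.
Qed.

Lemma norm2_ge0 f : 0 <= norm2 f.
Proof. by apply: Expe_ge0 => w; exact: sqr_ge0. Qed.

Lemma cauchy_schwarz f g : L2 f -> L2 g ->
  Expe P (fun w => f w * g w) ^+ 2 <= norm2 f * norm2 g.
Proof.
move=> hf hg; set b := Expe P _.
have q t : 0 <= norm2 f + 2 * t * b + t ^+ 2 * norm2 g.
  have -> : norm2 f + 2 * t * b + t ^+ 2 * norm2 g = norm2 (fun w => f w + t * g w).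
    have i1 := L2_sqr hf; have i2 := L2_sqr hg; have i3 := L2_mul hf hg.
    rewrite /norm2 /b -(ExpeZ (2 * t) i3) -(ExpeZ (t ^+ 2) i2).
    rewrite -ExpeD//; last exact: intgZ.
    rewrite -ExpeD//; [|by apply: intgD => //; exact: intgZ|exact: intgZ].
    by congr (Expe P _); apply/funext => w; ring.
  exact: norm2_ge0.
have [c0|c0] := eqVneq (norm2 g) 0.
  have [->|b0] := eqVneq b 0; first by rewrite expr0n mulr_ge0 ?norm2_ge0.
  (* With [norm2 g] = 0 the quadratic is affine of slope 2 b; this t gives it the value -1, a
     contradiction. *)
  have := q (- (norm2 f + 1) / (2 * b)).
  have -> : 2 * (- (norm2 f + 1) / (2 * b)) * b = - (norm2 f + 1) by field.
  by rewrite c0 mulr0 addr0 opprD addrA subrr add0r oppr_ge0 ler10.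
have cp : 0 < norm2 g by rewrite lt0r c0 norm2_ge0.
have := q (- b / norm2 g).
have -> : norm2 f + 2 * (- b / norm2 g) * b + (- b / norm2 g) ^+ 2 * norm2 g =
   norm2 f - b ^+ 2 / norm2 g by field.
by rewrite subr_ge0 ler_pdivrMr.
Qed.

(** Expanding around the limits leaves three error terms, each with a factor of vanishing norm.
    Cauchy-Schwarz controls their squares, whence the form of [zero]. *)
Lemma cvg_inner (f g : nat -> T -> R) f' g' :
  (forall n, L2 (f n)) -> (forall n, L2 (g n)) -> L2 f' -> L2 g' ->
  norm2 (fun w => f n w - f' w) @[n --> \oo] --> (0 : R) ->
  norm2 (fun w => g n w - g' w) @[n --> \oo] --> (0 : R) ->
  Expe P (fun w => f n w * g n w) @[n --> \oo] --> Expe P (fun w => f' w * g' w).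
Proof.
move=> hf hg hf' hg' cf cg.
have zero (u : nat -> R) (v : nat -> R) : (forall n, u n ^+ 2 <= v n) ->
    v n @[n --> \oo] --> (0 : R) -> u n @[n --> \oo] --> (0 : R).
  move=> uv v0; apply/cvgr0Pnorm_le => e e0.
  move/cvgr0Pnorm_le : v0 => /(_ (e ^+ 2) (exprn_gt0 2 e0)); apply: filterS => n.
  move=> vn; have : `|u n| ^+ 2 <= e ^+ 2.
    rewrite real_normK ?num_real//; apply: le_trans (uv n) _.
    by apply: le_trans vn; exact: ler_norm.
  by rewrite ler_pXn2r ?nnegrE// ltW.
have hfB n : L2 (fun w => f n w - f' w) by exact: L2B.
have hgB n : L2 (fun w => g n w - g' w) by exact: L2B.
have c1 : Expe P (fun w => (f n w - f' w) * (g n w - g' w)) @[n --> \oo] --> (0 : R).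
  apply: (zero _ _ (fun n => cauchy_schwarz (hfB n) (hgB n))).
  by have := cvgM cf cg; rewrite mulr0; apply.
have c2 : Expe P (fun w => (f n w - f' w) * g' w) @[n --> \oo] --> (0 : R).
  apply: (zero _ _ (fun n => cauchy_schwarz (hfB n) hg')).
  by have := cvgM cf (cvg_cst (norm2 g')); rewrite mul0r; apply.
have c3 : Expe P (fun w => f' w * (g n w - g' w)) @[n --> \oo] --> (0 : R).
  apply: (zero _ _ (fun n => cauchy_schwarz hf' (hgB n))).
  by have := cvgM (cvg_cst (norm2 f')) cg; rewrite mulr0; apply.
have e n : Expe P (fun w => f n w * g n w) =
   Expe P (fun w => (f n w - f' w) * (g n w - g' w)) +
   Expe P (fun w => (f n w - f' w) * g' w) +
   Expe P (fun w => f' w * (g n w - g' w)) + Expe P (fun w => f' w * g' w).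
  rewrite -!ExpeD; do ?[exact: L2_mul | apply: intgD].
  by congr (Expe P _); apply/funext => w; ring.
under eq_fun do rewrite e.
have := cvgD (cvgD (cvgD c1 c2) c3) (cvg_cst (Expe P (fun w => f' w * g' w))).
by rewrite !add0r; apply.
Qed.

Lemma integral_norm2 f : L2 f -> (\int[P]_w ((f w) ^+ 2)%:E)%E = (norm2 f)%:E.
Proof. by move=> h; rewrite /norm2 EFin_Expe//; exact: L2_sqr. Qed.

(** Riesz-Fischer: a fast subsequence has integrable total variation and so converges almost
    everywhere; Fatou's lemma carries the Cauchy bound [e m] over to the limit, for every term of
    the original sequence. *)
Lemma L2_complete (f : nat -> T -> R) (e : nat -> R) :
  (forall n, L2 (f n)) -> e @ \oo --> (0 : R) ->
  (forall m n, (m <= n)%N -> norm2 (fun w => f m w - f n w) <= e m) ->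
  exists2 g, L2 g & norm2 (fun w => f n w - g w) @[n --> \oo] --> (0 : R).
Proof.
move=> hf e0 fe.
have e_ge0 m : 0 <= e m by apply: le_trans (fe m m (leqnn m)); exact: norm2_ge0.
pose d (i : nat) : R := (2 ^+ i)^-1.
have d0 i : 0 < d i by rewrite invr_gt0 exprn_gt0.
have /choice[kap kapP] : forall i, exists k, forall m, (k <= m)%N -> e m <= d i ^+ 2.
  move=> i; move/cvgr0Pnorm_le : e0 => /(_ (d i ^+ 2) (exprn_gt0 2 (d0 i))).
  move=> [k _ kP]; exists k => m km; apply: le_trans (kP m km); exact: ler_norm.
(* A running sum makes the indices nondecreasing, at least [kap i], and at least [i]; the last bound
   lets them pass any fixed m. *)
pose k i := (\sum_(j < i.+1) (kap j).+1)%N.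
have kS i : (k i <= k i.+1)%N by rewrite /k (big_ord_recr i.+1)/= leq_addr.
have kge i : (kap i <= k i)%N by rewrite /k big_ord_recr/= (leq_trans (leqnSn _))// leq_addl.
have kid i : (i <= k i)%N.
  elim: i => // i IH; rewrite /k big_ord_recr/= -/(k i).
  by rewrite addnS ltnS (leq_trans IH)// leq_addr.
pose g i := f (k i).
have hg i : L2 (g i) by exact: hf.
have mg i : measurable_fun setT (g i) by case: (hg i).
pose h i w := `|g i.+1 w - g i w|.
have hh i : L2 (fun w => g i.+1 w - g i w) by exact: L2B.
have mh i : measurable_fun setT (EFin \o h i).
  by apply/measurable_EFinP; apply: measurableT_comp => //; exact: measurable_funB.
have Eh i : Expe P (h i) <= d i.
  have ih : intg P (h i) by apply: intg_norm; exact: L2_intg.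
  have i2 := L2_sqr (hh i).
  (* The inequality y <= d / 2 + y^2 / (2 d) passes from the second moment to the first: a second
     moment at most d^2 gives a mean at most d. *)
  apply: (@le_trans _ _ (Expe P (fun w => d i / 2 + (2 * d i)^-1 * (g i.+1 w - g i w) ^+ 2))).
    apply: Expe_le => //; first by apply: intgD; [exact: intg_cst|exact: intgZ].
    move=> w; rewrite /h -(real_normK (num_real (g i.+1 w - g i w))).
    set y := `|_|; rewrite -subr_ge0.
    have -> : d i / 2 + (2 * d i)^-1 * y ^+ 2 - y = (2 * d i)^-1 * (d i - y) ^+ 2.
      by field; rewrite gt_eqF.
    by rewrite mulr_ge0 ?sqr_ge0// invr_ge0 mulr_ge0// ltW.
  rewrite ExpeD; [|exact: intg_cst|exact: intgZ].
  rewrite Expe_cst ExpeZ//.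
  have : Expe P (fun w => (g i.+1 w - g i w) ^+ 2) <= d i ^+ 2.
    apply: (le_trans _ (kapP i (k i) (kge i))).
    apply: (le_trans _ (fe _ _ (kS i))).
    rewrite le_eqVlt; apply/orP; left; apply/eqP; congr (Expe P _).
    by apply/funext => w; rewrite /g -sqrrN opprB.
  move=> le2; apply: (@le_trans _ _ (d i / 2 + (2 * d i)^-1 * d i ^+ 2)).
    by rewrite lerD2l ler_wpM2l// invr_ge0 mulr_ge0// ltW.
  by rewrite le_eqVlt; apply/orP; left; apply/eqP; field; rewrite gt_eqF.
pose H w := (\sum_(0 <= i <oo) (h i w)%:E)%E.
have h0 i w : (0 <= (h i w)%:E)%E by rewrite lee_fin /h.
have mH : measurable_fun setT H.
  by apply: (@ge0_emeasurable_sum _ _ _ _ (fun i w => (h i w)%:E) xpredT) => [i w _ _|i _];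
    [exact: h0 | exact: mh].
have iH : P.-integrable setT H.
  apply/integrableP; split => //.
  under eq_integral => w _ do rewrite gee0_abs ?nneseries_ge0//.
  rewrite integral_nneseries//.
  (* The term 2 / 2^(i+1) is [d i], in the shape expected by [epsilon_trick0]. *)
  apply: (@le_lt_trans _ _ (\sum_(0 <= i <oo) (2 / (2 ^ i.+1)%:R)%:E)%E).
    apply: lee_nneseries => // [i _ _|i _]; first exact: integral_ge0.
    rewrite -EFin_Expe; last by apply: intg_norm; exact: L2_intg.
    rewrite lee_fin (le_trans (Eh i))// /d natrX exprS invfM mulrA mulfV ?mul1r//.
  by apply: le_lt_trans (epsilon_trick0 xpredT _) _; rewrite ?ltry.
pose A := H @^-1` [set x | x \is a fin_num].
have mA : measurable A.
  by have := emeasurable_fin_num measurableT mH; rewrite setTI.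
(* Multiplying by the indicator of finite variation gives a sequence convergent at every point,
   hence a measurable limit, and changes the functions only on a null set. *)
pose I : T -> R := \1_A.
have mI : measurable_fun setT I by exact: measurable_indic.
have aeA : {ae P, forall w, I w = 1}.
  have := integrable_ae measurableT iH; apply: filterS => w /(_ Logic.I) Aw.
  by rewrite /I indicE mem_set.
have gcvg w : cvgn (fun i => g i w * I w).
  rewrite /I indicE; have [Aw|_] := boolP (w \in A); last first.
    by under eq_fun do rewrite mulr0; exact: is_cvg_cst.
  under eq_fun do rewrite mulr1.
  have : cvgn (series (telescope (g ^~ w))).
    apply: normed_cvg; apply: nondecreasing_is_cvgn.
      apply/nondecreasing_seqP => n /=.
      by rewrite [leRHS]seriesSr lerDl normr_ge0.
    exists (fine (H w)) => _ [n _ <-].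
    rewrite -lee_fin fineK; last by move: Aw; rewrite inE.
    rewrite /series /= -sumEFin; apply: nneseries_lim_ge => *; exact: h0.
  rewrite telescopeK => c.
  have -> : (fun i => g i w) = (fun n => (g n w - g 0 w) + g 0 w).
    by apply/funext => n; rewrite subrK.
  exact: is_cvgD c (is_cvg_cst (g 0 w)).
pose gl w := limn (fun i => g i w * I w).
have mgl : measurable_fun setT gl.
  apply: (@measurable_fun_cvg _ _ _ _ (fun i w => g i w * I w)).
    by move=> i; exact: measurable_funM.
  by move=> w _; exact: gcvg.
have key m : (\int[P]_w ((f m w - gl w) ^+ 2)%:E <= (e m)%:E)%E.
  (* The shift by m ensures that the subsequence index is at least m, so [fe] applies for every
     i. *)
  pose u i w := ((f m w - g (i + m)%N w * I w) ^+ 2)%:E.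
  have mu i : measurable_fun setT (u i).
    apply/measurable_EFinP; apply: measurable_funX; apply: measurable_funB.
      by case: (hf m).
    by apply: measurable_funM.
  have ulim w : limn_einf (u ^~ w) = ((f m w - gl w) ^+ 2)%:E.
    have c : u ^~ w @ \oo --> ((f m w - gl w) ^+ 2)%:E.
      apply: cvg_EFin; first exact: nearW.
      have c1 : g (i + m)%N w * I w @[i --> \oo] --> gl w.
        by have := gcvg w; rewrite -(cvg_shiftn m).
      have c2 : f m w - g (i + m)%N w * I w @[i --> \oo] --> f m w - gl w.
        by apply: cvgB => //; exact: cvg_cst.
      exact: (cvgM c2 c2).
    by rewrite (cvg_limn_einf_sup c).1.
  have u0 i w : setT w -> (0 <= u i w)%E by rewrite lee_fin sqr_ge0.
  have := fatou P measurableT mu u0.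
  under eq_integral => w _ do rewrite ulim.
  move=> /le_trans; apply.
  have ule i : (\int[P]_w u i w <= (e m)%:E)%E.
    rewrite (_ : (\int[P]_w u i w = (norm2 (fun w => f m w - g (i + m)%N w))%:E)%E).
      by rewrite lee_fin; apply: fe; rewrite (leq_trans (leq_addl i m)).
    rewrite -integral_norm2; last exact: L2B.
    apply: ae_eq_integral => //.
      apply/measurable_EFinP; apply: measurable_funX; apply: measurable_funB => //.
      by case: (hf m).
    apply: filterS aeA => w Iw _; by rewrite /u Iw mulr1.
  rewrite limn_einf_lim; apply: lime_le; first exact: is_cvg_einfs.
  apply: nearW => n; apply: le_trans (ule n).
  by apply: ereal_inf_lbound; exists n => /=.
have hB m : L2 (fun w => f m w - gl w).
  have mB : measurable_fun setT (fun w => f m w - gl w).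
    by apply: measurable_funB => //; case: (hf m).
  split=> //; apply/integrableP; split.
    by apply/measurable_EFinP; exact: measurable_funX.
  under eq_integral => w _ do rewrite gee0_abs ?lee_fin ?sqr_ge0//.
  exact: le_lt_trans (key m) (ltry _).
exists gl.
  have := L2B (hf 0) (hB 0).
  by under [X in L2 X]eq_fun do rewrite opprB addrC subrK.
apply: (squeeze_cvgr _ (cvg_cst 0) e0); apply: nearW => m.
by rewrite norm2_ge0/= -lee_fin -integral_norm2.
Qed.

End SquareIntegrable.

(** * Joint moments of a uniform point *)

(** Turns an identity valid for every y into equality of coefficients; the roots used are the
    natural numbers. *)
Lemma poly_ext (R : numDomainType) (p q : {poly R}) : (forall y, p.[y] = q.[y]) -> p = q.
Proof.
move=> pq; apply/eqP; rewrite -subr_eq0; apply/negP => /negP r0.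
pose s := [seq (i%:R : R) | i <- iota 0 (size (p - q))].
have : (size s < size (p - q)%R)%N.
  apply: max_poly_roots => //.
    by apply/allP => x _; rewrite rootE hornerD hornerN pq subrr.
  by rewrite map_inj_uniq ?iota_uniq// => i j /eqP; rewrite eqr_nat => /eqP.
by rewrite size_map size_iota ltnn.
Qed.

Section SumReindexing.
Variable V : nmodType.

Lemma sum_double (f : nat -> V) n :
  \sum_(c < n.*2) f c = \sum_(l < n) (f l.*2 + f l.*2.+1).
Proof.
elim: n => [|n IH]; first by rewrite !big_ord0.
by rewrite doubleS !big_ord_recr /= IH addrA.
Qed.

Lemma sum_even (f : nat -> V) k :
  (forall c, odd c -> f c = 0) -> (forall c, (k < c)%N -> f c = 0) ->
  \sum_(c < k.+1) f c = \sum_(l < k.+1) f l.*2.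
Proof.
move=> f_odd f_gt.
transitivity (\sum_(c < k.+1.*2) f c).
  rewrite (big_ord_widen k.+1.*2 f) ?big_mkcond; last by rewrite -addnn leq_addr.
  by apply: eq_bigr => c _; case: ltnP => // kc; rewrite f_gt.
rewrite sum_double; apply: eq_bigr => l _.
by rewrite (f_odd l.*2.+1) ?addr0//= odd_double.
Qed.

Lemma sum_shift (u : nat -> V) l n : (forall b, (n <= b + l)%N -> u b = 0) ->
  \sum_(b < n) u b = \sum_(j < n) if (l <= j)%N then u (j - l)%N else 0.
Proof.
move=> u0; have [ln|nl] := leqP l n; last first.
  rewrite !big1// => i _.
    by rewrite ifN// -ltnNge (ltn_trans (ltn_ord i)).
  by rewrite u0// (leq_trans (ltnW nl))// leq_addl.
rewrite -(big_mkord xpredT (fun j => if (l <= j)%N then u (j - l)%N else 0)).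
have h0 : \sum_(0 <= j < l) (if (l <= j)%N then u (j - l)%N else 0) = 0.
  by rewrite big_nat big1// => i /andP[_ il]; rewrite leqNgt il.
rewrite (@big_cat_nat _ _ _ l)//= h0 add0r.
rewrite -{1}(add0n l) big_addn big_mkord.
under [RHS]eq_bigr => i _ do rewrite leq_addl addnK.
rewrite [RHS](big_ord_widen n u) ?leq_subr// [RHS]big_mkcond.
by apply: eq_bigr => b _; case: ltnP => // h; rewrite u0//; lia.
Qed.

End SumReindexing.

(** Times (j-l)! (k-j-l)! both sides equal k!, and both vanish when j + l > k. The numbers 2l, j-l
    and k-j-l are the exponents of z, q and p in the expansion of [pair_expansion]. *)
Lemma trinomial_coef k j l : (l <= j)%N ->
  ('C(k, l.*2) * 'C(k - l.*2, j - l) * (l.*2)`! = 'C(k, j) * 'C(j, l) * (k - j) ^_ l * l`!)%N.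
Proof.
move=> lj; have [jk|kj] := leqP (j + l) k; last first.
  have h0 : ('C(k, j) * 'C(j, l) * (k - j) ^_ l * l`! = 0)%N.
    have [jk|jk] := leqP j k; last by rewrite bin_small.
    by rewrite ffact_small ?muln0//; lia.
  rewrite h0.
  have [h|h] := leqP l.*2 k; last by rewrite bin_small.
  by rewrite ['C(k - _, _)]bin_small ?muln0 ?mul0n//; lia.
have e1 := @bin_fact k l.*2 ltac:(lia).
have e2 := @bin_fact (k - l.*2) (j - l) ltac:(lia).
have e3 := @bin_fact k j ltac:(lia).
have e4 := @bin_fact j l ltac:(lia).
have e5 := @ffact_fact (k - j) l ltac:(lia).
have e6 : (k - l.*2 - (j - l) = k - j - l)%N by lia.
rewrite e6 in e2.
apply/eqP; rewrite -(eqn_pmul2r (fact_gt0 (j - l))) -(eqn_pmul2r (fact_gt0 (k - j - l))).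
apply/eqP; transitivity k`!.
  by rewrite -e1 -e2; ring.
by rewrite -e3 -e4 -e5; ring.
Qed.

Section StandardPosition.
Context {R : realType} {dT : measure_display} {T : measurableType dT}.
Variables (P : probability T R) (D : nat) (N1 : R).
(* In homogeneous coordinates [(u_0, ..., u_n)] of the random point, [p] and [q] are [|u_0|^2] and
   [|u_1|^2], the [zeta m] are the real components of [u_0 u_1^*], and [N1] is [n]. *)
Variables (p q : T -> R) (zeta : 'I_D.+1 -> T -> R).
Local Notation z := (zeta ord0).
Hypotheses (bp : bmf p) (bq : bmf q) (bz : forall m, bmf (zeta m)).
Hypothesis N1_gt0 : 0 < N1.
Hypothesis pqE : forall w, p w * q w = \sum_m zeta m w ^+ 2.
(** In coordinates, [zeta_sym] changes the sign of u_1, [zeta_rot] changes its phase, [p_rot] is a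
    real rotation in the plane of u_0 and u_1, and [p_sum] combines unit trace with exchangeability
    of the coordinates other than u_0. *)
Hypothesis zeta_sym : forall l i j,
  Expe P (fun w => (- z w) ^+ l * (p w ^+ i * q w ^+ j)) =
  Expe P (fun w => z w ^+ l * (p w ^+ i * q w ^+ j)).
Hypothesis zeta_rot : forall m (x y : R) l i j, m != ord0 -> x ^+ 2 + y ^+ 2 = 1 ->
  Expe P (fun w => (x * z w + y * zeta m w) ^+ l * (p w ^+ i * q w ^+ j)) =
  Expe P (fun w => z w ^+ l * (p w ^+ i * q w ^+ j)).
Hypothesis p_rot : forall (x y : R) k, x ^+ 2 + y ^+ 2 = 1 ->
  Expe P (fun w => (x ^+ 2 * p w + y ^+ 2 * q w + 2 * x * y * z w) ^+ k) =
  Expe P (fun w => p w ^+ k).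
Hypothesis p_sum : forall k,
  Expe P (fun w => p w ^+ k) = Expe P (fun w => p w ^+ k.+1) + N1 * Expe P (fun w => p w ^+ k * q w).

Let B : R := D.+1%:R / 2.
Let B_gt0 : 0 < B. Proof. by rewrite /B divr_gt0. Qed.

Definition pqmom i j := Expe P (fun w => p w ^+ i * q w ^+ j).
Definition zmom l i j := Expe P (fun w => z w ^+ l * (p w ^+ i * q w ^+ j)).

Let bpq i j : bmf (fun w => p w ^+ i * q w ^+ j).
Proof. by apply: bmfM; exact: bmfX. Qed.

Lemma zmom_odd l i j : odd l -> zmom l i j = 0.
Proof.
move=> ol; have := zeta_sym l i j.
under [X in Expe P X = _ -> _]eq_fun do rewrite exprNn -signr_odd ol expr1 mulN1r mulNr.
rewrite ExpeN; last by apply: bmf_intg; apply: bmfM => //; exact: bmfX.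
rewrite -/(zmom l i j) => h; lra.
Qed.

Let sqrt1y (y : R) : 0 < Num.sqrt (1 + y ^+ 2).
Proof. by rewrite sqrtr_gt0 ltr_wpDr// sqr_ge0. Qed.

Let sqrt1y2 (y : R) : Num.sqrt (1 + y ^+ 2) ^+ 2 = 1 + y ^+ 2.
Proof. by rewrite sqr_sqrtr// addr_ge0// sqr_ge0. Qed.

(** [zeta_rot] for the direction (1, y) / sqrt(1 + y^2), with the root cleared; the even exponent
    makes both sides polynomials in y. *)
Lemma zeta_rotE m (y : R) L i j : m != ord0 ->
  Expe P (fun w => (z w + y * zeta m w) ^+ L.*2 * (p w ^+ i * q w ^+ j)) =
  (1 + y ^+ 2) ^+ L * zmom L.*2 i j.
Proof.
move=> m0; set s := Num.sqrt (1 + y ^+ 2).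
have s0 : s != 0 by rewrite gt_eqF// sqrt1y.
rewrite /zmom -(@zeta_rot m s^-1 (y / s) L.*2 i j m0); last first.
  by rewrite exprMn exprVn sqrt1y2 -[X in X + _]mul1r -mulrDl mulfV// -sqrt1y2 expf_neq0.
rewrite -ExpeZ; last first.
  apply: bmf_intg; apply: bmfM => //; apply: bmfX; apply: bmfD.
    by apply: bmfM => //; exact: bmf_cst.
  by apply: bmfM => //; exact: bmf_cst.
congr (Expe P _); apply/funext => w.
rewrite [RHS]mulrA; congr (_ * _).
rewrite -(sqrt1y2 y) -/s -exprM mul2n -exprMn; congr (_ ^+ _).
by field.
Qed.

(** Comparison of the coefficients of y^2 in [zeta_rotE] at exponent 2L + 2: the binomial (L + 1)(2L
    + 1) on one side, L + 1 on the other. *)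
Lemma zeta_mixed m L i j : m != ord0 ->
  (L.+1.*2.-1)%:R * Expe P (fun w => z w ^+ L.*2 * zeta m w ^+ 2 * (p w ^+ i * q w ^+ j)) =
  zmom L.+1.*2 i j.
Proof.
move=> m0; set M := L.+1.*2.
pose c k := Expe P (fun w => z w ^+ (M - k) * zeta m w ^+ k * (p w ^+ i * q w ^+ j)).
pose lhs : {poly R} := \sum_(k < M.+1) ('C(M, k)%:R * c k) *: 'X^k.
pose rhs : {poly R} := \sum_(k < L.+2) ('C(L.+1, k)%:R * zmom M i j) *: 'X^(k.*2).
have : lhs = rhs.
  apply: poly_ext => y; rewrite /lhs /rhs !horner_sum.
  transitivity (Expe P (fun w => (z w + y * zeta m w) ^+ M * (p w ^+ i * q w ^+ j))).
    transitivity (Expe P (fun w => \sum_(k < M.+1) ('C(M, k)%:R * y ^+ k) *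
       (z w ^+ (M - k) * zeta m w ^+ k * (p w ^+ i * q w ^+ j)))).
      rewrite Expe_sum; last first.
        move=> k; apply: intgZ; apply: bmf_intg; apply: bmfM => //.
        by apply: bmfM; exact: bmfX.
      apply: eq_bigr => k _; rewrite hornerZ hornerXn ExpeZ ?/c; first by ring.
      apply: bmf_intg; apply: bmfM => //.
      by apply: bmfM; exact: bmfX.
    congr (Expe P _); apply/funext => w; rewrite exprDn mulr_suml.
    by apply: eq_bigr => k _; rewrite -mulr_natl exprMn; ring.
  rewrite zeta_rotE// exprDn mulr_suml; apply: eq_bigr => k _.
  by rewrite expr1n mul1r hornerZ hornerXn -mulr_natl -exprM mul2n; ring.
move=> /(congr1 (fun f : {poly R} => f`_2)); rewrite /lhs /rhs !coef_sum.
have M2 : (2 < M.+1)%N by rewrite /M doubleS.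
rewrite (bigD1 (Ordinal M2))//= coefZ coefXn eqxx mulr1 big1 ?addr0; last first.
  by move=> k; rewrite -val_eqE /= coefZ coefXn eq_sym => /negbTE ->; rewrite mulr0.
rewrite (bigD1 (Ordinal (isT : (1 < L.+2)%N)))//= coefZ coefXn eqxx mulr1 big1 ?addr0; last first.
  move=> k; rewrite -val_eqE /= coefZ coefXn => k1; rewrite (_ : (2 == k.*2)%N = false) ?mulr0//.
  by apply/negbTE; apply: contra k1; lia.
rewrite bin1 /c => h.
have -> : (fun w => z w ^+ L.*2 * zeta m w ^+ 2 * (p w ^+ i * q w ^+ j)) =
   (fun w => z w ^+ (M - 2) * zeta m w ^+ 2 * (p w ^+ i * q w ^+ j)).
  by apply/funext => w; rewrite /M doubleS subSS subn1.
apply: (@mulfI _ L.+1%:R); first by rewrite pnatr_eq0.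
rewrite -h mulrA; congr (_ * _); rewrite -natrM; congr (_%:R).
by rewrite bin2 /M doubleS /=; lia.
Qed.

(** One factor p q is replaced by the sum of the D + 1 squares; each of the D squares other than
    that of z contributes 1 / (2L + 1) of the moment with z^(2L+2). This gives 2L + 1 + D against 2L
    + 1, then halved. *)
Lemma zmom_rec L i j : (B + L%:R) * zmom L.+1.*2 i j = (L%:R + 2^-1) * zmom L.*2 i.+1 j.+1.
Proof.
have b2 : bmf (fun w => z w ^+ L.*2) by exact: bmfX.
have e : zmom L.*2 i.+1 j.+1 = zmom L.+1.*2 i j +
   \sum_(m | m != ord0) Expe P (fun w => z w ^+ L.*2 * zeta m w ^+ 2 * (p w ^+ i * q w ^+ j)).
  rewrite -big_filter -Expe_sum; last first.
    by move=> m; apply: bmf_intg; apply: bmfM => //; apply: bmfM => //; exact: bmfX.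
  rewrite /zmom -ExpeD; last 2 first.
  - by apply: bmf_intg; apply: bmfM => //; exact: bmfX.
  - apply: bmf_intg; apply: bmf_sum => m; apply: bmfM => //; apply: bmfM => //.
    exact: bmfX.
  congr (Expe P _); apply/funext => w.
  have -> : p w ^+ i.+1 * q w ^+ j.+1 = (p w * q w) * (p w ^+ i * q w ^+ j) by rewrite !exprS; ring.
  rewrite pqE (bigD1 ord0)//= mulrDl mulrDr big_filter; congr (_ + _).
    by rewrite doubleS !exprS; ring.
  by rewrite mulr_suml mulr_sumr; apply: eq_bigr => m _; ring.
have e2 : (L.+1.*2.-1)%:R *
   \sum_(m | m != ord0) Expe P (fun w => z w ^+ L.*2 * zeta m w ^+ 2 * (p w ^+ i * q w ^+ j)) =
   D%:R * zmom L.+1.*2 i j.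
  rewrite mulr_sumr (eq_bigr _ (fun m m0 => zeta_mixed L i j m0)) sumr_const mulr_natl.
  have c0 : #|predC1 (ord0 : 'I_D.+1)| = D by rewrite cardC1 card_ord.
  by congr (_ *+ _); rewrite -[RHS]c0; apply: eq_card.
have o : (L.+1.*2.-1)%:R = 2 * (L%:R + 2^-1) :> R.
  by rewrite doubleS /= -addn1 natrD -muln2 natrM; field.
rewrite o in e2; rewrite e mulrDr; apply: (@mulfI _ 2); first by rewrite pnatr_eq0.
rewrite [RHS]mulrDr [X in _ = _ + X]mulrA e2 /B -natr1; by field.
Qed.

(** The factor (2l)! / (l! 4^l) is the rising factorial of 1/2, so these are the moments of one
    coordinate of a uniform vector of length sqrt(p q) in dimension D + 1. *)
Lemma zmomE l i j :
  zmom l.*2 i j = (l.*2)`!%:R / (l`!%:R * 4 ^+ l) / rising B l * pqmom (i + l) (j + l).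
Proof.
elim: l i j => [|l IH] i j.
  rewrite double0 rising0 fact0 expr0 !addn0 mulr1 !divr1 mul1r; congr (Expe P _).
  by apply/funext => w; rewrite mul1r.
have Bl : B + l%:R != 0 by rewrite gt_eqF// ltr_wpDr.
have rl := rising_neq0 l B_gt0.
have fl : l`!%:R != 0 :> R by rewrite pnatr_eq0 -lt0n fact_gt0.
have l1 : l%:R + 1 != 0 :> R by rewrite natr1 pnatr_eq0.
apply: (mulfI Bl); rewrite zmom_rec IH !addSn !addnS risingSr exprS.
rewrite doubleS !factS !natrM -!natr1 -muln2 natrM.
by field; rewrite fl rl Bl l1 expf_neq0.
Qed.

(** The base of the k-th power is |X u_0 + Y u_1|^2. In its trinomial expansion odd powers of z have
    mean zero and z^(2l) trades for (p q)^l, so the term with q^b z^(2l) is collected under j = b +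
    l. For fixed j the sum over l is Chu-Vandermonde with y = k - j. *)
Lemma pair_expansion (X Y : R) i k :
  Expe P (fun w => p w ^+ i * (X ^+ 2 * p w + Y ^+ 2 * q w + 2 * X * Y * z w) ^+ k) =
  \sum_(j < k.+1) 'C(k, j)%:R * X ^+ (2 * (k - j)) * Y ^+ (2 * j) *
    (rising B k / (rising B (k - j) * rising B j)) * pqmom (i + (k - j)) j.
Proof.
pose t c b : R := 'C(k, c)%:R * 'C(k - c, b)%:R * (2 * X * Y) ^+ c *
  X ^+ (2 * (k - c - b)) * Y ^+ (2 * b) * zmom c (i + (k - c - b)) b.
transitivity (\sum_(c < k.+1) \sum_(b < k.+1) t c b).
  have -> : \sum_(c < k.+1) \sum_(b < k.+1) t c b =
     \sum_(c < k.+1) \sum_(b < (k - c).+1) t c b.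
    apply: eq_bigr => c _; rewrite [RHS](big_ord_widen k.+1 (t c)) ?ltnS ?leq_subr//.
    rewrite [RHS]big_mkcond; apply: eq_bigr => b _; case: ltnP => // h.
    by rewrite /t ['C(k - c, b)]bin_small// mulr0 !mul0r.
  have ib c b x : intg P (fun w => x * (z w ^+ c * (p w ^+ (i + (k - c - b)) * q w ^+ b))).
    by apply: intgZ; apply: bmf_intg; apply: bmfM => //; exact: bmfX.
  transitivity (Expe P (fun w => \sum_(c < k.+1) \sum_(b < (k - c).+1)
     ('C(k, c)%:R * 'C(k - c, b)%:R * (2 * X * Y) ^+ c * X ^+ (2 * (k - c - b)) * Y ^+ (2 * b)) *
     (z w ^+ c * (p w ^+ (i + (k - c - b)) * q w ^+ b)))).
    congr (Expe P _); apply/funext => w; rewrite exprDn mulr_sumr.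
    apply: eq_bigr => c _; rewrite exprDn mulr_suml -mulr_natl !mulr_sumr.
    apply: eq_bigr => b _; rewrite -[_ *+ 'C(k - c, b)]mulr_natl !exprMn !exprM !expr2 !exprMn exprD; ring.
  rewrite Expe_sum; last by move=> c; apply: intg_sum => b; exact: ib.
  apply: eq_bigr => c _; rewrite Expe_sum; last by move=> b; exact: ib.
  by apply: eq_bigr => b _; rewrite ExpeZ//; apply: bmf_intg; apply: bmfM => //; exact: bmfX.
rewrite (sum_even (f := fun c => \sum_(b < k.+1) t c b)); last 2 first.
- by move=> c oc; rewrite big1// => b _; rewrite /t zmom_odd// mulr0.
- by move=> c kc; rewrite big1// => b _; rewrite /t ['C(k, c)]bin_small// !mul0r.
pose G j : R := X ^+ (2 * (k - j)) * Y ^+ (2 * j) * pqmom (i + (k - j)) j.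
transitivity (\sum_(l < k.+1) \sum_(j < k.+1)
   'C(k, j)%:R * ('C(j, l)%:R * (falling (k - j)%:R l / rising B l)) * G j).
  apply: eq_bigr => l _; rewrite (@sum_shift _ (t l.*2) l); last first.
    move=> b h; rewrite /t; have [h2|h2] := leqP l.*2 k; last first.
      by rewrite bin_small// !mul0r.
    by rewrite ['C(k - _, _)]bin_small ?mulr0 ?mul0r//; lia.
  apply: eq_bigr => j _; case: leqP => lj; last first.
    by rewrite ['C(j, l)]bin_small// mul0r mulr0 mul0r.
  rewrite falling_nat /t zmomE /G.
  have fl : l`!%:R != 0 :> R by rewrite pnatr_eq0 -lt0n fact_gt0.
  have rl := rising_neq0 l B_gt0.
  have h4 : 4 ^+ l != 0 :> R by rewrite expf_neq0.
  have := congr1 (fun n : nat => n%:R : R) (trinomial_coef k lj).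
  rewrite !natrM => tri.
  have [jk|kj] := leqP (j + l) k; last first.
    have -> : 'C(k, j)%:R * ('C(j, l)%:R * (((k - j) ^_ l)%:R / rising B l)) = 0 :> R.
      have [h2|h2] := leqP j k; last by rewrite bin_small// mul0r.
      by rewrite ffact_small ?(mul0r, mulr0)//; lia.
    have -> : 'C(k, l.*2)%:R * 'C(k - l.*2, j - l)%:R = 0 :> R.
      have [h2|h2] := leqP l.*2 k; last by rewrite bin_small// mul0r.
      by rewrite ['C(k - _, _)]bin_small ?mulr0//; lia.
    by rewrite !(mul0r, mulr0).
  have -> : (i + (k - l.*2 - (j - l)) + l = i + (k - j))%N by lia.
  have -> : (j - l + l = j)%N by lia.
  have -> : X ^+ (2 * (k - j)) = X ^+ (2 * (k - l.*2 - (j - l))) * X ^+ (l.*2).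
    by rewrite -exprD; congr (_ ^+ _); lia.
  have -> : Y ^+ (2 * j) = Y ^+ (2 * (j - l)) * Y ^+ (l.*2).
    by rewrite -exprD; congr (_ ^+ _); lia.
  rewrite !exprMn.
  have -> : 2 ^+ l.*2 = 4 ^+ l :> R by rewrite -mul2n exprM; congr (_ ^+ _); ring.
  have -> : 'C(k, j)%:R * ('C(j, l)%:R * (((k - j) ^_ l)%:R / rising B l)) =
     'C(k, l.*2)%:R * 'C(k - l.*2, j - l)%:R * (l.*2)`!%:R / (l`!%:R * rising B l) :> R.
    by rewrite tri; field; rewrite fl rl.
  by field; rewrite fl rl h4.
rewrite exchange_big /=; apply: eq_bigr => j _.
have jk : (j <= k)%N by rewrite -ltnS.
transitivity ('C(k, j)%:R * (\sum_(l < k.+1) 'C(j, l)%:R * (falling (k - j)%:R l / rising B l)) * G j).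
  by rewrite mulr_sumr mulr_suml.
have -> : \sum_(l < k.+1) 'C(j, l)%:R * (falling (k - j)%:R l / rising B l) =
   \sum_(l < j.+1) 'C(j, l)%:R * (falling (k - j)%:R l / rising B l).
  rewrite [RHS](big_ord_widen k.+1 (fun l => 'C(j, l)%:R * (falling (k - j)%:R l / rising B l)))//.
  rewrite [RHS]big_mkcond; apply: eq_bigr => l _; case: ltnP => // h.
  by rewrite bin_small// mul0r.
rewrite chu_vandermonde// /G.
have := risingD B (k - j) j; rewrite subnK// => ->.
have r1 := rising_neq0 (k - j) B_gt0; have r2 := rising_neq0 j B_gt0.
by field; rewrite r1 r2.
Qed.

(** By [p_rot], [pair_expansion] with i = 0, X = 1 and Y = y must equal (1 + y^2)^k E[p^k]; the
    coefficients of y^(2j) give the relation. *)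
Lemma pqmom_p i j :
  pqmom i j = rising B i * rising B j / rising B (i + j) * pqmom (i + j) 0.
Proof.
set k := (i + j)%N.
pose c (a : nat) : R := rising B k / (rising B (k - a) * rising B a) * pqmom (k - a) a.
pose lhs : {poly R} := \sum_(a < k.+1) ('C(k, a)%:R * c a) *: 'X^(a.*2).
pose rhs : {poly R} := \sum_(a < k.+1) ('C(k, a)%:R * pqmom k 0) *: 'X^(a.*2).
have : lhs = rhs.
  apply: poly_ext => y; rewrite /lhs /rhs !horner_sum.
  have e := pair_expansion 1 y 0 k.
  transitivity (Expe P (fun w => p w ^+ 0 * (1 ^+ 2 * p w + y ^+ 2 * q w + 2 * 1 * y * z w) ^+ k)).
    rewrite e; apply: eq_bigr => a _; rewrite hornerZ hornerXn expr1n mulr1 add0n /c mul2n; ring.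
  set s := Num.sqrt (1 + y ^+ 2).
  have s0 : s != 0 by rewrite gt_eqF// sqrt1y.
  have r : (s^-1) ^+ 2 + (y / s) ^+ 2 = 1.
    by rewrite exprMn exprVn sqrt1y2 -[X in X + _]mul1r -mulrDl mulfV// -sqrt1y2 expf_neq0.
  transitivity ((1 + y ^+ 2) ^+ k * pqmom k 0); last first.
    rewrite exprDn mulr_suml; apply: eq_bigr => a _.
    by rewrite expr1n mul1r hornerZ hornerXn -mulr_natl -exprM mul2n; ring.
  have -> : pqmom k 0 = Expe P (fun w => p w ^+ k).
    by congr (Expe P _); apply/funext => w; rewrite mulr1.
  rewrite -(p_rot k r) -ExpeZ; last first.
    apply: bmf_intg; apply: bmfX; apply: bmfD; last by apply: bmfM => //; exact: bmf_cst.
    by apply: bmfD; apply: bmfM => //; exact: bmf_cst.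
  congr (Expe P _); apply/funext => w.
  rewrite expr0 mul1r -exprMn; congr (_ ^+ _); rewrite -(sqrt1y2 y) -/s.
  by field.
move=> /(congr1 (fun f : {poly R} => f`_(j.*2))); rewrite /lhs /rhs !coef_sum.
have jk : (j < k.+1)%N by rewrite ltnS leq_addl.
have red (u : nat -> R) : \sum_(a < k.+1) (u a *: 'X^(a.*2) : {poly R})`_(j.*2) = u j.
  rewrite (bigD1 (Ordinal jk))//= coefZ coefXn eqxx mulr1 big1 ?addr0// => a.
  by rewrite -val_eqE /= coefZ coefXn => aj; rewrite (_ : (j.*2 == a.*2)%N = false) ?mulr0//;
    apply/negbTE; apply: contra aj; lia.
rewrite (red (fun a => 'C(k, a)%:R * c a)) (red (fun a => 'C(k, a)%:R * pqmom k 0)).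
have Cn : 'C(k, j)%:R != 0 :> R by rewrite pnatr_eq0 -lt0n bin_gt0 leq_addl.
move=> /(mulfI Cn); rewrite /c /k addnK => <-.
have r1 := rising_neq0 i B_gt0; have r2 := rising_neq0 j B_gt0.
have r3 := rising_neq0 (i + j) B_gt0.
by field; rewrite r1 r2 r3.
Qed.

Let AB : R := B + N1 * B.
Let AB_gt0 : 0 < AB. Proof. by rewrite addr_gt0// mulr_gt0. Qed.

(** [p_sum], with [pqmom_p] at exponents k and 1, gives the ratio (B + k) / (AB + k) of consecutive
    moments, where AB = B + N1 B. *)
Lemma pmom k : pqmom k 0 = rising B k / rising AB k.
Proof.
elim: k => [|k IH].
  rewrite !rising0 divr1 -[RHS](Expe_cst P 1); congr (Expe P _).
  by apply/funext => w; rewrite mulr1.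
have e k' : Expe P (fun w => p w ^+ k') = pqmom k' 0.
  by congr (Expe P _); apply/funext => w; rewrite mulr1.
have := p_sum k; rewrite !e.
have -> : Expe P (fun w => p w ^+ k * q w) = pqmom k 1 by [].
rewrite (pqmom_p k 1) IH addn1 !risingSr rising0 mul1r addr0.
have r1 := rising_neq0 k B_gt0; have r2 := rising_neq0 k AB_gt0.
have Bk : B + k%:R != 0 by rewrite gt_eqF// ltr_wpDr.
have ABk : AB + k%:R != 0 by rewrite gt_eqF// ltr_wpDr.
move=> h.
have {}h : rising B k / rising AB k * (B + k%:R) = pqmom k.+1 0 * (AB + k%:R).
  by rewrite h /AB; field; rewrite r1 Bk.
apply: (mulIf ABk); rewrite -h; field.
by rewrite r2 ABk.
Qed.

Lemma pair_mom_Expe (al be c : R) i k : be + 1 = B -> al + 1 = N1 * B -> 0 <= c <= 1 ->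
  Expe P (fun w => p w ^+ i *
    (c * p w + (1 - c) * q w + 2 * Num.sqrt c * Num.sqrt (1 - c) * z w) ^+ k) =
  pair_mom al be c i k.
Proof.
move=> eB eA /andP[c0 c1]; have := pair_expansion (Num.sqrt c) (Num.sqrt (1 - c)) i k.
rewrite !sqr_sqrtr ?subr_ge0// => ->; apply: eq_bigr => j _.
have jk : (j <= k)%N by rewrite -ltnS.
rewrite !exprM !sqr_sqrtr ?subr_ge0// pqmom_p pmom eB eA.
have -> : al + be + 2 = AB by rewrite /AB -eA -eB; ring.
have -> : (i + (k - j) + j = i + k)%N by lia.
have r1 := rising_neq0 (k - j) B_gt0; have r2 := rising_neq0 j B_gt0.
have r3 := rising_neq0 (i + k) B_gt0; have r4 := rising_neq0 (i + k) AB_gt0.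
have r5 : rising (N1 * B) j != 0 by rewrite rising_neq0// mulr_gt0.
by field; rewrite r1 r2 r3 r4 r5.
Qed.

End StandardPosition.

(* A copy of [M] carrying the point needed by [g_sigma_algebraType]. *)
Definition pointed_copy (M : Type) (x0 : M) : Type := M.

HB.instance Definition _ (M : Type) (x0 : M) := gen_eqMixin (pointed_copy x0).
HB.instance Definition _ (M : Type) (x0 : M) := gen_choiceMixin (pointed_copy x0).
HB.instance Definition _ (M : Type) (x0 : M) := isPointed.Build (pointed_copy x0) x0.

(** * Borel functions for the sigma-algebra of balls *)

Section BorelFunctions.
Context {R : realType} {M : Type} (dist : M -> M -> R).

Definition borel_fun (f : M -> R) := forall B, measurable B -> borel_sets dist (f @^-1` B).

Definition bborel (f : M -> R) := borel_fun f /\ exists C, forall x, `|f x| <= C.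

Let borelT (x0 : M) := g_sigma_algebraType (ball_sets dist : set (set (pointed_copy x0))).

(** [M] carries no measurable structure and may be empty. A point [x0] makes the theory of
    measurable functions applicable, and [borel_fun_noM] settles the empty case. *)
Lemma borel_funP (x0 : M) (f : M -> R) :
  borel_fun f <-> measurable_fun setT (f : borelT x0 -> R).
Proof.
split=> h; first by move=> _ B mB; rewrite setTI; exact: h.
by move=> B mB; have := h measurableT B mB; rewrite setTI.
Qed.

Lemma borel_fun_noM (f : M -> R) : (M -> False) -> borel_fun f.
Proof.
move=> noM B mB; have -> : f @^-1` B = set0 by apply/seteqP; split => x; have := noM x.
exact: sigma_algebra0.
Qed.

Let borel_fun_lift2 (op : R -> R -> R) (f g : M -> R) :
  (forall d (T : measurableType d) (f' g' : T -> R), measurable_fun setT f' ->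
    measurable_fun setT g' -> measurable_fun setT (fun x => op (f' x) (g' x))) ->
  borel_fun f -> borel_fun g -> borel_fun (fun x => op (f x) (g x)).
Proof.
move=> h hf hg; have [[x0 _]|noM] := pselect (exists x : M, True); last first.
  by apply: borel_fun_noM => x; apply: noM; exists x.
apply/(borel_funP x0); apply: h; exact/(borel_funP x0).
Qed.

Lemma borel_funD f g : borel_fun f -> borel_fun g -> borel_fun (fun x => f x + g x).
Proof. by apply: (borel_fun_lift2 (op := +%R)) => *; exact: measurable_funD. Qed.

Lemma borel_funM f g : borel_fun f -> borel_fun g -> borel_fun (fun x => f x * g x).
Proof. by apply: (borel_fun_lift2 (op := *%R)) => *; exact: measurable_funM. Qed.

Lemma borel_fun_cst c : borel_fun (fun=> c).
Proof.
have [[x0 _]|noM] := pselect (exists x : M, True); last first.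
  by apply: borel_fun_noM => x; apply: noM; exists x.
by apply/(borel_funP x0); exact: measurable_cst.
Qed.

Lemma borel_fun_comp (phi : R -> R) f : measurable_fun setT phi -> borel_fun f ->
  borel_fun (phi \o f).
Proof.
move=> mphi hf B mB; rewrite comp_preimage; apply: hf.
by have := mphi measurableT B mB; rewrite setTI.
Qed.

Lemma borel_dist x : borel_fun (dist x).
Proof.
apply/(borel_funP x).
apply: (@measurability _ _ (borelT x) R setT (dist x) (@RGenInftyO.G R)).
  exact: RGenInftyO.measurableE.
move=> _ [_ [r ->] <-]; apply: sub_gen_smallest; exists x, r.
by rewrite setTI; apply/seteqP; split => y /=; rewrite in_itv/=.
Qed.

Lemma bborelD f g : bborel f -> bborel g -> bborel (fun x => f x + g x).
Proof.
move=> [mf [C fC]] [mg [C' gC]]; split; first exact: borel_funD.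
by exists (C + C') => w; rewrite (le_trans (ler_normD _ _))// lerD.
Qed.

Lemma bborelM f g : bborel f -> bborel g -> bborel (fun x => f x * g x).
Proof.
move=> [mf [C fC]] [mg [C' gC]]; split; first exact: borel_funM.
by exists (C * C') => w; rewrite normrM ler_pM.
Qed.

Lemma bborel_cst c : bborel (fun=> c).
Proof. by split; [exact: borel_fun_cst | exists `|c|]. Qed.

Lemma bborelX n f : bborel f -> bborel (fun x => f x ^+ n).
Proof.
move=> h; elim: n => [|n IH].
  by under [X in bborel X]eq_fun do rewrite expr0; exact: bborel_cst.
by under [X in bborel X]eq_fun do rewrite exprS; exact: bborelM.
Qed.

Lemma bborelZ c f : bborel f -> bborel (fun x => c * f x).
Proof. by move=> ?; apply: bborelM => //; exact: bborel_cst. Qed.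

Lemma bborelB f g : bborel f -> bborel g -> bborel (fun x => f x - g x).
Proof.
move=> hf /(bborelZ (-1)) hg; have := bborelD hf hg.
by under [X in bborel X]eq_fun do rewrite mulN1r.
Qed.

Lemma bborel_horner (q : {poly R}) f : bborel f -> bborel (fun x => q.[f x]).
Proof.
move=> h; elim/poly_ind: q => [|q c IH].
  by under [X in bborel X]eq_fun do rewrite horner0; exact: bborel_cst.
under [X in bborel X]eq_fun do rewrite hornerMXaddC.
by apply: bborelD; [exact: bborelM|exact: bborel_cst].
Qed.

(** The ball at x pulls back to the ball at the preimage of x, and the sets with Borel preimage form
    a sigma-algebra. *)
Lemma borel_preimage_isometry g A : isometry dist g -> borel_sets dist A ->
  borel_sets dist (g @^-1` A).
Proof.
move=> [[h hK gK] gd]; rewrite /borel_sets.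
suff : <<s ball_sets dist >> `<=` [set A | <<s ball_sets dist >> (g @^-1` A)].
  by apply.
apply: smallest_sub.
  split.
  - by rewrite /= preimage_set0; exact: sigma_algebra0.
  - by move=> B /= hB; rewrite setTD preimage_setC -setTD; exact: sigma_algebraCD.
  - by move=> F hF; rewrite /= preimage_bigcup; exact: sigma_algebra_bigcup.
move=> _ [x [r ->]] /=; apply: sub_gen_smallest; exists (h x), r.
have e y : dist x (g y) = dist (h x) y by rewrite -{1}(gK x) gd.
by apply/seteqP; split => y /=; rewrite e.
Qed.

(** On projective models this is Re tr(PQ) and on spheres (1 + <x, y>) / 2 ([half_cos_proj],
    [half_cos_sph]), a polynomial in coordinates. *)
Definition half_cos (x y : M) : R := (1 + cos (dist x y)) / 2.

Lemma half_cos_itv x y : 0 <= half_cos x y <= 1.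
Proof.
rewrite /half_cos; have h1 := cos_geN1 (dist x y); have h2 := cos_le1 (dist x y).
by apply/andP; split; lra.
Qed.

Lemma bborel_half_cos x : bborel (half_cos x).
Proof.
split; last by exists 1 => y; have /andP[? ?] := half_cos_itv x y; rewrite ger0_norm.
apply: borel_funM; last exact: borel_fun_cst.
apply: borel_funD; first exact: borel_fun_cst.
apply: (@borel_fun_comp cos); last exact: borel_dist.
by apply: continuous_measurable_fun; exact: continuous_cos.
Qed.

End BorelFunctions.

(** * Joint moments of a uniform element from a frame *)

Section UniformElement.
Context {R : realType} {M : Type} (dist : M -> M -> R).
Context {dT : measure_display} {T : measurableType dT} (P : probability T R) (U : T -> M).
Hypotheses (Uel : random_element dist U) (Uunif : uniform_el P dist U).
Local Notation t := (half_cos dist).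

Lemma bborel_bmf f : bborel dist f -> bmf (f \o U).
Proof.
move=> [bf [C fC]]; split; last by exists C => w; exact: fC.
by move=> _ B mB; rewrite setTI comp_preimage; apply: Uel; exact: bf.
Qed.

Lemma half_cos_isometry h x u : isometry dist h -> t (h x) (h u) = t x u.
Proof. by case=> _ hd; rewrite /half_cos hd. Qed.

(** Moving all base points by [h] amounts to moving u by the inverse isometry, which preserves the
    law. Taking [F] as a function of the whole profile x -> t(x, u) lets a monomial in several
    values be transformed at once. *)
Lemma Expe_isometry h (F : (M -> R) -> R) : isometry dist h ->
  bborel dist (fun u => F (t ^~ u)) ->
  Expe P (fun w => F (fun x => t (h x) (U w))) = Expe P (fun w => F (t ^~ (U w))).
Proof.
move=> ih bF; have [[g hK gK] hd] := ih.
have ig : isometry dist g by split; [exists h|move=> x y; rewrite -{2}(gK x) -{2}(gK y) hd].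
pose f u := F (t ^~ u).
have fg u : F (fun x => t (h x) u) = f (g u).
  by rewrite /f; congr F; apply/funext => x; rewrite -{1}(gK u) half_cos_isometry.
have bfg : bborel dist (f \o g).
  case: bF => bF [C FC]; split; last by exists C => x; exact: FC.
  by move=> B mB; rewrite comp_preimage; apply: borel_preimage_isometry => //; exact: bF.
have b1 := bborel_bmf bF; have b2 := bborel_bmf bfg.
transitivity (Expe P ((f \o g) \o U)).
  by congr (Expe P _); apply/funext => w; rewrite fg.
symmetry; apply: Expe_same_law; [by case: b1|by case: b2|exact: bmf_intg| |exact: bmf_intg].
by move=> B mB; exact: (Uunif ig (bF.1 B mB)).
Qed.

Variables (D n : nat) (E0 E1 : M) (Q : 'I_D.+1 -> M) (E_ : 'I_n.+1 -> M).
Let p := t E0.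
Let q := t E1.
(** On a projective space [Q m] has diagonal entries 1/2 at the first two places and off-diagonal
    entry e_m / 2. Its t-value at u is the mean of |u_0|^2 and |u_1|^2 plus the e_m-component of the
    off-diagonal entry of u; removing the mean isolates that component. *)
Let zeta m u := t (Q m) u - (t E0 u + t E1 u) / 2.

(* The sphere is the case of a projective line: [E0] and [E1] are antipodal and [n = 0]. *)
Hypothesis frame_pq : forall u, p u * q u = \sum_m zeta m u ^+ 2.
Hypothesis frame_sym : exists2 h, isometry dist h &
  [/\ h E0 = E0, h E1 = E1 & forall u, t (h (Q ord0)) u - (p u + q u) / 2 = - zeta ord0 u].
Hypothesis frame_rot : forall m (x y : R), m != ord0 -> x ^+ 2 + y ^+ 2 = 1 ->
  exists2 h, isometry dist h & [/\ h E0 = E0, h E1 = E1 &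
    forall u, t (h (Q ord0)) u - (p u + q u) / 2 = x * zeta ord0 u + y * zeta m u].
Hypothesis frame_line : forall (x y : R), x ^+ 2 + y ^+ 2 = 1 ->
  exists2 h, isometry dist h &
    forall u, t (h E0) u = x ^+ 2 * p u + y ^+ 2 * q u + 2 * x * y * zeta ord0 u.
Hypothesis frame_sum : forall u, p u + \sum_l t (E_ l) u = 1.
Hypothesis frame_perm : forall l, exists2 h, isometry dist h & h E0 = E0 /\ h E1 = E_ l.
Hypothesis frame_pair : forall x y : M, exists2 h, isometry dist h & h E0 = x /\ exists2 y0, h y0 = y & forall u, t y0 u = t x y * p u + (1 - t x y) * q u +
    2 * Num.sqrt (t x y) * Num.sqrt (1 - t x y) * zeta ord0 u.

Let bt x : bborel dist (t x). Proof. exact: bborel_half_cos. Qed.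

Let bzeta m : bborel dist (zeta m).
Proof.
apply: bborelB => //; apply: bborelM; last exact: bborel_cst.
exact: bborelD.
Qed.

(** [frame_pair] carries [E0] and a point of the real line through [E0] and [E1] to x and y. Each
    invariance required in standard position is then [Expe_isometry] for a frame isometry and a
    suitable monomial. *)
Lemma pair_mom_uniform (al be : R) x y i k :
  be + 1 = D.+1%:R / 2 -> al + 1 = n.+1%:R * (D.+1%:R / 2) ->
  Expe P (fun w => t x (U w) ^+ i * t y (U w) ^+ k) = pair_mom al be (t x y) i k.
Proof.
move=> eB eA.
have [h ih [hx [y0 hy ty0]]] := frame_pair x y.
transitivity (Expe P (fun w => t E0 (U w) ^+ i * t y0 (U w) ^+ k)).
  rewrite -hx -hy (@Expe_isometry h (fun f => f E0 ^+ i * f y0 ^+ k))//.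
  by apply: bborelM; exact: bborelX.
under [X in Expe P X]eq_fun do rewrite ty0.
have bb f : bborel dist f -> bmf (fun w => f (U w)) by exact: bborel_bmf.
apply: (@pair_mom_Expe _ _ _ P D n.+1%:R (p \o U) (q \o U) (fun m w => zeta m (U w))) => //.
- exact: (bb p (bt E0)).
- exact: (bb q (bt E1)).
- by move=> m; exact: (bb _ (bzeta m)).
- by move=> w; exact: frame_pq.
- move=> l i' j'; have [g ig [g0 g1 gz]] := frame_sym.
  rewrite -[RHS](@Expe_isometry g (fun f => (f (Q ord0) - (f E0 + f E1) / 2) ^+ l *
     (f E0 ^+ i' * f E1 ^+ j')))//.
    by congr (Expe P _); apply/funext => w; rewrite g0 g1 gz.
  by apply: bborelM; [apply: bborelX; exact: bzeta|apply: bborelM; exact: bborelX].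
- move=> m x' y' l i' j' m0 xy; have [g ig [g0 g1 gz]] := frame_rot m0 xy.
  rewrite -[RHS](@Expe_isometry g (fun f => (f (Q ord0) - (f E0 + f E1) / 2) ^+ l *
     (f E0 ^+ i' * f E1 ^+ j')))//.
    by congr (Expe P _); apply/funext => w; rewrite g0 g1 gz.
  by apply: bborelM; [apply: bborelX; exact: bzeta|apply: bborelM; exact: bborelX].
- move=> x' y' k' xy; have [g ig gz] := frame_line xy.
  rewrite -[RHS](@Expe_isometry g (fun f => f E0 ^+ k'))//; last exact: bborelX.
  by congr (Expe P _); apply/funext => w; rewrite gz.
- move=> k'.
  have bk l : bmf (fun w => p (U w) ^+ k' * t (E_ l) (U w)).
    by apply: bmfM; [apply: bmfX; exact: (bb p (bt E0))|exact: (bb _ (bt (E_ l)))].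
  have el l : Expe P (fun w => p (U w) ^+ k' * t (E_ l) (U w)) =
      Expe P (fun w => p (U w) ^+ k' * q (U w)).
    have [g ig [g0 g1]] := frame_perm l.
    rewrite -[RHS](@Expe_isometry g (fun f => f E0 ^+ k' * f E1))//; last first.
      by apply: bborelM => //; exact: bborelX.
    by congr (Expe P _); apply/funext => w; rewrite g0 g1.
  transitivity (Expe P (fun w => p (U w) ^+ k'.+1 + \sum_l p (U w) ^+ k' * t (E_ l) (U w))).
    congr (Expe P _); apply/funext => w.
    by rewrite -mulr_sumr exprSr -mulrDr frame_sum mulr1.
  rewrite ExpeD; last 2 first.
  - by apply: bmf_intg; apply: bmfX; exact: (bb p (bt E0)).
  - by apply: intg_sum => l; exact: bmf_intg.
  congr (_ + _); rewrite Expe_sum; last by move=> l; exact: bmf_intg.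
  rewrite (eq_bigr _ (fun l _ => el l)) sumr_const card_ord.
  by rewrite mulr_natl.
- exact: half_cos_itv.
Qed.

Lemma jacobi_uniform (al be : R) x y m :
  be + 1 = D.+1%:R / 2 -> al + 1 = n.+1%:R * (D.+1%:R / 2) ->
  Expe P (fun w => jacobiP m al be (cos (dist x (U w))) * jacobiP m al be (cos (dist y (U w)))) =
  jacobi_const al be m * jacobiP m al be (cos (dist x y)).
Proof.
move=> eB eA.
have al0 : 0 < al + 1 by rewrite eA mulr_gt0// divr_gt0.
have be0 : 0 < be + 1 by rewrite eB divr_gt0.
have e u v : cos (dist u v) = 2 * t u v - 1 by rewrite /half_cos; field.
rewrite e jacobiP_horner.
transitivity (Expe P (fun w => (jacobi_poly al be m).[t x (U w)] * (jacobi_poly al be m).[t y (U w)])).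
  by congr (Expe P _); apply/funext => w; rewrite !e !jacobiP_horner.
have b z : bmf (fun w => t z (U w)) by exact: (bborel_bmf (bt z)).
rewrite (Expe_horner2 P (b x) (b y) (size_jacobi_poly al0 be0 m) (size_jacobi_poly al0 be0 m)).
rewrite -jacobi_reproducing//; apply: eq_bigr => k _; congr (_ * _).
by apply: eq_bigr => i _; rewrite (pair_mom_uniform _ _ _ _ eB eA).
Qed.

End UniformElement.

(** * Cayley-Dickson algebras *)

Section CayleyDickson.
Variable R : realType.

Fixpoint cd_scale (j : nat) (r : R) : CD R j -> CD R j :=
  match j return CD R j -> CD R j with
  | 0 => fun a => r * a
  | j'.+1 => fun a => (cd_scale r a.1, cd_scale r a.2)
  end.

Fixpoint cd_one (j : nat) : CD R j :=
  match j return CD R j with 0 => 1 | j'.+1 => (cd_one j', cd_zero j') end.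

(** The Euclidean inner product of real coordinates; [cd_re_mul] relates it to the real part of a
    product with a conjugate. *)
Fixpoint cdot (j : nat) : CD R j -> CD R j -> R :=
  match j return CD R j -> CD R j -> R with
  | 0 => fun a b => a * b
  | j'.+1 => fun a b => cdot a.1 b.1 + cdot a.2 b.2
  end.

Lemma cd_addA j : associative (@cd_add R j).
Proof. by elim: j => [|j IH] a b c /=; rewrite ?addrA// !IH. Qed.

Lemma cd_addC j : commutative (@cd_add R j).
Proof. by elim: j => [|j IH] a b /=; [rewrite addrC|rewrite (IH a.1) (IH a.2)]. Qed.

Lemma cd_add0 j : left_id (cd_zero j) (@cd_add R j).
Proof. by elim: j => [|j IH] a /=; [rewrite add0r|rewrite !IH; case: a]. Qed.

Lemma cd_addN j : left_inverse (cd_zero j) (@cd_opp R j) (@cd_add R j).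
Proof. by elim: j => [|j IH] a /=; [rewrite addNr|rewrite !IH]. Qed.

HB.instance Definition _ j := gen_eqMixin (CD R j).
HB.instance Definition _ j := gen_choiceMixin (CD R j).
HB.instance Definition _ j :=
  GRing.isZmodule.Build (CD R j) (@cd_addA j) (@cd_addC j) (@cd_add0 j) (@cd_addN j).

Lemma cd_scaleA j r s (a : CD R j) : cd_scale r (cd_scale s a) = cd_scale (r * s) a.
Proof. by elim: j a => [|j IH] a /=; rewrite ?mulrA// !IH. Qed.

Lemma cd_scale1 j : left_id 1 (@cd_scale j).
Proof. by elim: j => [|j IH] a /=; [rewrite mul1r|rewrite !IH; case: a]. Qed.

Lemma cd_scaleDr j : right_distributive (@cd_scale j) +%R.
Proof. by elim: j => [|j IH] r a b; [exact: mulrDr|rewrite /= !IH]. Qed.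

Lemma cd_scaleDl j (a : CD R j) : {morph @cd_scale j ^~ a : r s / r + s}.
Proof. by elim: j a => [|j IH] a r s; [exact: mulrDl|rewrite /= !IH]. Qed.

HB.instance Definition _ j := GRing.Zmodule_isLmodule.Build R (CD R j)
  (@cd_scaleA j) (@cd_scale1 j) (@cd_scaleDr j) (@cd_scaleDl j).

Local Notation "a ** b" := (cd_mul a b) (at level 40, left associativity).
Local Notation "a ^~" := (cd_conj a) (at level 2, format "a ^~").

Lemma cdotC j (a b : CD R j) : cdot a b = cdot b a.
Proof. by elim: j a b => [|j IH] a b /=; [rewrite mulrC|rewrite (IH a.1) (IH a.2)]. Qed.

Lemma cdotDl j (a b c : CD R j) : cdot (a + b) c = cdot a c + cdot b c.
Proof. by elim: j a b c => [|j IH] a b c; [exact: mulrDl|rewrite /= !IH; ring]. Qed.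

Lemma cdotDr j (a b c : CD R j) : cdot c (a + b) = cdot c a + cdot c b.
Proof. by rewrite cdotC cdotDl !(cdotC c). Qed.

Lemma cdotZl j r (a c : CD R j) : cdot (r *: a) c = r * cdot a c.
Proof. by elim: j a c => [|j IH] a c; [exact/esym/mulrA|rewrite /= !IH; ring]. Qed.

Lemma cdotZr j r (a c : CD R j) : cdot c (r *: a) = r * cdot c a.
Proof. by rewrite cdotC cdotZl cdotC. Qed.

Lemma cdotNl j (a c : CD R j) : cdot (- a) c = - cdot a c.
Proof. by rewrite -scaleN1r cdotZl mulN1r. Qed.

Lemma cdotNr j (a c : CD R j) : cdot c (- a) = - cdot c a.
Proof. by rewrite cdotC cdotNl cdotC. Qed.

Lemma cdot0l j (c : CD R j) : cdot 0 c = 0.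
Proof. by rewrite -(scale0r 0) cdotZl mul0r. Qed.

Lemma cdot_suml j I (s : seq I) (F : I -> CD R j) c :
  cdot (\sum_(i <- s) F i) c = \sum_(i <- s) cdot (F i) c.
Proof.
elim: s => [|i s IH]; first by rewrite !big_nil cdot0l.
by rewrite !big_cons cdotDl IH.
Qed.

Lemma cdot_ge0 j (a : CD R j) : 0 <= cdot a a.
Proof. by elim: j a => [|j IH] a /=; [rewrite -expr2 sqr_ge0|rewrite addr_ge0]. Qed.

Lemma cdot_eq0 j (a : CD R j) : cdot a a = 0 -> a = 0.
Proof.
elim: j a => [|j IH] a /=; first by move/eqP; rewrite mulf_eq0 orbb => /eqP.
move/eqP; rewrite paddr_eq0 ?cdot_ge0// => /andP[/eqP/IH a1 /eqP/IH a2].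
by case: a a1 a2 => a1 a2 /= -> ->.
Qed.

(** These unfoldings hold by conversion; rewriting with them keeps the module operations one level
    down, where the induction hypotheses are stated. *)
Lemma cdSD j (a b : CD R j.+1) :
  a + b = ((a.1 : CD R j) + b.1, (a.2 : CD R j) + b.2) :> CD R j.+1.
Proof. by []. Qed.

Lemma cdSN j (a : CD R j.+1) : - a = (- (a.1 : CD R j), - (a.2 : CD R j)) :> CD R j.+1.
Proof. by []. Qed.

Lemma cdSZ j r (a : CD R j.+1) :
  r *: a = (r *: (a.1 : CD R j), r *: (a.2 : CD R j)) :> CD R j.+1.
Proof. by []. Qed.

Lemma cdSM j (a b : CD R j.+1) : a ** b =
  ((a.1 : CD R j) ** b.1 - (b.2 : CD R j)^~ ** a.2,
   (b.2 : CD R j) ** a.1 + a.2 ** (b.1 : CD R j)^~) :> CD R j.+1.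
Proof. by []. Qed.

Lemma cdSJ j (a : CD R j.+1) :
  a^~ = ((a.1 : CD R j)^~, - (a.2 : CD R j)) :> CD R j.+1.
Proof. by []. Qed.

Lemma cd_conjK j : involutive (@cd_conj R j).
Proof. by elim: j => [|j IH] // [a b]; rewrite !cdSJ /= IH opprK. Qed.

Lemma cd_conjD j (a b : CD R j) : (a + b)^~ = a^~ + b^~.
Proof. by elim: j a b => [|j IH] // a b; rewrite cdSD !cdSJ cdSD /= IH opprD. Qed.

Lemma cd_conjZ j r (a : CD R j) : (r *: a)^~ = r *: a^~.
Proof. by elim: j a => [|j IH] // a; rewrite cdSZ !cdSJ cdSZ /= IH scalerN. Qed.

Lemma cd_conj0 j : (0 : CD R j)^~ = 0.
Proof. by rewrite -(scale0r 0) cd_conjZ !scale0r. Qed.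

Lemma cd_conjN j (a : CD R j) : (- a)^~ = - a^~.
Proof. by rewrite -[- a]scaleN1r cd_conjZ scaleN1r. Qed.

Lemma cd_conjB j (a b : CD R j) : (a - b)^~ = a^~ - b^~.
Proof. by rewrite cd_conjD cd_conjN. Qed.

Lemma cd_conj1 j : (cd_one j)^~ = cd_one j.
Proof. by elim: j => [|j IH] //; rewrite cdSJ /= IH; congr (_, _); exact (@oppr0 (CD R j)). Qed.

Lemma cdot_conj j (a b : CD R j) : cdot a^~ b^~ = cdot a b.
Proof. by elim: j a b => [|j IH] // a b; rewrite /= IH cdotNl cdotNr opprK. Qed.

Lemma cd_mulDl_mulDr j : (forall a b c : CD R j, (a + b) ** c = a ** c + b ** c) /\
  (forall a b c : CD R j, c ** (a + b) = c ** a + c ** b).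
Proof.
elim: j => [|j [IHl IHr]]; first by split => a b c; [exact: mulrDl|exact: mulrDr].
by split=> a b c; rewrite !cdSM !cdSD /= ?cd_conjD !IHl !IHr opprD; congr (_, _);
  rewrite addrACA.
Qed.

Lemma cd_mulDl j (a b c : CD R j) : (a + b) ** c = a ** c + b ** c.
Proof. by case: (cd_mulDl_mulDr j). Qed.

Lemma cd_mulDr j (a b c : CD R j) : c ** (a + b) = c ** a + c ** b.
Proof. by case: (cd_mulDl_mulDr j). Qed.

Lemma cd_mulZl_mulZr j : (forall r (a b : CD R j), (r *: a) ** b = r *: (a ** b)) /\
  (forall r (a b : CD R j), a ** (r *: b) = r *: (a ** b)).
Proof.
elim: j => [|j [IHl IHr]].
  by split => r a b; [exact/esym/mulrA|exact: mulrCA].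
by split=> r a b; rewrite !cdSM !cdSZ /= ?cd_conjZ !IHl !IHr scalerBr scalerDr.
Qed.

Lemma cd_mulZl j r (a b : CD R j) : (r *: a) ** b = r *: (a ** b).
Proof. by case: (cd_mulZl_mulZr j). Qed.

Lemma cd_mulZr j r (a b : CD R j) : a ** (r *: b) = r *: (a ** b).
Proof. by case: (cd_mulZl_mulZr j). Qed.

Lemma cd_mulNl j (a b : CD R j) : (- a) ** b = - (a ** b).
Proof. by rewrite -scaleN1r cd_mulZl scaleN1r. Qed.

Lemma cd_mulNr j (a b : CD R j) : a ** (- b) = - (a ** b).
Proof. by rewrite -scaleN1r cd_mulZr scaleN1r. Qed.

Lemma cd_mul0l j (b : CD R j) : 0 ** b = 0.
Proof. by rewrite -(scale0r 0) cd_mulZl !scale0r. Qed.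

Lemma cd_mul0r j (b : CD R j) : b ** 0 = 0.
Proof. by rewrite -(scale0r 0) cd_mulZr !scale0r. Qed.

Lemma cd_mul_suml j I (s : seq I) (F : I -> CD R j) c :
  (\sum_(i <- s) F i) ** c = \sum_(i <- s) F i ** c.
Proof.
elim: s => [|i s IH]; first by rewrite !big_nil cd_mul0l.
by rewrite !big_cons cd_mulDl IH.
Qed.

Lemma cd_mul_sumr j I (s : seq I) (F : I -> CD R j) c :
  c ** (\sum_(i <- s) F i) = \sum_(i <- s) c ** F i.
Proof.
elim: s => [|i s IH]; first by rewrite !big_nil cd_mul0r.
by rewrite !big_cons cd_mulDr IH.
Qed.

Lemma cd_mul1_1mul j : (forall a : CD R j, cd_one j ** a = a) /\
  (forall a : CD R j, a ** cd_one j = a).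
Proof.
elim: j => [|j [IHl IHr]]; first by split => a; [exact: mul1r|exact: mulr1].
have z : cd_zero j = 0 :> CD R j by [].
by split=> -[a b]; rewrite cdSM /= ?cd_conj1 z ?cd_conj0 ?IHl ?IHr ?cd_mul0l ?cd_mul0r
  ?subr0 ?addr0 ?add0r.
Qed.

Lemma cd_mul1l j (a : CD R j) : cd_one j ** a = a.
Proof. by case: (cd_mul1_1mul j). Qed.

Lemma cd_mul1r j (a : CD R j) : a ** cd_one j = a.
Proof. by case: (cd_mul1_1mul j). Qed.

Lemma cd_conjM j (a b : CD R j) : (a ** b)^~ = b^~ ** a^~.
Proof.
elim: j a b => [|j IH] a b; first exact: mulrC.
rewrite !cdSM !cdSJ /= cd_conjB !IH !cd_conjK !cd_mulNl !cd_mulNr cd_conjN cd_mulNl opprK.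
by congr (_, _); rewrite opprD addrC.
Qed.

(** Both orders of the product are proved together, since the first component at the next level is
    the sum of a_1 times its conjugate and the conjugate of a_2 times a_2. *)
Lemma cd_mul_conj j (a : CD R j) : a ** a^~ = cdot a a *: cd_one j.
Proof.
have h : a ** a^~ = cdot a a *: cd_one j /\ a^~ ** a = cdot a a *: cd_one j.
  elim: j a => [|j IH] a; first by split; exact/esym/mulr1.
  rewrite !cdSM !cdSJ /= cd_conjK cd_conjN !cd_mulNl !cd_mulNr opprK.
  rewrite (IH a.1).1 (IH a.1).2 (IH a.2).2 addNr subrr cdSZ /= -scalerDl.
  have z : cd_zero j = 0 :> CD R j by [].
  by rewrite z scaler0.
by case: h.
Qed.

Lemma cd_conj_mul j (a : CD R j) : a^~ ** a = cdot a a *: cd_one j.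
Proof. by rewrite -{2}(cd_conjK a) cd_mul_conj cdot_conj. Qed.

Lemma cd_re_mul j (a b : CD R j) : cd_re (a ** b) = cdot a b^~.
Proof.
have reD j' (x y : CD R j') : cd_re (x + y) = cd_re x + cd_re y.
  by elim: j' x y => [|j' IH] // x y; rewrite cdSD /= IH.
have reN j' (x : CD R j') : cd_re (- x) = - cd_re x.
  by elim: j' x => [|j' IH] // x; rewrite cdSN /= IH.
elim: j a b => [|j IH] // a b.
by rewrite cdSM cdSJ /= reD reN !IH cdot_conj cdotNr (cdotC b.2).
Qed.

Lemma cdot1 j (a : CD R j) : cdot (cd_one j) a = cd_re a.
Proof.
by elim: j a => [|j IH] a /=; [rewrite mul1r|rewrite IH -/(0 : CD R j) cdot0l addr0].
Qed.

Lemma cdot11 j : cdot (cd_one j) (cd_one j) = 1.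
Proof.
elim: j => [|j IH] /=; first by rewrite mulr1.
by rewrite IH -/(0 : CD R j) cdot0l addr0.
Qed.

Lemma cd_self_conj j (a : CD R j) : a^~ = a -> a = cd_re a *: cd_one j.
Proof.
elim: j a => [|j IH] a; first by move=> _; exact/esym/mulr1.
rewrite cdSJ cdSZ => e; rewrite [LHS]surjective_pairing; congr (_, _).
  by apply: IH; exact (congr1 fst e).
have b_ : - (a.2 : CD R j) = a.2 by exact (congr1 snd e).
have -> : (a.2 : CD R j) = 0.
  have : (2 : R) *: (a.2 : CD R j) = 0.
    by rewrite -[2]/(1 + 1) scalerDl scale1r -[X in X + _]b_ addNr.
  by move/eqP; rewrite scaler_eq0 pnatr_eq0 /= => /eqP.
by rewrite /= -/(0 : CD R j) scaler0.
Qed.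

Lemma cd_reM_comm j (a b : CD R j) : cd_re (a ** b) = cd_re (b ** a).
Proof. by rewrite !cd_re_mul cdotC -cdot_conj cd_conjK. Qed.

Lemma cd_re_conj j (a : CD R j) : cd_re a^~ = cd_re a.
Proof. by rewrite -!cdot1 -[in LHS]cd_conj1 cdot_conj. Qed.

(** The list starts with 1, so component 0 in this basis is the real part. *)
Fixpoint cd_basis (j : nat) : seq (CD R j) :=
  match j return seq (CD R j) with
  | 0 => [:: 1]
  | j'.+1 => [seq (b, cd_zero j') | b <- cd_basis j'] ++ [seq (cd_zero j', b) | b <- cd_basis j']
  end.

Lemma size_cd_basis j : size (cd_basis j) = (2 ^ j)%N.
Proof. by elim: j => //= j IH; rewrite size_cat !size_map IH expnS mul2n addnn. Qed.

Lemma cd_basis_sum j (a : CD R j) : \sum_(b <- cd_basis j) cdot b a ^+ 2 = cdot a a.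
Proof.
elim: j a => [|j IH] a /=; first by rewrite big_seq1 mul1r expr2.
rewrite big_cat !big_map /= -!IH; congr (_ + _); apply: eq_bigr => b _.
  by rewrite -/(0 : CD R j) cdot0l addr0.
by rewrite -/(0 : CD R j) cdot0l add0r.
Qed.

Lemma cd_basis_cons j : exists2 s, cd_basis j = cd_one j :: s &
  forall b, b \in s -> cdot (cd_one j) b = 0 /\ cdot b b = 1.
Proof.
suff [s e [/allP h1 /allP h2]] : exists2 s, cd_basis j = cd_one j :: s &
  all (fun b => cdot (cd_one j) b == 0) s /\ all (fun b => cdot b b == 1) (cd_basis j).
  exists s => // b bs; split; first exact/eqP/h1.
  by apply/eqP/h2; rewrite e inE bs orbT.
have z k : cd_zero k = 0 :> CD R k by [].
elim: j => [|j [s e [h1 h2]]].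
  by exists [::] => //; split => //=; rewrite mulr1 eqxx.
exists ([seq (b, cd_zero j) | b <- s] ++ [seq (cd_zero j, b) | b <- cd_basis j]).
  by rewrite /= e.
split; rewrite /= all_cat !all_map; apply/andP; split.
- by apply: sub_all h1 => b /= /eqP ->; rewrite z cdot0l addr0.
- by apply/allP => b _ /=; rewrite cdotC z !cdot0l addr0.
- by apply: sub_all h2 => b /= /eqP ->; rewrite z cdot0l addr0.
- by apply: sub_all h2 => b /= /eqP ->; rewrite z cdot0l add0r.
Qed.

Definition cd_assoc j := forall a b c : CD R j, a ** (b ** c) = (a ** b) ** c.

Lemma cd_mulA j : (j <= 2)%N -> cd_assoc j.
Proof.
case: j => [|[|[|//]]] _ a b c; first exact: mulrA.
  case: a b c => [a1 a2] [b1 b2] [c1 c2]; rewrite /cd_mul /=; congr (_, _); ring.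
case: a b c => [[a1 a2] [a3 a4]] [[b1 b2] [b3 b4]] [[c1 c2] [c3 c4]].
by rewrite /cd_mul /=; congr ((_, _), (_, _)); ring.
Qed.

End CayleyDickson.

(** * Composition algebras and the Moufang identities *)

Section CompositionAlgebra.
Variables (R : realType) (j : nat).
Hypothesis j_le3 : (j <= 3)%N.
Local Notation "a ** b" := (cd_mul a b) (at level 40, left associativity).
Local Notation "a ^~" := (cd_conj a) (at level 2, format "a ^~").
Implicit Types a b c d t u x y z : CD R j.

Lemma cdot_ext (k : nat) (a b : CD R k) : (forall t : CD R k, cdot a t = cdot b t) -> a = b.
Proof.
move=> h; apply/eqP; rewrite -subr_eq0; apply/eqP/cdot_eq0.
by rewrite cdotDl cdotNl h subrr.
Qed.

(** The components live one level down, at level at most 2, where multiplication is associative and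
    norms multiply by regrouping. The two cross terms agree by cyclicity of the real part and enter
    with opposite signs. *)
Lemma cd_norm_mul a b : cdot (a ** b) (a ** b) = cdot a a * cdot b b.
Proof.
have assocN k (x y : CD R k) : cd_assoc R k -> cdot (x ** y) (x ** y) = cdot x x * cdot y y.
  move=> kA; rewrite -{2}[x ** y]cd_conjK -cd_re_mul cd_conjM kA -(kA x) cd_mul_conj.
  by rewrite cd_mulZr cd_mul1r cd_mulZl cd_mul_conj -!cdot1 !cdotZr cdot11 mulr1 mulrC.
move: j_le3 a b; case: j => [|k] k3 a b; first by rewrite /=; ring.
have kA := @cd_mulA R k k3.
have cross : cdot ((a.1 : CD R k) ** b.1) ((b.2 : CD R k)^~ ** a.2) =
   cdot ((b.2 : CD R k) ** a.1) (a.2 ** (b.1 : CD R k)^~).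
  rewrite -[_ ** a.2]cd_conjK -cd_re_mul -[a.2 ** _]cd_conjK -cd_re_mul !cd_conjM !cd_conjK.
  by rewrite !kA cd_reM_comm !kA.
have e (x y : CD R k.+1) : cdot x y = cdot (x.1 : CD R k) y.1 + cdot (x.2 : CD R k) y.2 by [].
rewrite !e !cdSM /= !(cdotDl, cdotDr, cdotNl, cdotNr) !assocN// !cdot_conj.
rewrite (cdotC _ ((a.1 : CD R k) ** b.1)) (cdotC (a.2 ** _)) cross.
by ring.
Qed.

(** The full polarization of multiplicativity of the norm. Tested against an arbitrary t through
    [cdot_ext], it replaces associativity in the rest of the section. *)
Lemma cd_exchange a b c d :
  cdot (a ** b) (c ** d) + cdot (a ** d) (c ** b) = 2 * cdot a c * cdot b d.
Proof.
have h := cd_norm_mul (a + c) (b + d).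
have h1 := cd_norm_mul (a + c) b; have h2 := cd_norm_mul (a + c) d.
have h3 := cd_norm_mul a (b + d); have h4 := cd_norm_mul c (b + d).
have h5 := cd_norm_mul a b; have h6 := cd_norm_mul a d.
have h7 := cd_norm_mul c b; have h8 := cd_norm_mul c d.
rewrite !(cd_mulDl, cd_mulDr, cdotDl, cdotDr) in h h1 h2 h3 h4.
rewrite (cdotC (c ** b) (a ** b)) (cdotC c a) in h h1 h2 h3 h4.
rewrite (cdotC d b) (cdotC (c ** d) (a ** d)) in h h2 h3 h4.
rewrite (cdotC (a ** d) (a ** b)) (cdotC (c ** d) (c ** b)) in h h3 h4.
rewrite (cdotC (c ** d) (a ** b)) (cdotC (c ** b) (a ** d)) in h.
rewrite (cdotC (a ** d) (c ** b)) in h *.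
by lra.
Qed.

Lemma cd_conjE a : a^~ = (2 * cd_re a) *: cd_one R j - a.
Proof.
have e : (a + a^~)^~ = a + a^~ by rewrite cd_conjD cd_conjK addrC.
have := cd_self_conj e; rewrite -cdot1 cdotDr !cdot1 cd_re_conj => h.
by rewrite mulr_natl mulr2n -h addrC addKr.
Qed.

Lemma cdot_mulr a b d : cdot b (a ** d) = cdot (a^~ ** b) d.
Proof.
have := cd_exchange a b (cd_one R j) d; rewrite !cd_mul1l => h.
rewrite cd_conjE cd_mulDl cd_mulNl cd_mulZl cd_mul1l cdotDl cdotNl cdotZl -cdot1 cdotC.
rewrite (cdotC a) in h; rewrite -h cdotC; ring.
Qed.

Lemma cdot_mull a b d : cdot a (d ** b) = cdot (a ** b^~) d.
Proof. by rewrite -cdot_conj cd_conjM cdot_mulr cd_conjK -cdot_conj cd_conjM !cd_conjK. Qed.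

Lemma cdot_mul2l u a b : cdot (u ** a) (u ** b) = cdot u u * cdot a b.
Proof. by have := cd_exchange u a u b; rewrite (cdotC (u ** b)) => h; lra. Qed.

Lemma cdot_mul2r u a b : cdot (a ** u) (b ** u) = cdot u u * cdot a b.
Proof. by have := cd_exchange a u b u => h; lra. Qed.

Lemma cd_mulKl u a : u^~ ** (u ** a) = cdot u u *: a.
Proof.
apply: cdot_ext => t; rewrite -cdot_mulr cdot_mul2l cdotZl.
by [].
Qed.

Lemma cd_mulKr u a : (a ** u) ** u^~ = cdot u u *: a.
Proof. by apply: cdot_ext => t; rewrite -cdot_mull cdot_mul2r cdotZl. Qed.

Lemma cd_mulKVl u a : u ** (u^~ ** a) = cdot u u *: a.
Proof. by rewrite -{1}(cd_conjK u) cd_mulKl cdot_conj. Qed.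

Lemma cd_mulKVr u a : (a ** u^~) ** u = cdot u u *: a.
Proof. by rewrite -{2}(cd_conjK u) cd_mulKr cdot_conj. Qed.

(** The right side contains no triple product, which reduces the Moufang identities to instances of
    [cd_exchange]. *)
Lemma cd_sandwich u x : (u ** x) ** u = (2 * cdot x u^~) *: u - cdot u u *: x^~.
Proof.
apply: cdot_ext => t; rewrite cdotC cdot_mull cdotC.
have := cd_exchange u x t u^~; rewrite cd_mul_conj cdotZl cdot1 cd_re_mul => h.
rewrite cdotDl cdotNl !cdotZl (cdotC x^~); lra.
Qed.

(** The middle, left and right Moufang identities are the three compatibility conditions needed in
    [triality_mul]. *)
Lemma moufang_middle u y z : (u ** y) ** (z ** u) = (u ** (y ** z)) ** u.
Proof.
apply: cdot_ext => t; rewrite cd_sandwich cdotDl cdotNl !cdotZl.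
rewrite cdotC cdot_mull cdotC cd_conjM.
have := cd_exchange u y t (u^~ ** z^~); rewrite cd_mulKVl cdotZl => h.
have e1 : cdot y (u^~ ** z^~) = cdot (y ** z) u^~ by rewrite cdot_mull cd_conjK.
have e2 : cdot z^~ (t ** y) = cdot (y ** z)^~ t by rewrite cdot_mull cd_conjM.
rewrite e1 in h; rewrite e2 in h; lra.
Qed.

Lemma moufang_left u x y : ((u ** x) ** u) ** y = u ** (x ** (u ** y)).
Proof.
apply: cdot_ext => t; rewrite cd_sandwich cd_mulDl cd_mulNl !cd_mulZl cdotDl cdotNl !cdotZl.
have -> : cdot (u ** (x ** (u ** y))) t = cdot (x ** (u ** y)) (u^~ ** t).
  by rewrite cdotC cdot_mulr cdotC.
have := cd_exchange x (u ** y) u^~ t; rewrite cd_mulKl cdotZr => h.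
have e : cdot (x ** t) y = cdot (x^~ ** y) t by rewrite cdotC cdot_mulr.
rewrite e in h; lra.
Qed.

Lemma moufang_right u x z : z ** ((u ** x) ** u) = ((z ** u) ** x) ** u.
Proof.
apply: cdot_ext => t; rewrite cd_sandwich cd_mulDr cd_mulNr !cd_mulZr cdotDl cdotNl !cdotZl.
have -> : cdot (z ** u ** x ** u) t = cdot (z ** u ** x) (t ** u^~).
  by rewrite cdotC cdot_mull cdotC.
have := cd_exchange (z ** u) x t u^~; rewrite cd_mulKr cdotZl => h.
have e : cdot z (t ** x) = cdot (z ** x^~) t by rewrite cdot_mull.
rewrite e in h; lra.
Qed.

End CompositionAlgebra.

(** * Projective spaces *)

Section ProjectiveSpace.
Variables (R : realType) (j n : nat).
Local Notation "a ** b" := (cd_mul a b) (at level 40, left associativity).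
Local Notation "a ^~" := (cd_conj a) (at level 2, format "a ^~").
Local Notation pmx := (proj_mx R j n).
Local Notation pt := (proj_pt R j n).
Local Notation one := (cd_one R j).

Definition inner (x y : pt) : R := proj_inner (proj1_sig x) (proj1_sig y).

Lemma proj_innerE (P Q : pmx) : proj_inner P Q = \sum_i \sum_k cdot (P i k) (Q i k).
Proof. by apply: eq_bigr => i _; apply: eq_bigr => k _; rewrite cd_re_mul cd_conjK. Qed.

Lemma proj_pt_eq (x y : pt) : proj1_sig x = proj1_sig y -> x = y.
Proof. by case: x y => [P hP] [Q hQ] /= PQ; subst Q; congr exist; exact: Prop_irrelevance. Qed.

Lemma proj_mx_ext (P Q : pmx) : (forall i k, P i k = Q i k) -> P = Q.
Proof. by move=> h; apply/funext => i; apply/funext => k. Qed.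

Lemma proj_trace (P : pmx) : (forall i k, P k i = (P i k)^~) ->
  (forall i k, \sum_l (P i l ** P l k) = P i k) ->
  \sum_i cd_re (P i i) = proj_inner P P.
Proof.
move=> hP iP; rewrite proj_innerE; apply: eq_bigr => i _.
rewrite -[in LHS]iP -cdot1 cdotC cdot_suml; apply: eq_bigr => l _.
by rewrite cdotC cdot1 cd_re_mul (hP i l) cd_conjK.
Qed.

Lemma proj_herm (x : pt) i k : proj1_sig x k i = (proj1_sig x i k)^~.
Proof. by case: x => P []. Qed.

Lemma proj_idem (x : pt) i k : \sum_l (proj1_sig x i l ** proj1_sig x l k) = proj1_sig x i k.
Proof. by case: x => P []. Qed.

Lemma inner_self (x : pt) : inner x x = 1.
Proof.
by rewrite /inner -proj_trace; [case: x => P []|exact: proj_herm|exact: proj_idem].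
Qed.

(** For a Hermitian idempotent the trace is the squared norm, and invariance of the norm is what the
    actions below give directly. *)
Lemma mk_proj_pt (P : pmx) : (forall i k, P k i = (P i k)^~) ->
  (forall i k, \sum_l (P i l ** P l k) = P i k) -> proj_inner P P = 1 -> is_proj_pt P.
Proof. by move=> h1 h2 h3; split => //; rewrite proj_trace. Qed.

Definition diag (x : pt) (i : 'I_n.+1) : R := cd_re (proj1_sig x i i).

Lemma diagE (x : pt) i : proj1_sig x i i = diag x i *: one.
Proof. by apply: cd_self_conj; rewrite -proj_herm. Qed.

Lemma diag_sum (x : pt) : \sum_i diag x i = 1.
Proof. by case: x => P []. Qed.

Lemma diag_norm (x : pt) i : diag x i = \sum_l cdot (proj1_sig x i l) (proj1_sig x i l).
Proof.
rewrite /diag -proj_idem -cdot1 cdotC cdot_suml; apply: eq_bigr => l _.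
by rewrite cdotC cdot1 cd_re_mul -proj_herm.
Qed.

Lemma diag_ge0 (x : pt) i : 0 <= diag x i.
Proof. by rewrite diag_norm sumr_ge0// => l _; exact: cdot_ge0. Qed.

Definition inner_iso (g : pt -> pt) :=
  bijective g /\ forall x y, inner (g x) (g y) = inner x y.

Lemma inner_iso_comp g h : inner_iso g -> inner_iso h -> inner_iso (g \o h).
Proof.
move=> [bg ig] [bh ih]; split; first exact: bij_comp.
by move=> x y; rewrite /= ig ih.
Qed.

Lemma inner_iso_inv g : inner_iso g ->
  exists2 h, inner_iso h & cancel g h /\ cancel h g.
Proof.
move=> [[h gK hK] ig]; exists h => //; split; first by exists g.
by move=> x y; rewrite -{2}(hK x) -{2}(hK y) ig.
Qed.

Lemma inner_isometry g : inner_iso g -> isometry (@proj_rho R j n) g.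
Proof. by move=> [bg ig]; split=> // x y; rewrite /proj_rho -!/(inner _ _) ig. Qed.

(** [lmx] and [rmx] multiply by O on the left and by its transpose on the right. Real scalars
    commute and associate with everything, so conjugation by a real orthogonal matrix acts on
    projective points over the octonions too. *)
Definition lmx (O : 'M[R]_n.+1) (P : pmx) : pmx := fun i k => \sum_a O i a *: P a k.
Definition rmx (P : pmx) (O : 'M[R]_n.+1) : pmx := fun i k => \sum_b O k b *: P i b.

Lemma lmx_rmx O P : lmx O (rmx P O) = rmx (lmx O P) O.
Proof.
apply: proj_mx_ext => i k; rewrite /lmx /rmx.
under eq_bigr do rewrite scaler_sumr.
rewrite exchange_big /=; apply: eq_bigr => b _; rewrite scaler_sumr.
by apply: eq_bigr => a _; rewrite !scalerA mulrC.
Qed.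

Section Orthogonal.
Variable O : 'M[R]_n.+1.
Hypothesis OO : O^T *m O = 1%:M.

Lemma orth_col a b : \sum_l O l a * O l b = (a == b)%:R.
Proof.
have /matrixP/(_ a b) := OO; rewrite !mxE => <-.
by apply: eq_bigr => l _; rewrite mxE.
Qed.

Lemma orth_mul (p q : 'I_n.+1 -> CD R j) :
  \sum_l ((\sum_b O l b *: p b) ** (\sum_c O l c *: q c)) = \sum_b p b ** q b.
Proof.
transitivity (\sum_b \sum_c (\sum_l O l b * O l c) *: (p b ** q c)).
  under eq_bigr do rewrite cd_mul_suml.
  rewrite exchange_big /=; apply: eq_bigr => b _.
  under eq_bigr do rewrite cd_mul_sumr.
  rewrite exchange_big /=; apply: eq_bigr => c _.
  rewrite scaler_suml; apply: eq_bigr => l _.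
  by rewrite cd_mulZl cd_mulZr scalerA.
apply: eq_bigr => b _; rewrite (bigD1 b)//= orth_col eqxx scale1r [X in _ + X]big1 ?addr0// => c cb.
by rewrite orth_col eq_sym (negbTE cb) scale0r.
Qed.

Lemma orth_cdot (p q : 'I_n.+1 -> CD R j) :
  \sum_l cdot (\sum_b O l b *: p b) (\sum_c O l c *: q c) = \sum_b cdot (p b) (q b).
Proof.
transitivity (\sum_b \sum_c (\sum_l O l b * O l c) * cdot (p b) (q c)).
  under eq_bigr do rewrite cdot_suml.
  rewrite exchange_big /=; apply: eq_bigr => b _.
  under eq_bigr do rewrite cdotC cdot_suml.
  rewrite exchange_big /=; apply: eq_bigr => c _.
  rewrite mulr_suml; apply: eq_bigr => l _.
  by rewrite cdotZl cdotZr (cdotC (q c)); ring.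
apply: eq_bigr => b _; rewrite (bigD1 b)//= orth_col eqxx mul1r [X in _ + X]big1 ?addr0// => c cb.
by rewrite orth_col eq_sym (negbTE cb) mul0r.
Qed.

Lemma conj_lincomb (F : 'I_n.+1 -> CD R j) (r : 'I_n.+1 -> R) :
  (\sum_a r a *: F a)^~ = \sum_a r a *: (F a)^~.
Proof.
elim: (index_enum _) => [|a s IH]; first by rewrite !big_nil cd_conj0.
by rewrite !big_cons cd_conjD cd_conjZ IH.
Qed.

Lemma real_act_inner (P Q : pmx) :
  proj_inner (lmx O (rmx P O)) (lmx O (rmx Q O)) = proj_inner P Q.
Proof.
rewrite !proj_innerE /lmx exchange_big /=.
under eq_bigr do rewrite orth_cdot.
by rewrite exchange_big /=; apply: eq_bigr => i _; rewrite /rmx orth_cdot.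
Qed.

Lemma real_act_pt (P : pmx) : is_proj_pt P -> is_proj_pt (lmx O (rmx P O)).
Proof.
move=> hP; pose x : pt := exist _ P hP.
have hh : forall i k, P k i = (P i k)^~ := @proj_herm x.
have hi : forall i k, \sum_l (P i l ** P l k) = P i k := @proj_idem x.
apply: mk_proj_pt.
- move=> i k; rewrite {1}lmx_rmx /lmx /rmx conj_lincomb; apply: eq_bigr => a _.
  rewrite conj_lincomb; congr (_ *: _); apply: eq_bigr => b _.
  by rewrite hh.
- move=> i k; rewrite {2}lmx_rmx /lmx /rmx.
  under eq_bigr do rewrite cd_mul_suml.
  rewrite exchange_big /=; apply: eq_bigr => a _.
  under eq_bigr do rewrite cd_mulZl cd_mul_sumr.
  rewrite -scaler_sumr; congr (_ *: _).
  rewrite exchange_big /=; apply: eq_bigr => b _.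
  under eq_bigr do rewrite cd_mulZr.
  rewrite -scaler_sumr; congr (_ *: _).
  by rewrite orth_mul hi.
- by rewrite real_act_inner; exact: (inner_self x).
Qed.

End Orthogonal.

Lemma lmx_mul O O' P : lmx O (lmx O' P) = lmx (O *m O') P.
Proof.
apply: proj_mx_ext => i k; rewrite /lmx.
under eq_bigr do rewrite scaler_sumr.
rewrite exchange_big /=; apply: eq_bigr => a _; rewrite mxE scaler_suml.
by apply: eq_bigr => b _; rewrite scalerA.
Qed.

Lemma rmx_mul O O' P : rmx (rmx P O') O = rmx P (O *m O').
Proof.
apply: proj_mx_ext => i k; rewrite /rmx.
under eq_bigr do rewrite scaler_sumr.
rewrite exchange_big /=; apply: eq_bigr => a _; rewrite mxE scaler_suml.
by apply: eq_bigr => b _; rewrite scalerA.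
Qed.

Lemma lmx1 P : lmx 1%:M P = P.
Proof.
apply: proj_mx_ext => i k; rewrite /lmx (bigD1 i)//= big1 ?addr0; last first.
  by move=> a ai; rewrite mxE eq_sym (negbTE ai) scale0r.
by rewrite mxE eqxx scale1r.
Qed.

Lemma rmx1 P : rmx P 1%:M = P.
Proof.
apply: proj_mx_ext => i k; rewrite /rmx (bigD1 k)//= big1 ?addr0; last first.
  by move=> a ai; rewrite mxE eq_sym (negbTE ai) scale0r.
by rewrite mxE eqxx scale1r.
Qed.

Definition ray_mx (v : 'cV[R]_n.+1) : pmx := fun i k => (v i 0 * v k 0) *: one.

Lemma ray_is_pt v : dot v v = 1 -> is_proj_pt (ray_mx v).
Proof.
move=> v1; apply: mk_proj_pt.
- by move=> i k; rewrite /ray_mx cd_conjZ cd_conj1 mulrC.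
- move=> i k; rewrite /ray_mx -[RHS]scale1r -v1 /dot scaler_suml; apply: eq_bigr => l _.
  by rewrite cd_mulZl cd_mulZr cd_mul1l !scalerA; congr (_ *: _); ring.
- rewrite proj_innerE -[RHS](mulr1 1) -v1 /dot mulr_suml; apply: eq_bigr => i _.
  rewrite mulr_sumr; apply: eq_bigr => k _.
  by rewrite /ray_mx cdotZl cdotZr cdot11; ring.
Qed.

Definition ray v (v1 : dot v v = 1) : pt := exist _ _ (ray_is_pt v1).

Lemma inner_ray v (v1 : dot v v = 1) u :
  inner (ray v1) u = \sum_i \sum_k v i 0 * v k 0 * cd_re (proj1_sig u i k).
Proof.
rewrite /inner proj_innerE; apply: eq_bigr => i _; apply: eq_bigr => k _.
by rewrite /= /ray_mx cdotZl cdot1.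
Qed.

Lemma reflection_iso (O : 'M[R]_n.+1) : O^T = O -> O *m O = 1%:M ->
  exists2 g, inner_iso g & forall v (v1 : dot v v = 1) (w1 : dot (O *m v) (O *m v) = 1),
    g (ray v1) = ray w1.
Proof.
move=> OT OO; have OtO : O^T *m O = 1%:M by rewrite OT.
pose g (x : pt) : pt := exist _ _ (real_act_pt OtO (proj2_sig x)).
have gK : involutive g.
  move=> x; apply: proj_pt_eq => /=.
  by rewrite lmx_rmx lmx_mul OO lmx1 rmx_mul OO rmx1.
exists g; first by split; [exists g|move=> x y; exact: real_act_inner].
move=> v v1 w1; apply: proj_pt_eq; apply: proj_mx_ext => i k /=.
rewrite /lmx /rmx /ray_mx !mxE mulr_suml scaler_suml; apply: eq_bigr => a _.
rewrite scaler_sumr mulr_sumr scaler_suml; apply: eq_bigr => b _.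
by rewrite !scalerA; congr (_ *: _); ring.
Qed.

End ProjectiveSpace.

Lemma dot_delta (R : realType) n (i : 'I_n) (v : 'cV[R]_n) : dot (delta_mx i 0) v = v i 0.
Proof.
rewrite /dot (bigD1 i)//= !mxE !eqxx mul1r big1 ?addr0// => k ki.
by rewrite mxE (negbTE ki) mul0r.
Qed.

Lemma dot_delta1 (R : realType) n (i : 'I_n) :
  dot (delta_mx i 0 : 'cV[R]_n) (delta_mx i 0) = 1.
Proof. by rewrite dot_delta mxE !eqxx. Qed.

Lemma dotDl (R : realType) n (u v w : 'cV[R]_n) : dot (u + v) w = dot u w + dot v w.
Proof. by rewrite /dot -big_split; apply: eq_bigr => i _; rewrite !mxE mulrDl. Qed.

(** * Frames of projective spaces *)

Section ProjectiveFrame.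
Variables (R : realType) (j n : nat).
Local Notation "a ** b" := (cd_mul a b) (at level 40, left associativity).
Local Notation "a ^~" := (cd_conj a) (at level 2, format "a ^~").
Local Notation N := n.+2.
Local Notation pmx := (proj_mx R j n.+1).
Local Notation pt := (proj_pt R j n.+1).
Local Notation one := (cd_one R j).

Definition root_diag (x : pt) : 'cV[R]_N := \col_i Num.sqrt (diag x i).

Lemma root_diag_dot (x : pt) : dot (root_diag x) (root_diag x) = 1.
Proof.
rewrite -(diag_sum x); apply: eq_bigr => i _.
by rewrite mxE -expr2 sqr_sqrtr// diag_ge0.
Qed.

Definition vertex (l : 'I_N) : pt := ray j (dot_delta1 R l).

(** Since all |u_i|^2 are kept, this says that the phases of all coordinates of a point can be
    removed at once. It is proved separately for associative algebras and for the octonions. *)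
Definition straightenable := forall x : pt, exists2 g, @inner_iso R j n.+1 g &
  (forall l, g (vertex l) = vertex l) /\ g x = ray j (root_diag_dot x).

Lemma ray_eq (v w : 'cV[R]_N) (v1 : dot v v = 1) (w1 : dot w w = 1) :
  v = w -> ray j v1 = ray j w1.
Proof. by move=> vw; subst w; congr (ray j); exact: Prop_irrelevance. Qed.

Lemma inner_vertex l u : inner (vertex l) u = diag u l.
Proof.
rewrite inner_ray (bigD1 l)//= (bigD1 l)//= !mxE !eqxx !mul1r big1 ?addr0; last first.
  by move=> k kl; rewrite !mxE (negbTE kl) mulr0 mul0r.
by rewrite big1 ?addr0// => i il; rewrite big1// => k _; rewrite !mxE (negbTE il) !mul0r.
Qed.

Lemma reflection_ray (v w : 'cV[R]_N) (v1 : dot v v = 1) (w1 : dot w w = 1) :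
  exists2 g, @inner_iso R j n.+1 g & g (ray j v1) = ray j w1 /\
    forall u (u1 : dot u u = 1), dot (v - w) u = 0 -> g (ray j u1) = ray j u1.
Proof.
have [Q [QT QQ Qv Qfix]] := exists_reflection (etrans v1 (esym w1)).
have [g ig gray] := reflection_iso j QT QQ.
exists g => //; split.
  have w1' : dot (Q *m v) (Q *m v) = 1 by rewrite Qv.
  by rewrite (gray _ _ w1'); apply: ray_eq.
move=> u u1 vwu; have u1' : dot (Q *m u) (Q *m u) = 1 by rewrite Qfix.
by rewrite (gray _ _ u1'); apply: ray_eq; rewrite Qfix.
Qed.

Local Notation i0 := (ord0 : 'I_N).
Local Notation i1 := (lift ord0 ord0 : 'I_N).

Definition plane_vec (a b : R) : 'cV[R]_N := a *: delta_mx i0 0 + b *: delta_mx i1 0.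

Lemma plane_vecE a b i : plane_vec a b i 0 = a * (i == i0)%:R + b * (i == i1)%:R.
Proof. by rewrite !mxE !eqxx !andbT. Qed.

Lemma plane_vec_dot a b : a ^+ 2 + b ^+ 2 = 1 -> dot (plane_vec a b) (plane_vec a b) = 1.
Proof.
move=> ab; rewrite {1}/plane_vec dotDl !dotZl !dot_delta !plane_vecE /=.
by rewrite !mulr1 !mulr0 addr0 add0r -!expr2.
Qed.

Lemma sum_plane (V : nmodType) (F : 'I_N -> V) :
  (forall i, i != i0 -> i != i1 -> F i = 0) -> \sum_i F i = F i0 + F i1.
Proof.
move=> F0; rewrite (bigD1 i0)//= (bigD1 i1)//= big1 ?addr0// => i /andP[h1 h2].
exact: F0.
Qed.

Lemma inner_plane a b (ab : a ^+ 2 + b ^+ 2 = 1) u :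
  inner (ray j (plane_vec_dot ab)) u =
  a ^+ 2 * diag u i0 + b ^+ 2 * diag u i1 + 2 * a * b * cd_re (proj1_sig u i0 i1).
Proof.
rewrite inner_ray sum_plane; last first.
  by move=> i /negbTE h1 /negbTE h2; rewrite big1// => k _;
    rewrite plane_vecE h1 h2 !mulr0 addr0 !mul0r.
rewrite !sum_plane; last 2 first.
- by move=> k /negbTE h1 /negbTE h2; rewrite !plane_vecE h1 h2 !(mulr0, addr0, mul0r).
- by move=> k /negbTE h1 /negbTE h2; rewrite !plane_vecE h1 h2 !(mulr0, addr0, mul0r).
rewrite !plane_vecE /= !mulr1 !mulr0 !addr0 !add0r /diag (proj_herm u i0 i1) cd_re_conj.
by ring.
Qed.

Hypothesis straight : straightenable.
Hypothesis j_le3 : (j <= 3)%N.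
Hypothesis offdiag_norm : forall (x : pt) i k,
  cdot (proj1_sig x i k) (proj1_sig x i k) = diag x i * diag x k.

Lemma diag_le1 (x : pt) i : diag x i <= 1.
Proof.
rewrite -(diag_sum x) (bigD1 i)//= lerDl sumr_ge0// => k _; exact: diag_ge0.
Qed.

(** Straighten x, reflect it to the first vertex, straighten the image of y without moving that
    vertex, and reflect it into the plane of the first two coordinates. The bound on [inner x y],
    required to invert [acos], comes from the same motion. *)
Lemma standard_pair (x y : pt) : 0 <= inner x y <= 1 /\
  exists2 g, @inner_iso R j n.+1 g & g x = vertex i0 /\
    forall ab : Num.sqrt (inner x y) ^+ 2 + Num.sqrt (1 - inner x y) ^+ 2 = 1,
    g y = ray j (plane_vec_dot ab).
Proof.
have [g1 ig1 [_ g1x]] := straight x.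
have [g2 ig2 [g2x _]] := reflection_ray (root_diag_dot x) (dot_delta1 R i0).
pose y2 := g2 (g1 y).
have [g3 ig3 [g3E g3y]] := straight y2.
have x2 : g2 (g1 x) = vertex i0 by rewrite g1x g2x.
have cE : inner x y = diag y2 i0 by rewrite -inner_vertex -x2 ig2.2 ig1.2.
have c01 : 0 <= inner x y <= 1 by rewrite cE diag_ge0 diag_le1.
split=> //.
have ab : Num.sqrt (inner x y) ^+ 2 + Num.sqrt (1 - inner x y) ^+ 2 = 1.
  by case/andP: c01 => c0 c1; rewrite !sqr_sqrtr ?subr_ge0// addrC subrK.
(* Both vectors have first coordinate sqrt(inner x y), so the first basis vector is orthogonal to
   their difference and its vertex is fixed. *)
have [g4 ig4 [g4y g4fix]] := reflection_ray (root_diag_dot y2) (plane_vec_dot ab).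
exists (g4 \o (g3 \o (g2 \o g1))); first by do 3! apply: inner_iso_comp => //.
split => [|ab'] /=.
  rewrite x2 g3E /vertex g4fix// dotBl !(dotC _ (delta_mx _ _)) !dot_delta plane_vecE mxE cE /=.
  by rewrite mulr1 mulr0 addr0 subrr.
rewrite -/y2 g3y g4y; exact: ray_eq.
Qed.

Lemma inner_itv (x y : pt) : 0 <= inner x y <= 1.
Proof. by case: (standard_pair x y). Qed.

Lemma half_cos_proj (x y : pt) : half_cos (@proj_rho R j n.+1) x y = inner x y.
Proof.
rewrite /half_cos /proj_rho -/(inner x y) acosK; first by field.
have /andP[c0 c1] := inner_itv x y.
by rewrite in_itv/=; apply/andP; split; lra.
Qed.

(** For a unit b, the point with |u_0|^2 = |u_1|^2 = 1/2 and relative phase b. *)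
Definition edge_mx (b : CD R j) : pmx := fun i k =>
  if (i == i0) && (k == i0) then 2^-1 *: one
  else if (i == i1) && (k == i1) then 2^-1 *: one
  else if (i == i0) && (k == i1) then 2^-1 *: b
  else if (i == i1) && (k == i0) then 2^-1 *: b^~ else 0.

Lemma edge_mx0 b i k : (i != i0) && (i != i1) || (k != i0) && (k != i1) -> edge_mx b i k = 0.
Proof.
rewrite /edge_mx; case: (eqVneq i i0) => [->|h1] /=; case: (eqVneq k i0) => [->|h2] //=.
- by move=> /negbTE ->.
- by rewrite ?andbF orbF; case: (eqVneq i i1) => //= ->.
- by case: (eqVneq i i1) => //= _; case: (eqVneq k i1) => //= _.
Qed.

Lemma edge_mxE b : [/\ edge_mx b i0 i0 = 2^-1 *: one, edge_mx b i1 i1 = 2^-1 *: one,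
  edge_mx b i0 i1 = 2^-1 *: b & edge_mx b i1 i0 = 2^-1 *: b^~].
Proof. by split; rewrite /edge_mx /=. Qed.

Lemma proj_inner_edge b (P : pmx) : proj_inner (edge_mx b) P =
  (cd_re (P i0 i0) + cd_re (P i1 i1) + cdot b (P i0 i1) + cdot b^~ (P i1 i0)) / 2.
Proof.
have [e1 e2 e3 e4] := edge_mxE b.
rewrite proj_innerE sum_plane; last first.
  by move=> i h1 h2; rewrite big1// => k _; rewrite edge_mx0 ?h1 ?h2// cdot0l.
rewrite !sum_plane; last 2 first.
- by move=> k h1 h2; rewrite edge_mx0 ?h1 ?h2 ?orbT// cdot0l.
- by move=> k h1 h2; rewrite edge_mx0 ?h1 ?h2 ?orbT// cdot0l.
by rewrite e1 e2 e3 e4 !cdotZl !cdot1; field.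
Qed.

Lemma edge_is_pt b : cdot b b = 1 -> is_proj_pt (edge_mx b).
Proof.
move=> b1; have [e1 e2 e3 e4] := edge_mxE b; apply: mk_proj_pt.
- move=> i k; have [/orP h|] := boolP (((i != i0) && (i != i1)) || ((k != i0) && (k != i1))).
    by rewrite !edge_mx0 ?cd_conj0//; apply/orP; case: h; [left|right|right|left].
  rewrite negb_or !negb_and !negbK => /andP[/orP[] /eqP -> /orP[] /eqP ->];
    by rewrite ?e1 ?e2 ?e3 ?e4 cd_conjZ ?cd_conj1 ?cd_conjK.
- move=> i k; rewrite sum_plane; last first.
    by move=> l h1 h2; rewrite edge_mx0 ?cd_mul0l// h1 h2 orbT.
  have [/orP h|] := boolP (((i != i0) && (i != i1)) || ((k != i0) && (k != i1))).
    rewrite [RHS]edge_mx0; last by apply/orP.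
    case: h => h; first by rewrite ![edge_mx b i _]edge_mx0 ?h// !cd_mul0l addr0.
    by rewrite ![edge_mx b _ k]edge_mx0 ?h ?orbT// !cd_mul0r addr0.
  have hh : 2^-1 * 2^-1 + 2^-1 * 2^-1 = 2^-1 :> R by field.
  rewrite negb_or !negb_and !negbK => /andP[/orP[] /eqP -> /orP[] /eqP ->];
    rewrite ?e1 ?e2 ?e3 ?e4 !cd_mulZl !cd_mulZr ?cd_mul_conj ?cd_conj_mul ?b1 ?scale1r
      ?cd_mul1l ?cd_mul1r !scalerA -scalerDl hh; by [].
- by rewrite proj_inner_edge e1 e2 e3 e4 -!cdot1 !cdotZr cdot_conj b1 !cdot11; field.
Qed.

Definition edge b (b1 : cdot b b = 1) : pt := exist _ _ (edge_is_pt b1).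

Lemma inner_edge b (b1 : cdot b b = 1) u :
  inner (edge b1) u = (diag u i0 + diag u i1) / 2 + cdot b (proj1_sig u i0 i1).
Proof.
rewrite /inner proj_inner_edge (proj_herm u i0 i1) cdot_conj /diag; by field.
Qed.

(** All edges have the same diagonal, so straightening sends them to the same ray; one straightening
    followed by the inverse of another moves edge to edge. *)
Lemma edge_move b c (b1 : cdot b b = 1) (c1 : cdot c c = 1) :
  exists2 h, @inner_iso R j n.+1 h &
    (forall l, h (vertex l) = vertex l) /\ h (edge b1) = edge c1.
Proof.
have [g ig [gE gb]] := straight (edge b1).
have [g' ig' [gE' gc]] := straight (edge c1).
have [h ih [gK hK]] := inner_iso_inv ig'.
exists (h \o g); first exact: inner_iso_comp.
split=> [l|] /=; first by rewrite gE -{1}gE' gK.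
rewrite gb -[RHS]gK gc; congr h; apply: ray_eq; apply/matrixP => i k; rewrite !mxE.
congr Num.sqrt; rewrite /diag /= /edge_mx.
by rewrite !andbb; case: (i == i0) => //; case: (i == i1).
Qed.

Lemma basis_unit m : cdot (nth one (cd_basis R j) m) (nth one (cd_basis R j) m) = 1.
Proof.
have [s e h] := cd_basis_cons R j; rewrite e; case: m => [|m] /=; first exact: cdot11.
have [ms|ms] := ltnP m (size s); last by rewrite nth_default// cdot11.
by have [] := h _ (mem_nth one ms).
Qed.

Lemma proj_jacobi_uniform (dT : measure_display) (T : measurableType dT) (P : probability T R)
  (U : T -> pt) (al be : R) x y m :
  random_element (@proj_rho R j n.+1) U -> uniform_el P (@proj_rho R j n.+1) U ->
  be + 1 = (2 ^ j)%:R / 2 -> al + 1 = n.+1%:R * ((2 ^ j)%:R / 2) ->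
  Expe P (fun w => jacobiP m al be (cos (proj_rho x (U w))) * jacobiP m al be (cos (proj_rho y (U w)))) =
  jacobi_const al be m * jacobiP m al be (cos (proj_rho x y)).
Proof.
move=> Uel Uun; have D2 : (2 ^ j = (2 ^ j).-1.+1)%N by rewrite prednK// expn_gt0.
rewrite D2; set D := (2 ^ j).-1 => eB eA.
have [s eb hs] := cd_basis_cons R j.
pose Q (k : 'I_D.+1) : pt := edge (basis_unit k).
have zE (k : 'I_D.+1) u : inner (Q k) u - (inner (vertex i0) u + inner (vertex i1) u) / 2 =
    cdot (nth one (cd_basis R j) k) (proj1_sig u i0 i1).
  by rewrite inner_edge !inner_vertex addrC addKr.
have n0 : nth one (cd_basis R j) (ord0 : 'I_D.+1) = one by rewrite eb.
apply: (@jacobi_uniform R pt (@proj_rho R j n.+1) dT T P U Uel Uun D n (vertex i0) (vertex i1)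
  Q (fun l => vertex (lift ord0 l))) eB eA => //.
- move=> u; under eq_bigr do rewrite !half_cos_proj zE.
  rewrite !half_cos_proj !inner_vertex -offdiag_norm -(cd_basis_sum (proj1_sig u i0 i1)) (big_nth one) size_cd_basis D2.
  by rewrite big_mkord.
(* [frame_sym]: the edge of 1 goes to the edge of -1, which negates the real part of the
   off-diagonal entry. *)
- have m1 : cdot (- one) (- one) = 1 by rewrite cdotNl cdotNr opprK cdot11.
  have [h ih [hE hb]] := edge_move (basis_unit (ord0 : 'I_D.+1)) m1.
  exists h; first exact: inner_isometry.
  split=> // u; rewrite !half_cos_proj zE hb n0 inner_edge !inner_vertex addrC addKr.
  by rewrite cdotNl.
- move=> k a b k0 ab; set e := nth one (cd_basis R j) k.
  have [e0 e1] : cdot one e = 0 /\ cdot e e = 1.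
    have kgt : (0 < k)%N by rewrite lt0n; exact: k0.
    have ks : (k.-1 < size s)%N.
      have := size_cd_basis R j; rewrite eb /= D2 => -[] ->.
      by rewrite -ltnS prednK// ltn_ord.
    by rewrite /e -(prednK kgt) eb /=; apply: hs; exact: mem_nth.
  (* [frame_rot]: this combination is a unit because 1 and e are orthonormal, and its edge reads off
     the rotated component. *)
  have u1 : cdot (a *: one + b *: e) (a *: one + b *: e) = 1.
    rewrite !(cdotDl, cdotDr, cdotZl, cdotZr) cdot11 e1 (cdotC e one) e0 -[RHS]ab; ring.
  have [h ih [hE hb]] := edge_move (basis_unit (ord0 : 'I_D.+1)) u1.
  exists h; first exact: inner_isometry.
  split=> // u; rewrite !half_cos_proj !zE hb n0 inner_edge !inner_vertex addrC addKr.
  by rewrite cdotDl !cdotZl.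
- move=> a b ab; have [g ig [gv _]] := reflection_ray (dot_delta1 R i0) (plane_vec_dot ab).
  exists g; first exact: inner_isometry.
  move=> u; rewrite !half_cos_proj zE n0 cdot1 !inner_vertex /vertex gv.
  exact: inner_plane.
- move=> u; rewrite half_cos_proj inner_vertex -[RHS](diag_sum u) [RHS]big_ord_recl; congr (_ + _).
  by apply: eq_bigr => l _; rewrite half_cos_proj inner_vertex.
(* [frame_perm]: the reflection exchanging the second basis vector with another one besides the
   first fixes the first, which is orthogonal to both. *)
- move=> l; have [g ig [gv gfix]] := reflection_ray (dot_delta1 R i1) (dot_delta1 R (lift ord0 l)).
  exists g; first exact: inner_isometry.
  by split=> //; apply: gfix; rewrite dotBl !dot_delta !mxE /= subr0.
- move=> x' y'; have [/andP[c0 c1] [g ig [gx gy]]] := standard_pair x' y'.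
  have [h ih [gK hK]] := inner_iso_inv ig.
  exists h; first exact: inner_isometry.
  split; first by rewrite -gx gK.
  have ab : Num.sqrt (inner x' y') ^+ 2 + Num.sqrt (1 - inner x' y') ^+ 2 = 1.
    by rewrite !sqr_sqrtr ?subr_ge0// addrC subrK.
  exists (ray j (plane_vec_dot ab)); first by rewrite -gy gK.
  move=> u; rewrite !half_cos_proj zE n0 cdot1 !inner_vertex inner_plane.
  by rewrite !sqr_sqrtr ?subr_ge0.
Qed.

End ProjectiveFrame.

(** * Moving a point to real position *)

Section UnitPhase.
Variables (R : realType) (j : nat).
Local Notation "a ** b" := (cd_mul a b) (at level 40, left associativity).
Local Notation "a ^~" := (cd_conj a) (at level 2, format "a ^~").
Local Notation one := (cd_one R j).

Definition cd_norm (a : CD R j) : R := Num.sqrt (cdot a a).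

Lemma cd_norm_sqr a : cd_norm a ^+ 2 = cdot a a.
Proof. by rewrite sqr_sqrtr// cdot_ge0. Qed.

Lemma unit_phase (a : CD R j) : exists2 u, cdot u u = 1 &
  u ** a = cd_norm a *: one /\ a ** u = cd_norm a *: one.
Proof.
have [->|a0] := eqVneq a 0.
  exists one; first exact: cdot11.
  by rewrite cd_mul0r cd_mul0l /cd_norm cdot0l sqrtr0 scale0r.
have n0 : cd_norm a != 0.
  by apply: contra a0 => /eqP h; apply/eqP/cdot_eq0; rewrite -cd_norm_sqr h expr0n.
have e : (cd_norm a)^-1 * cdot a a = cd_norm a by rewrite -cd_norm_sqr expr2 mulKf.
exists ((cd_norm a)^-1 *: a^~).
  by rewrite cdotZl cdotZr cdot_conj mulrCA e mulVf.
by rewrite cd_mulZl cd_mulZr cd_conj_mul cd_mul_conj !scalerA e.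
Qed.

End UnitPhase.

Section Associative.
Variables (R : realType) (j n : nat).
Hypothesis j_le2 : (j <= 2)%N.
Local Notation "a ** b" := (cd_mul a b) (at level 40, left associativity).
Local Notation "a ^~" := (cd_conj a) (at level 2, format "a ^~").
Local Notation pmx := (proj_mx R j n).
Local Notation pt := (proj_pt R j n).
Local Notation one := (cd_one R j).

Let j_le3 : (j <= 3)%N. Proof. exact: leq_trans j_le2 _. Qed.
Let mulA := @cd_mulA R j j_le2.

(* The squared norms of the 2x2 minors through the pivot [k] sum to zero. *)
Lemma proj_rank1 (x : pt) i k l :
  proj1_sig x i k ** proj1_sig x k l = diag x k *: proj1_sig x i l.
Proof.
set X := proj1_sig x; set r := diag x k.
have nk : \sum_i cdot (X i k) (X i k) = r.
  by rewrite /r diag_norm; apply: eq_bigr => a _; rewrite /X (proj_herm x k a) cdot_conj.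
have nk' : \sum_l cdot (X k l) (X k l) = r by rewrite /r diag_norm.
pose W a b := r *: X a b - X a k ** X k b.
have Wsum : \sum_a \sum_b cdot (W a b) (W a b) = 0.
  have e a b : cdot (W a b) (W a b) = r ^+ 2 * cdot (X a b) (X a b)
     - 2 * r * cdot (X a b) (X a k ** X k b) + cdot (X a k) (X a k) * cdot (X k b) (X k b).
    rewrite -cd_norm_mul// /W !(cdotDl, cdotDr, cdotNl, cdotNr, cdotZl, cdotZr).
    by rewrite (cdotC (X a k ** X k b) (X a b)); ring.
  under eq_bigr do under eq_bigr do rewrite e.
  have s1 : \sum_a \sum_b r ^+ 2 * cdot (X a b) (X a b) = r ^+ 2.
    under eq_bigr do rewrite -mulr_sumr.
    by rewrite -mulr_sumr -proj_innerE -/(inner x x) inner_self mulr1.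
  have s2 : \sum_a \sum_b 2 * r * cdot (X a b) (X a k ** X k b) = 2 * r ^+ 2.
    under eq_bigr do rewrite -mulr_sumr.
    rewrite -mulr_sumr expr2 mulrA; congr (_ * _); rewrite -[RHS]nk; apply: eq_bigr => a _.
    transitivity (\sum_b cdot (X a b ** X b k) (X a k)).
      apply: eq_bigr => b _; rewrite cdot_mull//; congr cdot.
      by rewrite /X (proj_herm x k b).
    by rewrite -cdot_suml /X proj_idem.
  have s3 : \sum_a \sum_b cdot (X a k) (X a k) * cdot (X k b) (X k b) = r ^+ 2.
    under eq_bigr do rewrite -mulr_sumr nk'.
    by rewrite -mulr_suml nk expr2.
  under eq_bigr do rewrite big_split sumrB /=.
  by rewrite big_split sumrB /= s1 s2 s3; ring.
have W0 a b : W a b = 0.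
  apply: cdot_eq0.
  have h1 a' : true -> 0 <= \sum_b cdot (W a' b) (W a' b).
    by move=> _; apply: sumr_ge0 => b' _; exact: cdot_ge0.
  have h2 b' : true -> 0 <= cdot (W a b') (W a b') by move=> _; exact: cdot_ge0.
  exact: (psumr_eq0P h2 (psumr_eq0P h1 Wsum (i := a) isT) (i := b) isT).
by apply/esym/eqP; rewrite -subr_eq0; apply/eqP; exact: (W0 i l).
Qed.

Lemma proj_offdiag_norm (x : pt) i k :
  cdot (proj1_sig x i k) (proj1_sig x i k) = diag x i * diag x k.
Proof.
have := proj_rank1 x i k i; rewrite (proj_herm x i k) cd_mul_conj diagE scalerA.
by move/(congr1 (cdot one)); rewrite !cdotZr cdot11 !mulr1 mulrC => ->; rewrite mulrC.
Qed.

Definition phase_mx (u : 'I_n.+1 -> CD R j) (P : pmx) : pmx :=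
  fun i k => (u i ** P i k) ** (u k)^~.

Lemma phase_mx_inner u (P Q : pmx) : (forall i, cdot (u i) (u i) = 1) ->
  proj_inner (phase_mx u P) (phase_mx u Q) = proj_inner P Q.
Proof.
move=> u1; rewrite !proj_innerE; apply: eq_bigr => i _; apply: eq_bigr => k _.
by rewrite cdot_mul2r// cdot_mul2l// cdot_conj !u1 !mul1r.
Qed.

Lemma phase_mx_pt u (P : pmx) : (forall i, cdot (u i) (u i) = 1) ->
  is_proj_pt P -> is_proj_pt (phase_mx u P).
Proof.
move=> u1 hP; pose x : pt := exist _ P hP.
have hh : forall i k, P k i = (P i k)^~ := @proj_herm _ _ _ x.
have hi : forall i k, \sum_l (P i l ** P l k) = P i k := @proj_idem _ _ _ x.
apply: mk_proj_pt.
- by move=> i k; rewrite /phase_mx !cd_conjM cd_conjK -hh mulA.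
- move=> i k; rewrite /phase_mx -hi cd_mul_sumr cd_mul_suml; apply: eq_bigr => l _.
  rewrite -!mulA; congr (_ ** (_ ** _)); rewrite !mulA cd_conj_mul u1 scale1r cd_mul1l.
  by [].
- by rewrite phase_mx_inner//; exact: (inner_self x).
Qed.

End Associative.

(** Take a column k with positive diagonal entry and give row i the phase making its entry in that
    column real and nonnegative. By [proj_rank1] every entry is a product of two entries through k
    divided by the diagonal one, so all become real together. *)
Lemma assoc_straightenable (R : realType) (j n : nat) : (j <= 2)%N -> straightenable R j n.
Proof.
move=> j2 x; have j3 : (j <= 3)%N by exact: leq_trans j2 _.
have mulA := @cd_mulA R j j2.
set X := proj1_sig x.
have [k rk] : exists k, 0 < diag x k.
  apply: contrapT => h.
  have : \sum_i diag x i = 0.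
    apply: big1 => i _; apply/eqP; rewrite eq_le diag_ge0 andbT leNgt; apply/negP => hi.
    by apply: h; exists i.
  by rewrite diag_sum => /eqP; rewrite oner_eq0.
have /choice[u uP] : forall i, exists u : CD R j, cdot u u = 1 /\
    cd_mul u (X i k) = cd_norm (X i k) *: cd_one R j.
  by move=> i; have [u u1 [h _]] := unit_phase (X i k); exists u.
have u1 i : cdot (u i) (u i) = 1 by case: (uP i).
pose u' i := cd_conj (u i).
have u1' i : cdot (u' i) (u' i) = 1 by rewrite cdot_conj.
pose g (y : proj_pt R j n.+1) : proj_pt R j n.+1 := exist _ _ (phase_mx_pt j2 u1 (proj2_sig y)).
pose g' (y : proj_pt R j n.+1) : proj_pt R j n.+1 := exist _ _ (phase_mx_pt j2 u1' (proj2_sig y)).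
have gK : cancel g g'.
  move=> y; apply: proj_pt_eq; apply: proj_mx_ext => i l /=; rewrite /phase_mx /u' cd_conjK.
  by rewrite -!mulA cd_conj_mul u1 scale1r cd_mul1r mulA cd_conj_mul u1 scale1r cd_mul1l.
have gK' : cancel g' g.
  move=> y; apply: proj_pt_eq; apply: proj_mx_ext => i l /=; rewrite /phase_mx /u' cd_conjK.
  by rewrite -!mulA cd_mul_conj u1 scale1r cd_mul1r mulA cd_mul_conj u1 scale1r cd_mul1l.
exists g; first by split; [exists g'|move=> y z; exact: phase_mx_inner].
split=> [l|]; apply: proj_pt_eq; apply: proj_mx_ext => i m /=.
  rewrite /phase_mx /ray_mx !mxE !eqxx !andbT cd_mulZr cd_mul1r cd_mulZl.
  have [->|] := eqVneq i l; last by rewrite !mul0r !scale0r.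
  have [->|] := eqVneq m l; last by rewrite !mulr0 !scale0r.
  by rewrite cd_mul_conj u1 !scale1r.
have cn i' : cd_norm (X i' k) = Num.sqrt (diag x i') * Num.sqrt (diag x k).
  by rewrite /cd_norm proj_offdiag_norm// sqrtrM// diag_ge0.
(* The factor [diag x k] lets [proj_rank1] split the entry through column k; positivity cancels it
   at the end. *)
have h : diag x k *: phase_mx u X i m = diag x k *: ray_mx j (root_diag x) i m.
  rewrite /phase_mx -cd_mulZl -cd_mulZr -(proj_rank1 j2) -/X.
  rewrite mulA (uP i).2 -mulA.
  have -> : cd_mul (X k m) (cd_conj (u m)) = cd_norm (X m k) *: cd_one R j.
    have := congr1 (@cd_conj R j) (uP m).2.
    by rewrite cd_conjM /X -(proj_herm x m k) cd_conjZ cd_conj1.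
  rewrite cd_mulZl cd_mulZr cd_mul1l !cn /ray_mx !mxE !scalerA; congr (_ *: _).
  rewrite -[X in _ = X * _](@sqr_sqrtr _ (diag x k)) ?diag_ge0//; ring.
have rk0 : diag x k != 0 by rewrite gt_eqF.
exact: (scalerI rk0 h).
Qed.

(** * The Cayley plane and triality *)

Section Octonions.
Variable R : realType.
Local Notation O := (CD R 3).
Local Notation "a ** b" := (cd_mul a b) (at level 40, left associativity).
Local Notation "a ^~" := (cd_conj a) (at level 2, format "a ^~").
Local Notation pmx := (proj_mx R 3 2).
Local Notation pt := (proj_pt R 3 2).
Local Notation one := (cd_one R 3).
Local Notation i0 := (@Ordinal 3 0 isT).
Local Notation i1 := (@Ordinal 3 1 isT).
Local Notation i2 := (@Ordinal 3 2 isT).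
Local Notation le3 := (isT : (3 <= 3)%N).

Lemma I3_ind (Pr : 'I_3 -> Prop) : Pr i0 -> Pr i1 -> Pr i2 -> forall i, Pr i.
Proof.
move=> h0 h1 h2 [[|[|[|//]]] lt].
- by rewrite (_ : Ordinal lt = i0)//; exact: val_inj.
- by rewrite (_ : Ordinal lt = i1)//; exact: val_inj.
- by rewrite (_ : Ordinal lt = i2)//; exact: val_inj.
Qed.

Lemma sumI3 (V : nmodType) (F : 'I_3 -> V) : \sum_i F i = F i0 + F i1 + F i2.
Proof.
rewrite !big_ord_recl big_ord0 addr0 addrA.
by congr (F _ + F _ + F _); exact: val_inj.
Qed.

(** The off-diagonal entries are named cyclically, x = P_12, y = P_20, z = P_01, so that the
    relations and the triality triples are permuted by rotation. *)
Definition oct_mx (d : 'I_3 -> R) (x y z : O) : pmx := fun i k =>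
  match val i, val k with
  | 0, 0 => d i0 *: one | 0, 1 => z     | 0, _ => y^~
  | 1, 0 => z^~         | 1, 1 => d i1 *: one | 1, _ => x
  | _, 0 => y           | _, 1 => x^~   | _, _ => d i2 *: one
  end.

Lemma oct_mx_entries d x y z : let P := oct_mx d x y z in
  [/\ P i0 i0 = d i0 *: one, P i1 i1 = d i1 *: one & P i2 i2 = d i2 *: one] /\
  [/\ P i0 i1 = z, P i1 i2 = x & P i2 i0 = y] /\
  [/\ P i1 i0 = z^~, P i2 i1 = x^~ & P i0 i2 = y^~].
Proof. by []. Qed.

(** The rank-one equations P_il P_lk = d_l P_ik on independent entries; they involve products of two
    entries only, so nonassociativity does not interfere. *)
Definition oct_rel (d : 'I_3 -> R) (x y z : O) :=
  [/\ x ** y = d i2 *: z^~, y ** z = d i0 *: x^~ & z ** x = d i1 *: y^~] /\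
  [/\ cdot x x = d i1 * d i2, cdot y y = d i2 * d i0, cdot z z = d i0 * d i1
    & d i0 + d i1 + d i2 = 1].

Lemma oct_mx_rank1 d x y z : oct_rel d x y z ->
  forall i l k, oct_mx d x y z i l ** oct_mx d x y z l k = d l *: oct_mx d x y z i k.
Proof.
move=> [[xy yz zx] [nx ny nz _]].
have cj (a b : O) r (c : O) : a ** b = r *: c^~ -> b^~ ** a^~ = r *: c.
  by move=> h; rewrite -cd_conjM h cd_conjZ cd_conjK.
have xy' := cj _ _ _ _ xy; have yz' := cj _ _ _ _ yz; have zx' := cj _ _ _ _ zx.
have [[e00 e11 e22] [[e01 e12 e20] [e10 e21 e02]]] := oct_mx_entries d x y z.
elim/I3_ind; elim/I3_ind; elim/I3_ind;
  rewrite ?e00 ?e11 ?e22 ?e01 ?e12 ?e20 ?e10 ?e21 ?e02 ?xy ?yz ?zx ?xy' ?yz' ?zx'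
  ?cd_mulZl ?cd_mul1l ?cd_mulZr ?cd_mul1r ?cd_mul_conj ?cd_conj_mul ?scalerA ?nx ?ny ?nz //;
  by rewrite mulrC.
Qed.

Lemma oct_mx_pt d x y z : oct_rel d x y z -> is_proj_pt (oct_mx d x y z).
Proof.
move=> h; have [_ [_ _ _ d1]] := h; split.
- have [[e00 e11 e22] [[e01 e12 e20] [e10 e21 e02]]] := oct_mx_entries d x y z.
  by elim/I3_ind; elim/I3_ind;
    rewrite ?e00 ?e11 ?e22 ?e01 ?e12 ?e20 ?e10 ?e21 ?e02 ?cd_conjK ?cd_conjZ ?cd_conj1.
- move=> i k; rewrite -[LHS]/(\sum_l (oct_mx d x y z i l ** oct_mx d x y z l k)).
  under eq_bigr do rewrite oct_mx_rank1//.
  by rewrite -scaler_suml sumI3 d1 scale1r.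
- have [[e00 e11 e22] _] := oct_mx_entries d x y z.
  by rewrite sumI3 e00 e11 e22 -!cdot1 !cdotZr cdot11 !mulr1.
Qed.

Lemma oct_mxE (x : pt) : proj1_sig x =
  oct_mx (diag x) (proj1_sig x i1 i2) (proj1_sig x i2 i0) (proj1_sig x i0 i1).
Proof.
by apply: proj_mx_ext; elim/I3_ind; elim/I3_ind; rewrite ?diagE ?(proj_herm x i0 i1) ?(proj_herm x i1 i2) ?(proj_herm x i2 i0).
Qed.

(** In an off-diagonal equation of idempotency two terms carry real diagonal factors, and unit trace
    leaves the third diagonal entry as factor of the remaining product ([third]). The diagonal
    equations are a linear system for the three squared norms. *)
Lemma oct_rel_pt (x : pt) :
  oct_rel (diag x) (proj1_sig x i1 i2) (proj1_sig x i2 i0) (proj1_sig x i0 i1).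
Proof.
set X := proj1_sig x; set d := diag x.
have dd : d i0 + d i1 + d i2 = 1 by rewrite -(diag_sum x) sumI3.
have hX i k : X k i = (X i k)^~ := proj_herm x i k.
have idem i k : X i i0 ** X i0 k + X i i1 ** X i1 k + X i i2 ** X i2 k = X i k.
  by rewrite -[RHS](proj_idem x) sumI3.
have dX i : X i i = d i *: one := diagE x i.
have third (a b c : O) (r s t : R) : r + s + t = 1 -> r *: b + s *: b + a = b -> a = t *: b.
  move=> rst /(congr1 (fun v => v - (r *: b + s *: b))); rewrite addrC addKr => ->.
  by rewrite -{1}(scale1r b) -rst -scalerDl -scalerBl; congr (_ *: _); ring.
have nd i : d i = cdot (X i i0) (X i i0) + cdot (X i i1) (X i i1) + cdot (X i i2) (X i i2).
  by rewrite /d diag_norm sumI3.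
have n00 i : cdot (X i i) (X i i) = d i ^+ 2 by rewrite dX cdotZl cdotZr cdot11; ring.
split; split.
- have := idem i1 i0; rewrite !dX cd_mulZl cd_mulZr cd_mul1l cd_mul1r hX => h.
  by apply: (third _ _ 0 (d i0) (d i1)).
- have := idem i2 i1; rewrite !dX cd_mulZl cd_mulZr cd_mul1l cd_mul1r (hX i1 i2) => h.
  apply: (third _ _ 0 (d i1) (d i2)); first by rewrite -dd; ring.
  by rewrite -[RHS]h; rewrite addrC addrA.
- have := idem i0 i2; rewrite !dX cd_mulZl cd_mulZr cd_mul1l cd_mul1r (hX i2 i0) => h.
  apply: (third _ _ 0 (d i0) (d i2)); first by rewrite -dd; ring.
  by rewrite -[RHS]h addrAC.
- have := nd i0; have := nd i1; have := nd i2; rewrite !n00 (hX i2 i0) (hX i0 i1) (hX i1 i2) !cdot_conj.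
  have -> : d i0 = 1 - d i1 - d i2 by rewrite -dd; ring.
  by move=> *; lra.
- have := nd i0; have := nd i1; have := nd i2; rewrite !n00 (hX i2 i0) (hX i0 i1) (hX i1 i2) !cdot_conj.
  have -> : d i1 = 1 - d i0 - d i2 by rewrite -dd; ring.
  by move=> *; lra.
- have := nd i0; have := nd i1; have := nd i2; rewrite !n00 (hX i2 i0) (hX i0 i1) (hX i1 i2) !cdot_conj.
  have -> : d i2 = 1 - d i0 - d i1 by rewrite -dd; ring.
  by move=> *; lra.
- exact: dd.
Qed.

Lemma oct_offdiag_norm (x : pt) i k :
  cdot (proj1_sig x i k) (proj1_sig x i k) = diag x i * diag x k.
Proof.
have := oct_mx_rank1 (oct_rel_pt x) i k i; rewrite -oct_mxE (proj_herm x i k) cd_mul_conj diagE.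
by rewrite scalerA => /(congr1 (cdot one)); rewrite !cdotZr cdot11 !mulr1 mulrC => ->; rewrite mulrC.
Qed.

(* Triples acting on the off-diagonal entries [(P_12, P_20, P_01)] compatibly with products. *)
Definition triality (f g h : O -> O) :=
  [/\ forall a b, cdot (f a) (f b) = cdot a b, forall a b, cdot (g a) (g b) = cdot a b
    & forall a b, cdot (h a) (h b) = cdot a b] /\
  [/\ forall a b c r, a ** b = r *: c^~ -> f a ** g b = r *: (h c)^~,
      forall a b c r, a ** b = r *: c^~ -> g a ** h b = r *: (f c)^~
    & forall a b c r, a ** b = r *: c^~ -> h a ** f b = r *: (g c)^~].

Definition triality_iso (f g h : O -> O) := triality f g h /\
  exists f' g' h', [/\ triality f' g' h', cancel f f', cancel g g' & cancel h h'] /\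
    [/\ cancel f' f, cancel g' g & cancel h' h].

Lemma triality_iso_comp f g h f' g' h' : triality_iso f g h -> triality_iso f' g' h' ->
  triality_iso (f \o f') (g \o g') (h \o h').
Proof.
have tc a b c a' b' c' : triality a b c -> triality a' b' c' ->
    triality (a \o a') (b \o b') (c \o c').
  move=> [[h1 h2 h3] [k1 k2 k3]] [[h1' h2' h3'] [k1' k2' k3']].
  split; split=> u v; rewrite /comp.
  - by rewrite h1 h1'.
  - by rewrite h2 h2'.
  - by rewrite h3 h3'.
  - by move=> w r uv; apply: k1; exact: k1'.
  - by move=> w r uv; apply: k2; exact: k2'.
  - by move=> w r uv; apply: k3; exact: k3'.
move=> [t1 [a [b [c [[t2 fK gK hK] [fK' gK' hK']]]]]].
move=> [t1' [a' [b' [c' [[t2' fK2 gK2 hK2] [fK2' gK2' hK2']]]]]].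
split; first exact: tc.
exists (a' \o a), (b' \o b), (c' \o c); split; split; try exact: tc; exact: can_comp.
Qed.

Lemma triality_iso_rot f g h : triality_iso f g h -> triality_iso g h f.
Proof.
have tr a b c : triality a b c -> triality b c a by case=> [[? ? ?] [? ? ?]].
move=> [/tr t1 [a [b [c [[/tr t2 ? ? ?] [? ? ?]]]]]].
by split=> //; exists b, c, a.
Qed.

Lemma cd_flexible (u x : O) : (u ** x) ** u = u ** (x ** u).
Proof. by have := moufang_middle le3 u one x; rewrite cd_mul1r cd_mul1l. Qed.

(** The compatibility conditions are the left, middle and right Moufang identities, in that order,
    after cancelling u against its conjugate. The inverse triple is the one of the conjugate of
    u. *)
Lemma triality_mul u : cdot u u = 1 ->
  triality_iso (fun x => (u ** x) ** u) (fun y => u^~ ** y) (fun z => z ** u^~).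
Proof.
have tm v : cdot v v = 1 ->
    triality (fun x => (v ** x) ** v) (fun y => v^~ ** y) (fun z => z ** v^~).
  move=> v1; split; split=> a b; rewrite ?cdot_mul2r// ?cdot_mul2l// ?cdot_conj ?v1 ?mul1r//.
  - move=> c r ab; rewrite (moufang_left le3) (cd_mulKVl le3) v1 scale1r ab.
    by rewrite cd_mulZr cd_conjM cd_conjK.
  - move=> c r ab; rewrite (moufang_middle le3) ab cd_mulZr cd_mulZl !cd_conjM.
    by rewrite cd_flexible.
  - move=> c r ab; rewrite (moufang_right le3) (cd_mulKVr le3) v1 scale1r ab.
    by rewrite cd_mulZl cd_conjM cd_conjK.
move=> u1; have u1' : cdot u^~ u^~ = 1 by rewrite cdot_conj.
split; first exact: tm.
exists (fun x => (u^~ ** x) ** u^~), (fun y => u^~^~ ** y), (fun z => z ** u^~^~).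
split; split; first exact: tm.
- by move=> a; rewrite (cd_flexible u) (cd_mulKl le3) u1 scale1r (cd_mulKr le3) u1 scale1r.
- by move=> a; rewrite cd_conjK (cd_mulKVl le3) u1 scale1r.
- by move=> a; rewrite cd_conjK (cd_mulKVr le3) u1 scale1r.
- by move=> a; rewrite (cd_flexible u^~) (cd_mulKVl le3) u1 scale1r (cd_mulKVr le3) u1 scale1r.
- by move=> a; rewrite cd_conjK (cd_mulKl le3) u1 scale1r.
- by move=> a; rewrite cd_conjK (cd_mulKr le3) u1 scale1r.
Qed.

Lemma oct_inner (x y : pt) : inner x y = \sum_i diag x i * diag y i +
  2 * (cdot (proj1_sig x i1 i2) (proj1_sig y i1 i2) + cdot (proj1_sig x i2 i0) (proj1_sig y i2 i0)
       + cdot (proj1_sig x i0 i1) (proj1_sig y i0 i1)).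
Proof.
rewrite /inner proj_innerE !sumI3 !diagE (proj_herm x i0 i1) (proj_herm x i1 i2) (proj_herm x i2 i0).
rewrite (proj_herm y i0 i1) (proj_herm y i1 i2) (proj_herm y i2 i0) !cdot_conj.
by rewrite !cdotZl !cdotZr cdot11; ring.
Qed.

Lemma oct_pt_ext (x y : pt) : (forall i, diag x i = diag y i) ->
  proj1_sig x i1 i2 = proj1_sig y i1 i2 -> proj1_sig x i2 i0 = proj1_sig y i2 i0 ->
  proj1_sig x i0 i1 = proj1_sig y i0 i1 -> x = y.
Proof.
move=> /funext dxy e1 e2 e3; apply: proj_pt_eq.
by rewrite (oct_mxE x) (oct_mxE y) dxy e1 e2 e3.
Qed.

Lemma triality_map f g h : triality f g h -> exists G : pt -> pt, forall x,
  [/\ forall i, diag (G x) i = diag x i, proj1_sig (G x) i1 i2 = f (proj1_sig x i1 i2),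
      proj1_sig (G x) i2 i0 = g (proj1_sig x i2 i0)
    & proj1_sig (G x) i0 i1 = h (proj1_sig x i0 i1)].
Proof.
move=> [[nf ng nh] [tf tg th]].
have rel x : oct_rel (diag x) (f (proj1_sig x i1 i2)) (g (proj1_sig x i2 i0)) (h (proj1_sig x i0 i1)).
  have [[xy yz zx] [nx ny nz s]] := oct_rel_pt x.
  by split; split=> //; rewrite ?nf ?ng ?nh//; [exact: tf|exact: tg|exact: th].
exists (fun x => exist _ _ (oct_mx_pt (rel x))) => x.
have [[e00 e11 e22] _] := oct_mx_entries (diag x) (f (proj1_sig x i1 i2))
  (g (proj1_sig x i2 i0)) (h (proj1_sig x i0 i1)).
split=> //; elim/I3_ind; rewrite {1}/diag [proj1_sig _]/=.
- by rewrite e00 -cdot1 cdotZr cdot11 mulr1.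
- by rewrite e11 -cdot1 cdotZr cdot11 mulr1.
- by rewrite e22 -cdot1 cdotZr cdot11 mulr1.
Qed.

Definition vertex_iso (G : pt -> pt) :=
  inner_iso G /\ forall l, G (@vertex R 3 1 l) = @vertex R 3 1 l.

Lemma vertex_iso_comp G H : vertex_iso G -> vertex_iso H -> vertex_iso (G \o H).
Proof.
move=> [iG vG] [iH vH]; split; first exact: inner_iso_comp.
by move=> l; rewrite /comp vH vG.
Qed.

Lemma vertex_offdiag l i k : i != k -> proj1_sig (@vertex R 3 1 l) i k = 0.
Proof.
move=> ik; rewrite -[LHS]/(ray_mx 3 (delta_mx l 0) i k) /ray_mx !mxE.
suff -> : ((i == l) && (0 == 0 :> 'I_1))%:R * ((k == l) && (0 == 0 :> 'I_1))%:R = 0 :> R.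
  by rewrite scale0r.
have [il|_] := eqVneq i l; last by rewrite mul0r.
by rewrite -il eq_sym (negbTE ik) mulr0.
Qed.

Lemma triality_vertex_iso f g h : triality_iso f g h -> exists2 G, vertex_iso G & forall x,
  [/\ forall i, diag (G x) i = diag x i, proj1_sig (G x) i1 i2 = f (proj1_sig x i1 i2),
      proj1_sig (G x) i2 i0 = g (proj1_sig x i2 i0)
    & proj1_sig (G x) i0 i1 = h (proj1_sig x i0 i1)].
Proof.
move=> [t [f' [g' [h' [[t' fK gK hK] [fK' gK' hK']]]]]].
have [G GE] := triality_map t; have [G' GE'] := triality_map t'.
exists G => //; split; first split.
- exists G' => x; have [d1 a1 b1 c1] := GE x; have [d2 a2 b2 c2] := GE' x.
    have [d3 a3 b3 c3] := GE' (G x).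
    by apply: oct_pt_ext => [i|||]; [rewrite d3 d1|rewrite a3 a1 fK|rewrite b3 b1 gK|rewrite c3 c1 hK].
  have [d3 a3 b3 c3] := GE (G' x).
  by apply: oct_pt_ext => [i|||]; [rewrite d3 d2|rewrite a3 a2 fK'|rewrite b3 b2 gK'|rewrite c3 c2 hK'].
- move=> x y; have [d1 a1 b1 c1] := GE x; have [d2 a2 b2 c2] := GE y.
  have [[nf ng nh] _] := t.
  rewrite !oct_inner a1 a2 b1 b2 c1 c2 nf ng nh; congr (_ + _).
  by apply: eq_bigr => i _; rewrite d1 d2.
(* Off-diagonal entries of a vertex vanish, and norm-preserving maps send 0 to 0. *)
- move=> l; have [d1 a1 b1 c1] := GE (@vertex R 3 1 l); have [[nf ng nh] _] := t.
  apply: oct_pt_ext => //.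
  + by rewrite a1 vertex_offdiag//; apply: cdot_eq0; rewrite nf cdot0l.
  + by rewrite b1 vertex_offdiag//; apply: cdot_eq0; rewrite ng cdot0l.
  + by rewrite c1 vertex_offdiag//; apply: cdot_eq0; rewrite nh cdot0l.
Qed.

(* Left multiplication of [P_01] by an imaginary unit extends to an isometry fixing the real
   values of [P_20]; two of them make [P_01] real, the first one being chosen so that the product
   is again imaginary. *)
Lemma triality_imag u : cdot u u = 1 -> u^~ = - u -> exists f g h,
  [/\ triality_iso f g h, forall s, g (s *: one) = s *: one & forall z, h z = u ** z].
Proof.
move=> u1 uj; have u1' : cdot u^~ u^~ = 1 by rewrite cdot_conj.
have t := triality_iso_comp (triality_mul u1) (triality_iso_rot (triality_mul u1')).
do 3! eexists; split; first exact: t.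
- by move=> s; rewrite /comp cd_conjK cd_mulZl cd_mul1l cd_mulZr cd_conj_mul u1 scale1r.
- move=> z; rewrite /comp [X in _ ** X = _]uj cd_mulNr (cd_mulKVr le3) u1 scale1r.
  by rewrite uj cd_mulNl opprK.
Qed.

(** Two orthonormal imaginary units e and e' span a plane, in which some unit vector is orthogonal
    to z: the normalized b e - a e', or e itself when z is orthogonal to both. *)
Lemma imag_orth (z : O) : exists2 u, cdot u u = 1 & u^~ = - u /\ cdot u z = 0.
Proof.
pose e : O := (((0, 1), (0, 0)), ((0, 0), (0, 0))).
pose e' : O := (((0, 0), (1, 0)), ((0, 0), (0, 0))).
have ee : cdot e e = 1 by rewrite /e /=; ring.
have ee' : cdot e' e' = 1 by rewrite /e' /=; ring.
have e0 : cdot e e' = 0 by rewrite /e /e' /=; ring.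
have ej : e^~ = - e.
  by rewrite -[RHS]/(cd_opp e) /e /= !oppr0.
have ej' : e'^~ = - e'.
  by rewrite -[RHS]/(cd_opp e') /e' /= !oppr0.
pose a := cdot e z; pose b := cdot e' z.
have [ab|ab] := eqVneq (a ^+ 2 + b ^+ 2) 0.
  exists e => //; split=> //; apply/eqP; rewrite -sqrf_eq0 -/a.
  by move/eqP: ab; rewrite paddr_eq0 ?sqr_ge0// => /andP[].
have abgt : 0 < a ^+ 2 + b ^+ 2 by rewrite lt_def ab addr_ge0 ?sqr_ge0.
pose r := (Num.sqrt (a ^+ 2 + b ^+ 2))^-1.
exists (r *: (b *: e - a *: e')); last split.
- rewrite !(cdotZl, cdotZr, cdotDl, cdotDr, cdotNl, cdotNr) ee ee' (cdotC e' e) e0.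
  transitivity (r ^+ 2 * (a ^+ 2 + b ^+ 2)); first by ring.
  by rewrite /r exprVn sqr_sqrtr ?ltW// mulVf.
- by rewrite cd_conjZ cd_conjB !cd_conjZ ej ej' !scalerN opprK -[RHS]scalerN opprB addrC.
- by rewrite cdotZl cdotDl cdotNl !cdotZl -/a -/b; ring.
Qed.

Lemma triality_real (z : O) : exists f g h,
  [/\ triality_iso f g h, forall s, g (s *: one) = s *: one & h z = cd_norm z *: one].
Proof.
have [u u1 [uj uz]] := imag_orth z.
have [f [g [h [t gE hE]]]] := triality_imag u1 uj.
have [z0|z0] := eqVneq z 0.
  exists f, g, h; split=> //.
  by rewrite hE z0 cd_mul0r /cd_norm cdot0l sqrtr0 scale0r.
have n0 : cd_norm z != 0.
  by apply: contra z0 => /eqP n0; apply/eqP/cdot_eq0; rewrite -cd_norm_sqr n0 expr0n.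
pose w := u ** z; have ww : cdot w w = cd_norm z ^+ 2.
  by rewrite cd_norm_sqr /w (cd_norm_mul le3) u1 mul1r.
have wj : w^~ = - w.
  have := cd_conjE w; rewrite /w cd_re_mul -cdot_conj cd_conjK uj cdotNl uz.
  by move=> ->; rewrite oppr0 mulr0 scale0r add0r.
(* w = u z is imaginary of norm |z|, so v is an imaginary unit and v w, being the conjugate of w
   times w over |z|, is |z|. *)
pose v := - (cd_norm z)^-1 *: w.
have v1 : cdot v v = 1.
  by rewrite /v cdotZl cdotZr ww; field.
have vj : v^~ = - v by rewrite /v cd_conjZ wj scalerN.
have [f' [g' [h' [t' gE' hE']]]] := triality_imag v1 vj.
exists (f' \o f), (g' \o g), (h' \o h); split; first exact: triality_iso_comp.
  by move=> s; rewrite /comp gE gE'.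
rewrite /comp hE hE' -/w /v cd_mulZl scaleNr -scalerN -cd_mulNl -wj cd_conj_mul ww scalerA.
by congr (_ *: _); field.
Qed.

Lemma oct_norm (x : pt) i k : cd_norm (proj1_sig x i k) = Num.sqrt (diag x i) * Num.sqrt (diag x k).
Proof. by rewrite /cd_norm oct_offdiag_norm sqrtrM// diag_ge0. Qed.

Lemma oct_ray (x y : pt) : (forall i, diag y i = diag x i) ->
  proj1_sig y i1 i2 = cd_norm (proj1_sig y i1 i2) *: one ->
  proj1_sig y i2 i0 = cd_norm (proj1_sig y i2 i0) *: one ->
  proj1_sig y i0 i1 = cd_norm (proj1_sig y i0 i1) *: one -> y = ray 3 (root_diag_dot x).
Proof.
move=> dxy e1 e2 e3; apply: oct_pt_ext.
- move=> i; rewrite dxy {2}/diag -[proj1_sig _ i i]/(ray_mx 3 (root_diag x) i i) /ray_mx mxE.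
  by rewrite -cdot1 cdotZr cdot11 mulr1 -expr2 sqr_sqrtr// diag_ge0.
- by rewrite e1 oct_norm !dxy -[RHS]/(ray_mx 3 (root_diag x) i1 i2) /ray_mx !mxE.
- by rewrite e2 oct_norm !dxy -[RHS]/(ray_mx 3 (root_diag x) i2 i0) /ray_mx !mxE.
- by rewrite e3 oct_norm !dxy -[RHS]/(ray_mx 3 (root_diag x) i0 i1) /ray_mx !mxE.
Qed.

(** If d_0 = 0 then P_20 and P_01 vanish and one multiplication makes P_12 real. Otherwise P_20 is
    made real first, then P_01 by a triality fixing real values of P_20; their product is d_0 times
    the conjugate of P_12, which is therefore real too. *)
Lemma oct_straightenable : @straightenable R 3 1.
Proof.
move=> x; suff [G [iG vG] Gx] : exists2 G, vertex_iso G & G x = ray 3 (root_diag_dot x).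
  by exists G.
have null (y : pt) i k : diag y i * diag y k = 0 ->
    proj1_sig y i k = cd_norm (proj1_sig y i k) *: one.
  move=> dy; have y0 : proj1_sig y i k = 0 by apply: cdot_eq0; rewrite oct_offdiag_norm.
  by rewrite y0 /cd_norm cdot0l sqrtr0 scale0r.
have [d0|d0] := eqVneq (diag x i0) 0.
  have [u u1 [ux _]] := unit_phase (proj1_sig x i1 i2).
  have u1' : cdot u^~ u^~ = 1 by rewrite cdot_conj.
  have [G vG /(_ x) [dG G12 _ _]] := triality_vertex_iso (triality_iso_rot (triality_mul u1')).
  exists G => //; apply: oct_ray => //; last 2 first.
  - by apply: null; rewrite !dG d0 mulr0.
  - by apply: null; rewrite !dG d0 mul0r.
  by rewrite oct_norm !dG -oct_norm G12 cd_conjK.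
have [u u1 [uy _]] := unit_phase (proj1_sig x i2 i0).
have u1' : cdot u^~ u^~ = 1 by rewrite cdot_conj.
have [G vG /(_ x) [dG _ G20 _]] := triality_vertex_iso (triality_mul u1').
have [f [g [h [t gE hE]]]] := triality_real (proj1_sig (G x) i0 i1).
have [H vH /(_ (G x)) [dH _ H20 H01]] := triality_vertex_iso t.
have y20 : proj1_sig (H (G x)) i2 i0 = cd_norm (proj1_sig (H (G x)) i2 i0) *: one.
  by rewrite oct_norm !dH !dG -oct_norm H20 G20 cd_conjK uy gE.
have y01 : proj1_sig (H (G x)) i0 i1 = cd_norm (proj1_sig (H (G x)) i0 i1) *: one.
  by rewrite oct_norm !dH -oct_norm H01 hE.
exists (H \o G); first exact: vertex_iso_comp.
apply: oct_ray => //; rewrite /comp; first by move=> i; rewrite dH dG.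
have d0' : diag (H (G x)) i0 != 0 by rewrite dH dG.
have [[_ yz _] _] := oct_rel_pt (H (G x)).
have := congr1 (fun a : O => (diag (H (G x)) i0)^-1 *: a^~) yz.
rewrite y20 y01 cd_mulZl cd_mulZr cd_mul1l !cd_conjZ cd_conj1 cd_conjK !scalerA mulVf// scale1r.
move=> e; rewrite oct_norm -[LHS]e !oct_norm; congr (_ *: _).
set s := Num.sqrt (diag _ i0); have -> : diag (H (G x)) i0 = s ^+ 2.
  by rewrite sqr_sqrtr// diag_ge0.
have s0 : s != 0 by rewrite gt_eqF// sqrtr_gt0 lt_def d0' diag_ge0.
by field.
Qed.

End Octonions.

(** * Spheres *)

Section Sphere.
Variables (R : realType) (D : nat).
Local Notation pt := (sph_pt R D.+1).
Local Notation dist := (@sph_rho R D.+1).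
Local Notation i0 := (ord0 : 'I_D.+2).

Definition sph_vec (x : pt) : 'cV[R]_D.+2 := \col_i proj1_sig x i.

Lemma sph_vec_dot x : dot (sph_vec x) (sph_vec x) = 1.
Proof. by case: x => x x1; rewrite -[RHS]x1; apply: eq_bigr => i _; rewrite !mxE expr2. Qed.

Lemma sph_mk_subproof (v : 'cV[R]_D.+2) : dot v v = 1 -> \sum_i v i 0 ^+ 2 = 1.
Proof. by move=> v1; rewrite -[RHS]v1; apply: eq_bigr => i _; rewrite expr2. Qed.

Definition sph_mk v (v1 : dot v v = 1) : pt := exist _ (fun i => v i 0) (sph_mk_subproof v1).

Lemma sph_mkK v (v1 : dot v v = 1) : sph_vec (sph_mk v1) = v.
Proof. by apply/matrixP => i k; rewrite mxE ord1. Qed.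

Lemma sph_vec_inj : injective sph_vec.
Proof.
move=> [x x1] [y y1] /matrixP xy.
have e : x = y by apply/funext => i; have := xy i 0; rewrite !mxE.
by subst y; congr exist; exact: Prop_irrelevance.
Qed.

Lemma sph_rhoE x y : dist x y = acos (dot (sph_vec x) (sph_vec y)).
Proof. by congr acos; apply: eq_bigr => i _; rewrite !mxE. Qed.

Lemma sph_dot_itv x y : -1 <= dot (sph_vec x) (sph_vec y) <= 1.
Proof.
set u := sph_vec x; set v := sph_vec y; have u1 : dot u u = 1 := sph_vec_dot x.
have v1 : dot v v = 1 := sph_vec_dot y.
have h1 := dot_ge0 (u - v); have h2 := dot_ge0 (u - (- 1) *: v).
rewrite !dotBl !dotBr !dotZl !(dotC _ (-1 *: v)) !dotZl u1 v1 (dotC v u) in h1 h2.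
by apply/andP; split; lra.
Qed.

Lemma half_cos_sph x y : half_cos dist x y = (1 + dot (sph_vec x) (sph_vec y)) / 2.
Proof. by rewrite /half_cos sph_rhoE acosK// in_itv/= sph_dot_itv. Qed.

Lemma sph_reflection (u v : pt) : exists2 g, isometry dist g &
  [/\ involutive g, g u = v &
      forall w, dot (sph_vec u - sph_vec v) (sph_vec w) = 0 -> g w = w].
Proof.
have [Q [QT QQ Qu Qfix]] := exists_reflection (etrans (sph_vec_dot u) (esym (sph_vec_dot v))).
have Qdot (x y : 'cV[R]_D.+2) : dot (Q *m x) (Q *m y) = dot x y.
  have : (dot (Q *m x) (Q *m y))%:M = (dot x y)%:M :> 'M[R]_1.
    by rewrite -!dotE trmx_mul QT mulmxA -(mulmxA x^T) QQ mulmx1.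
  by move/matrixP/(_ 0 0); rewrite !mxE eqxx.
have g1 x : dot (Q *m sph_vec x) (Q *m sph_vec x) = 1 by rewrite Qdot sph_vec_dot.
pose g x := sph_mk (g1 x).
have gK : involutive g by move=> x; apply: sph_vec_inj; rewrite !sph_mkK mulmxA QQ mul1mx.
exists g.
  split; first by exists g.
  by move=> x y; rewrite !sph_rhoE !sph_mkK Qdot.
split=> // [|w uw]; apply: sph_vec_inj; rewrite sph_mkK//.
exact: Qfix.
Qed.

Lemma basis_vec_dot (k l : 'I_D.+2) (a b : R) : k != l -> a ^+ 2 + b ^+ 2 = 1 ->
  let v := a *: delta_mx k 0 + b *: delta_mx l 0 : 'cV[R]_D.+2 in dot v v = 1.
Proof.
move=> kl ab v; rewrite {1}/v dotDl !dotZl !dot_delta /v !mxE !eqxx !andbT (eq_sym l) (negbTE kl).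
by rewrite -[RHS]ab /= !mulr1 !mulr0 addr0 add0r !expr2.
Qed.

Lemma unit_delta (k : 'I_D.+2) : dot (delta_mx k 0 : 'cV[R]_D.+2) (delta_mx k 0) = 1.
Proof. exact: dot_delta1. Qed.

Lemma unitN (k : 'I_D.+2) : dot (- delta_mx k 0 : 'cV[R]_D.+2) (- delta_mx k 0) = 1.
Proof. by rewrite -(scaleN1r (delta_mx k 0)) dotZl dotC dotZl dot_delta1; ring. Qed.

Definition sph_comb k l a b (kl : k != l) (ab : a ^+ 2 + b ^+ 2 = 1) : pt :=
  sph_mk (basis_vec_dot kl ab).

(** With [E0], [E1] the poles and [Q k] the other basis vectors, p and q are (1 + x_0) / 2 and (1 -
    x_0) / 2 and zeta_k is x_(k+1) / 2. Then p + q = 1, and p q being the sum of the zeta_k^2 is the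
    equation of the sphere. *)
Lemma sph_jacobi_uniform (dT : measure_display) (T : measurableType dT) (P : probability T R)
  (U : T -> pt) (al be : R) x y m :
  random_element dist U -> uniform_el P dist U ->
  be + 1 = D.+1%:R / 2 -> al + 1 = D.+1%:R / 2 ->
  Expe P (fun w => jacobiP m al be (cos (dist x (U w))) * jacobiP m al be (cos (dist y (U w)))) =
  jacobi_const al be m * jacobiP m al be (cos (dist x y)).
Proof.
move=> Uel Uun eB eA0; have eA : al + 1 = 1%:R * (D.+1%:R / 2) by rewrite mul1r.
pose E0 := sph_mk (unit_delta i0); pose E1 := sph_mk (unitN i0).
pose Q (k : 'I_D.+1) := sph_mk (unit_delta (lift ord0 k)).
pose co (k : 'I_D.+2) u := sph_vec u k 0.
have dN (v w : 'cV[R]_D.+2) : dot (- v) w = - dot v w by rewrite -scaleN1r dotZl mulN1r.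
have tE0 u : half_cos dist E0 u = (1 + co i0 u) / 2 by rewrite half_cos_sph sph_mkK dot_delta.
have tE1 u : half_cos dist E1 u = (1 - co i0 u) / 2.
  by rewrite half_cos_sph sph_mkK dN dot_delta.
have tQ k u : half_cos dist (Q k) u = (1 + co (lift ord0 k) u) / 2.
  by rewrite half_cos_sph sph_mkK dot_delta.
have tC k l a b (kl : k != l) (ab : a ^+ 2 + b ^+ 2 = 1) u :
    half_cos dist (sph_comb kl ab) u = (1 + (a * co k u + b * co l u)) / 2.
  by rewrite half_cos_sph sph_mkK dotDl !dotZl !dot_delta.
have comb k l a b (kl : k != l) (ab : a ^+ 2 + b ^+ 2 = 1) :
    sph_vec (sph_comb kl ab) = a *: delta_mx k 0 + b *: delta_mx l 0 by rewrite sph_mkK.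
have fixE g k : (forall w, dot (sph_vec (Q ord0) - sph_vec k) (sph_vec w) = 0 -> g w = w) ->
    dot (sph_vec k) (delta_mx i0 0) = 0 -> g E0 = E0 /\ g E1 = E1.
  move=> gf k0; have e : dot (sph_vec (Q ord0) - sph_vec k) (delta_mx i0 0) = 0.
    by rewrite dotBl k0 sph_mkK dot_delta mxE subr0.
  by split; apply: gf; rewrite ?(sph_mkK (unit_delta i0))// (sph_mkK (unitN i0)) dotC dN dotC e oppr0.
apply: (@jacobi_uniform R pt dist dT T P U Uel Uun D 0 E0 E1 Q (fun=> E1)) eB eA.
- move=> u; rewrite tE0 tE1; under eq_bigr do rewrite tQ.
  have := sph_vec_dot u; rewrite /dot big_ord_recl -/(co i0 u) => h.
  rewrite (eq_bigr (fun k => co (lift ord0 k) u * co (lift ord0 k) u / 4)); last by move=> k _; field.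
  by rewrite -mulr_suml -(addKr (co i0 u * co i0 u) (\sum_i _)) h; field.
- pose w := sph_mk (unitN (lift ord0 ord0)).
  have [g ig [_ gu gf]] := sph_reflection (Q ord0) w.
  have [g0 g1] : g E0 = E0 /\ g E1 = E1.
    by apply: fixE gf _; rewrite sph_mkK dN dot_delta mxE oppr0.
  exists g => //; split=> // u; rewrite gu tE0 tE1 tQ half_cos_sph sph_mkK dN dot_delta -/(co _ u).
  by field.
- move=> k a b k0 ab.
  have kl : lift ord0 (ord0 : 'I_D.+1) != lift ord0 k :> 'I_D.+2 by rewrite eq_sym (inj_eq lift_inj).
  have [g ig [_ gu gf]] := sph_reflection (Q ord0) (sph_comb kl ab).
  have [g0 g1] : g E0 = E0 /\ g E1 = E1.
    by apply: fixE gf _; rewrite comb dotDl !dotZl !dot_delta !mxE !mulr0 addr0.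
  exists g => //; split=> // u; rewrite gu tC tE0 tE1 !tQ; by field.
(* Half angles: the direction (a, b) at angle phi on the projective line corresponds to the angle 2
   phi on the sphere. *)
- move=> a b ab; have ab' : (a ^+ 2 - b ^+ 2) ^+ 2 + (2 * a * b) ^+ 2 = 1.
    by transitivity ((a ^+ 2 + b ^+ 2) ^+ 2); [ring|rewrite ab expr1n].
  have kl : i0 != lift ord0 (ord0 : 'I_D.+1) by [].
  have [g ig [_ gu gf]] := sph_reflection E0 (sph_comb kl ab').
  exists g => // u; rewrite gu tC tE0 tE1 tQ.
  transitivity ((a ^+ 2 + b ^+ 2 + ((a ^+ 2 - b ^+ 2) * co i0 u + 2 * a * b * co (lift ord0 ord0) u)) / 2).
    by rewrite ab.
  by field.
- by move=> u; rewrite big_ord1 tE0 tE1; field.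
- by move=> l; exists id => //; split=> //; exists id.
- move=> x' y'; set s := half_cos dist x' y'.
  have /andP[s0 s1] : 0 <= s <= 1 := half_cos_itv dist x' y'.
  (* The cosine and sine of the distance, expressed through its half-angle value s. *)
  have ab : (2 * s - 1) ^+ 2 + (2 * Num.sqrt s * Num.sqrt (1 - s)) ^+ 2 = 1.
    by rewrite !exprMn !sqr_sqrtr ?subr_ge0//; ring.
  have kl : i0 != lift ord0 (ord0 : 'I_D.+1) by [].
  have [g ig [gK gx _]] := sph_reflection x' E0.
  have [h ih [hK hy hf]] := sph_reflection (g y') (sph_comb kl ab).
  have h0 : h E0 = E0.
    apply: hf; rewrite dotBl comb (sph_mkK (unit_delta i0)) dotDl !dotZl !dot_delta !mxE dotC.
    have : half_cos dist E0 (g y') = s by rewrite -gx half_cos_isometry.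
    by rewrite tE0 /co dot_delta mxE /= => h1; lra.
  (* Both reflections are involutions, so this composite undoes the motion of the pair into standard
     position. *)
  exists (g \o h); last split.
  - split; first by apply: bij_comp; [case: ig|case: ih].
    by move=> u v; rewrite /= ig.2 ih.2.
  - by rewrite /= h0 -gx gK.
  - exists (sph_comb kl ab); first by rewrite /= -hy hK gK.
    by move=> u; rewrite tC tE0 tE1 tQ; field.
Qed.

End Sphere.

(** * Normalizing constants and parameters *)

Section Constants.
Variable R : realType.
Implicit Types x al be : R.

Lemma Gamma_rising x n : 0 < x -> Gamma (x + n%:R) = rising x n * Gamma x.
Proof.
move=> x0; elim: n => [|n IH]; first by rewrite addr0 rising0 mul1r.
by rewrite -natr1 addrA GammaD1 ?ltr_pwDl// IH risingSr; ring.
Qed.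

(** Quotients of Gamma values are rising factorials, and [dup] is (s)_(2n+1) factored in two ways,
    with s = al + be + 1. *)
Lemma a_const_sqr al be n : 0 < be + 1 -> 0 < al + be + 1 ->
  a_const al be n ^+ 2 * jacobi_const al be n = 1.
Proof.
move=> b0; set s := al + be + 1 => s0.
have s1 : 0 < s + 1 by rewrite ltr_pwDl.
have sn : 0 < s + n%:R by rewrite ltr_pwDl.
have snn : 0 < s + (n + n)%:R by rewrite ltr_pwDl.
have G1 := Gamma_gt0 b0; have G2 := Gamma_gt0 s0; have G3 := Gamma_gt0 s1.
have r1 := rising_gt0 n b0; have r2 := rising_gt0 n s0; have r3 := rising_gt0 (n + n) s1.
have r4 := rising_gt0 n sn.
have e1 : n%:R + be + 1 = be + 1 + n%:R by ring.
have e2 : n%:R + al + be + 1 = s + n%:R by rewrite /s; ring.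
have e3 : al + be + 2 = s + 1 by rewrite /s; ring.
have e4 : 2 * n%:R + al + be + 1 = s + (n + n)%:R by rewrite /s natrD; ring.
have dup : (s + (n + n)%:R) * rising (s + n%:R) n * rising s n = s * rising (s + 1) (n + n).
  by rewrite -mulrA (mulrC (rising (s + n%:R) n)) -risingD mulrC -risingSr risingSl.
rewrite /a_const /jacobi_const e1 e2 e3 e4 (Gamma_rising n b0) (Gamma_rising n s0) (GammaD1 s0).
rewrite sqr_sqrtr; last by rewrite divr_ge0 ?mulr_ge0 ?ltW.
have dup' : s + (n + n)%:R = s * rising (s + 1) (n + n) / (rising (s + n%:R) n * rising s n).
  by rewrite -dup -[X in _ = X / _]mulrA mulfK// mulf_neq0 ?gt_eqF.
clearbody s; rewrite dup'. field.
by rewrite !gt_eqF.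
Qed.

End Constants.

Lemma param_gt0 (R : realType) K d : valid_dim K d ->
  0 < beta K d + 1 :> R /\ 0 < alpha K d + beta K d + 1 :> R.
Proof.
case: K => /=.
- move=> d2; have d2' : 2 <= d%:R :> R by rewrite ler_nat.
  by split; lra.
- move=> d2; have d2' : 2 <= d%:R :> R by rewrite ler_nat.
  by split; lra.
- move=> /andP[d2 _]; have d2' : 4 <= d%:R :> R by rewrite ler_nat.
  by split; lra.
- move=> /andP[d2 _]; have d2' : 8 <= d%:R :> R by rewrite ler_nat.
  by split; lra.
- by split; lra.
Qed.

(** On a projective space d = n 2^j, so al + 1 = d / 2 = n 2^j / 2, while be + 1 = 1/2, 1, 2, 4 is
    2^j / 2 for j = 0, 1, 2, 3. On the sphere both equal d / 2. *)
Lemma tph_jacobi_uniform (R : realType) K d (dT : measure_display) (T : measurableType dT)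
  (P : probability T R) (U : T -> tph_point R K d) x y m :
  valid_dim K d -> random_element rho U -> uniform_el P rho U ->
  let Jac := jacobiP m (alpha K d) (beta K d) in
  Expe P (fun w => Jac (cos (rho x (U w))) * Jac (cos (rho y (U w)))) =
  jacobi_const (alpha K d) (beta K d) m * Jac (cos (rho x y)).
Proof.
case: K U x y => /= U x y.
- case: d U x y => // d U x y d2 Uel Uun.
  by apply: sph_jacobi_uniform => //; field.
- case: d U x y => // d U x y d2 Uel Uun.
  apply: proj_jacobi_uniform => //; rewrite ?expn0; try by field.
  + exact: assoc_straightenable.
  + exact: proj_offdiag_norm.
- move=> /andP[d4 dodd]; have : (d = (d %/ 2) * 2)%N by rewrite divnK// dvdn2.
  (* The quotient is generalized together with the points whose type mentions it, so that it can be
     exposed as a successor. *)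
  move: (d %/ 2)%N U x y => [|n] U x y dE; first by rewrite dE in d4.
  move=> Uel Uun; apply: proj_jacobi_uniform => //; rewrite ?expn1.
  + exact: assoc_straightenable.
  + exact: proj_offdiag_norm.
  + by field.
  + by rewrite dE natrM; field.
- move=> /andP[d4 ddvd]; have : (d = (d %/ 4) * 4)%N by rewrite divnK.
  move: (d %/ 4)%N U x y => [|n] U x y dE; first by rewrite dE in d4.
  move=> Uel Uun; apply: proj_jacobi_uniform => //.
  + exact: assoc_straightenable.
  + exact: proj_offdiag_norm.
  + by rewrite (_ : (2 ^ 2 = 4)%N)//; field.
  + by rewrite (_ : (2 ^ 2 = 4)%N)// dE natrM; field.
- move=> /eqP dE; subst d => Uel Uun.
  apply: (@proj_jacobi_uniform R 3 1) => //.
  + exact: oct_straightenable.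
  + exact: oct_offdiag_norm.
  + by rewrite (_ : (2 ^ 3 = 8)%N)//; field.
  + by rewrite (_ : (2 ^ 3 = 8)%N)//; field.
Qed.

(** * The random field *)

Lemma rho_self (R : realType) K d (x : tph_point R K d) : rho x x = 0.
Proof.
have p j n (y : proj_pt R j n) : proj_rho y y = 0.
  by rewrite /proj_rho -/(inner y y) inner_self mulr1 (_ : 2 - 1 = 1) ?acos1//; ring.
case: K x => /= x; try exact: p.
rewrite /sph_rho; case: x => x x1 /=.
by under eq_bigr do rewrite -expr2; rewrite x1 acos1.
Qed.

(** Applied to products of components of the V_n, which must be measurable for the sigma-algebra
    these vectors generate and not merely for that of [T]. *)
Lemma generated_funM (R : realType) (M : Type) (F : set (set M)) (f g : M -> R) :
  (forall A, measurable A -> <<s F >> (f @^-1` A)) ->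
  (forall A, measurable A -> <<s F >> (g @^-1` A)) ->
  forall A, measurable A -> <<s F >> ((fun x => f x * g x) @^-1` A).
Proof.
move=> hf hg A mA; have [[x0 _]|noM] := pselect (exists x : M, True); last first.
  have -> : (fun x => f x * g x) @^-1` A = set0.
    by apply/seteqP; split => x // _; apply: noM; exists x.
  exact: sigma_algebra0.
pose MT := g_sigma_algebraType (F : set (set (pointed_copy x0))).
have mf : measurable_fun setT (f : MT -> R) by move=> _ C mC; rewrite setTI; exact: hf.
have mg : measurable_fun setT (g : MT -> R) by move=> _ C mC; rewrite setTI; exact: hg.
by have := measurable_funM mf mg measurableT mA; rewrite setTI.
Qed.

Lemma cvg_sum0 (R : realType) (I : Type) (s : seq I) (F : I -> nat -> R) :
  (forall i, F i @ \oo --> (0 : R)) -> (fun n => \sum_(i <- s) F i n) @ \oo --> (0 : R).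
Proof.
move=> F0; elim: s => [|i s IH].
  have -> : (fun n => \sum_(i <- [::]) F i n) = (fun=> 0) by apply/funext => n; rewrite big_nil.
  exact: cvg_cst.
have -> : (fun n => \sum_(k <- i :: s) F k n) = (fun n => F i n + \sum_(k <- s) F k n).
  by apply/funext => n; rewrite big_cons.
have := cvgD (F0 i) IH; rewrite addr0; exact.
Qed.

Section RandomField.
Variables (R : realType) (K : tph_kind) (d m : nat).
Variables (dT : measure_display) (T : measurableType dT) (P : probability T R).
Variables (V : nat -> T -> 'cV[R]_m) (U : T -> tph_point R K d) (B : nat -> 'M[R]_m).
Local Notation al := (alpha K d).
Local Notation be := (beta K d).
Hypothesis vd : valid_dim K d.
Hypothesis VL2 : forall n, rvec_L2 P (V n).
Hypothesis Vind : indep_family P (fun n : nat => sigma_rvec (V n)).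
Hypothesis V0 : forall n, Evec P (V n) = 0.
Hypothesis Vcov : forall n, covmx P (V n) (V n) = (a_const al be n) ^+ 2 *: 1%:M.
Hypothesis Uel : random_element rho U.
Hypothesis Uun : uniform_el P rho U.
Hypothesis UVind : indep2 P (sigma_el rho U) (<<s \bigcup_n sigma_rvec (V n) >>).
Hypothesis Bnnd : forall n, sym_nnd (B n).
Local Notation jac n r := (jacobiP n al be (cos r)).
Local Notation term := (fun (n : nat) (x : tph_point R K d) (w : T) =>
    jac n (rho x (U w)) *: (msqrt (B n) *m V n w)).
Local Notation S := (fun (N : nat) (x : tph_point R K d) (w : T) => \sum_(n < N) term n x w).

Let Vn n i w : R := V n w i 0.

Lemma bborel_jac n x : bborel (@rho R K d) (fun u => jac n (rho x u)).
Proof.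
have e u v : cos (@rho R K d u v) = 2 * half_cos rho u v - 1.
  by rewrite /half_cos; field.
under [X in bborel _ X]eq_fun do rewrite e jacobiP_horner.
by apply: bborel_horner; exact: bborel_half_cos.
Qed.

Lemma V_L2 n i : L2 P (Vn n i). Proof. exact: VL2. Qed.

Lemma V_mean n i : Expe P (Vn n i) = 0.
Proof. by have /matrixP/(_ i 0) := V0 n; rewrite !mxE. Qed.

Lemma V_sigma n i A : measurable A -> sigma_rvec (V n) (Vn n i @^-1` A).
Proof. by move=> mA; apply: sub_gen_smallest; exists i, A. Qed.

(** Equal indices use the prescribed covariance; distinct ones use independence of the family on the
    two-element list [[:: n; n']]. *)
Lemma V_inner n n' i k :
  Expe P (fun w => Vn n i w * Vn n' k w) = (n == n')%:R * ((i == k)%:R * a_const al be n ^+ 2).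
Proof.
have [<-|nn'] := eqVneq n n'.
  have /matrixP/(_ i k) := Vcov n; rewrite !mxE mul1r mulrC => <-.
  congr (Expe P _); apply/funext => w.
  by rewrite -/(Vn n i) -/(Vn n k) !V_mean !subr0.
rewrite mul0r Expe_indep_mul; first by rewrite V_mean mul0r.
- exact: L2_intg (V_L2 n i).
- exact: L2_intg (V_L2 n' k).
- exact: L2_mul (V_L2 n i) (V_L2 n' k).
move=> A A' mA mA'.
pose F j := if j == n then Vn n i @^-1` A else Vn n' k @^-1` A'.
have un : uniq [:: n; n'] by rewrite /= inE nn'.
have FS j : j \in [:: n; n'] -> sigma_rvec (V j) (F j).
  rewrite /F !inE; have [->|jn] := eqVneq j n; first by move=> _; exact: V_sigma.
  by rewrite orFb => /eqP ->; exact: V_sigma.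
have := Vind un FS; rewrite !big_cons big_nil mule1 /F eqxx eq_sym (negbTE nn') => <-.
congr (P _); apply/seteqP; split => w /=.
  by move=> [h h'] j /=; rewrite !inE => /orP[] /eqP ->; rewrite ?eqxx// eq_sym (negbTE nn').
move=> h; split.
  by have := h n; rewrite /= eqxx; apply; rewrite inE eqxx.
by have := h n'; rewrite /= eq_sym (negbTE nn'); apply; rewrite !inE eqxx orbT.
Qed.

Lemma UV_indep phi g : bborel (@rho R K d) phi -> intg P g ->
  (forall A, measurable A -> (<<s \bigcup_n sigma_rvec (V n) >>) (g @^-1` A)) ->
  Expe P (fun w => phi (U w) * g w) = Expe P (phi \o U) * Expe P g.
Proof.
move=> bphi ig sg; have bU := bborel_bmf Uel bphi.
rewrite (@Expe_indep_mul _ _ _ _ (phi \o U) g)//; first exact: bmf_intg.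
  exact: intg_bmfM.
move=> A A' mA mA'; rewrite comp_preimage; apply: UVind; last exact: sg.
by exists (phi @^-1` A) => //; exact: bphi.1.
Qed.

Lemma V_gen n i A : measurable A -> (<<s \bigcup_n sigma_rvec (V n) >>) (Vn n i @^-1` A).
Proof. by move=> mA; apply: sub_gen_smallest; exists n => //; exact: V_sigma. Qed.

Lemma termE n x w i : term n x w i 0 =
  \sum_k msqrt (B n) i k * (jac n (rho x (U w)) * Vn n k w).
Proof. by rewrite !mxE mulr_sumr; apply: eq_bigr => k _; rewrite mulrCA. Qed.

Lemma jacV_L2 n x k : L2 P (fun w => jac n (rho x (U w)) * Vn n k w).
Proof. by apply: L2_bmfM (V_L2 n k); exact: (bborel_bmf Uel (bborel_jac n x)). Qed.

Lemma term_L2 n x i : L2 P (fun w => term n x w i 0).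
Proof.
under [X in L2 _ X]eq_fun do rewrite termE.
by apply: L2_sum => k; apply: L2Z; exact: jacV_L2.
Qed.

Lemma term_mean n x i : Expe P (fun w => term n x w i 0) = 0.
Proof.
under [X in Expe P X]eq_fun do rewrite termE.
rewrite Expe_sum => [|k]; last by apply: intgZ; apply: L2_intg; exact: jacV_L2.
rewrite big1// => k _; rewrite ExpeZ; last by apply: L2_intg; exact: jacV_L2.
rewrite (UV_indep (bborel_jac n x) (L2_intg (V_L2 n k)) (@V_gen n k)).
by rewrite V_mean !mulr0.
Qed.

(** Independence splits off the expectation of the Jacobi product from that of V_a V_b, which is
    diagonal in (a, b). The remaining sum is the square root of B_n times its transpose, and the
    constants cancel by [a_const_sqr]. *)
Lemma term_inner n n' x y i k :
  Expe P (fun w => term n x w i 0 * term n' y w k 0) =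
  (n == n')%:R * (B n i k * jac n (rho x y)).
Proof.
pose J w := jac n (rho x (U w)) * jac n' (rho y (U w)).
have iVV a b : intg P (fun w => Vn n a w * Vn n' b w) by apply: L2_mul; exact: V_L2.
have bJ : bborel rho (fun u => jac n (rho x u) * jac n' (rho y u)).
  by apply: bborelM; exact: bborel_jac.
have iJ a b : intg P (fun w => J w * (Vn n a w * Vn n' b w)).
  by apply: intg_bmfM (iVV a b); exact: (bborel_bmf Uel bJ).
transitivity (Expe P (fun w => \sum_a \sum_b (msqrt (B n) i a * msqrt (B n') k b) *
    (J w * (Vn n a w * Vn n' b w)))).
  congr (Expe P _); apply/funext => w; rewrite !termE mulr_suml; apply: eq_bigr => a _.
  by rewrite mulr_sumr; apply: eq_bigr => b _; rewrite /J; ring.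
rewrite Expe_sum => [|a]; last by apply: intg_sum => b; exact: intgZ.
transitivity (\sum_a \sum_b (msqrt (B n) i a * msqrt (B n') k b) *
    (Expe P J * ((n == n')%:R * ((a == b)%:R * a_const al be n ^+ 2)))).
  apply: eq_bigr => a _; rewrite Expe_sum => [|b]; last exact: intgZ.
  apply: eq_bigr => b _; rewrite ExpeZ//; congr (_ * _).
  rewrite (UV_indep bJ (iVV a b)) ?V_inner// => A mA.
  by apply: generated_funM => // C mC; exact: V_gen.
have [nn'|nn'] := eqVneq n n'; last first.
  by rewrite mul0r big1// => a _; rewrite big1// => b _; rewrite !mul0r !mulr0.
rewrite -nn' mul1r in J bJ iJ *.
have [be0 s0] := param_gt0 R vd.
rewrite (tph_jacobi_uniform x y n vd Uel Uun).
transitivity ((msqrt (B n) *m (msqrt (B n))^T) i k * jac n (rho x y) *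
   (a_const al be n ^+ 2 * jacobi_const al be n)); last first.
  by rewrite a_const_sqr// mulr1 msqrt_mul_trmx.
rewrite mxE !mulr_suml; apply: eq_bigr => a _.
rewrite (bigD1 a)//= eqxx [X in _ + X]big1 ?addr0 ?mxE ?mul1r; first by ring.
by move=> b ba; rewrite eq_sym (negbTE ba) !(mul0r, mulr0).
Qed.

Lemma SE N x w i : S N x w i 0 = \sum_(n < N) term n x w i 0.
Proof. by rewrite summxE. Qed.

Lemma S_L2 N x i : L2 P (fun w => S N x w i 0).
Proof. by under [X in L2 _ X]eq_fun do rewrite SE; apply: L2_sum => n; exact: term_L2. Qed.

Lemma S_mean N x i : Expe P (fun w => S N x w i 0) = 0.
Proof.
under [X in Expe P X]eq_fun do rewrite SE.
rewrite Expe_sum => [|n]; last by apply: L2_intg; exact: term_L2.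
by rewrite big1// => n _; exact: term_mean.
Qed.

Local Notation coef x y i k := (fun n => B n i k * jac n (rho x y)).

(** Orthogonality leaves only the common terms; unequal lengths are needed for the norm of a
    difference of partial sums. *)
Lemma S_inner M N x y i k : (M <= N)%N ->
  Expe P (fun w => S M x w i 0 * S N y w k 0) = series (coef x y i k) M.
Proof.
move=> MN; transitivity (Expe P (fun w => \sum_(n < M) \sum_(n' < N) term n x w i 0 * term n' y w k 0)).
  congr (Expe P _); apply/funext => w; rewrite !SE mulr_suml.
  by apply: eq_bigr => n _; rewrite mulr_sumr.
have iT n n' : intg P (fun w => term n x w i 0 * term n' y w k 0).
  by apply: L2_mul; exact: term_L2.
rewrite Expe_sum => [|n]; last by apply: intg_sum => n'; exact: iT.
rewrite seriesEord; apply: eq_bigr => n _; rewrite Expe_sum => [|n']; last exact: iT.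
under eq_bigr do rewrite term_inner.
have nN : (n < N)%N by exact: leq_trans MN.
rewrite (bigD1 (Ordinal nN))//= eqxx mul1r big1 ?addr0// => n' n'n.
by rewrite (_ : (n == n' :> nat) = false) ?mul0r//; apply: contraNF n'n => /eqP e; apply/eqP/val_inj.
Qed.

Hypothesis Bcvg : forall i j, exists l : R,
  series (fun n => B n i j * jacobiP n al be 1) @ \oo --> l.

(** The series [s] is nondecreasing because each increment is a squared norm by [sE]. Hence it stays
    below its limit, and l - s n is an admissible rate in [L2_complete]. *)
Lemma S_complete x i : exists2 g, L2 P g &
  norm2 P (fun w => S n x w i 0 - g w) @[n --> \oo] --> (0 : R).
Proof.
have [l hl] := Bcvg i i; set s := series _ in hl.
have sE M N : (M <= N)%N -> norm2 P (fun w => S M x w i 0 - S N x w i 0) = s N - s M.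
  move=> MN.
  transitivity (Expe P (fun w => S M x w i 0 * S M x w i 0
      - 2 * (S M x w i 0 * S N x w i 0) + S N x w i 0 * S N x w i 0)).
    by congr (Expe P _); apply/funext => w; ring.
  have i2 a b : intg P (fun w => S a x w i 0 * S b x w i 0) by apply: L2_mul; exact: S_L2.
  rewrite ExpeD//; last by apply: intgB => //; exact: intgZ.
  rewrite ExpeB//; last exact: intgZ.
  rewrite ExpeZ//.
  rewrite !S_inner// rho_self cos0 -/s; ring.
have snd : nondecreasing_seq s.
  by move=> M N MN; rewrite -subr_ge0 -sE//; exact: norm2_ge0.
have sl N : s N <= l.
  have := nondecreasing_cvgn_le snd (cvgP _ hl) N.
  by rewrite (cvg_lim _ hl).
apply: (@L2_complete _ _ _ P (fun n w => S n x w i 0) (fun n => l - s n)).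
- by move=> n; exact: S_L2.
- by rewrite -(subrr l); apply: cvgB => //; exact: cvg_cst.
- by move=> M N MN; rewrite sE// lerB.
Qed.

Definition ms_cvg (x : tph_point R K d) (Z : T -> 'cV[R]_m) := rvec_L2 P Z /\
  (fun N => \int[P]_w ((\sum_i (S N x w i 0 - Z w i 0) ^+ 2)%:E))%E @ \oo --> 0%E.

Lemma integral_dist x N (Z : T -> 'cV[R]_m) : rvec_L2 P Z ->
  (\int[P]_w ((\sum_i (S N x w i 0 - Z w i 0) ^+ 2)%:E))%E =
  (\sum_i norm2 P (fun w => S N x w i 0 - Z w i 0))%:E.
Proof.
move=> hZ; have iSZ i : intg P (fun w => (S N x w i 0 - Z w i 0) ^+ 2).
  by apply: L2_sqr; apply: L2B; [exact: S_L2|exact: hZ].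
by rewrite -EFin_Expe ?Expe_sum//; exact: intg_sum.
Qed.

Lemma ms_cvg_exists x : exists Z, ms_cvg x Z.
Proof.
have /choice[g gP] : forall i : 'I_m, exists g, L2 P g /\
    norm2 P (fun w => S n x w i 0 - g w) @[n --> \oo] --> (0 : R).
  by move=> i; have [g g2 gc] := S_complete x i; exists g.
exists (fun w => \col_i g i w).
have Z2 : rvec_L2 P (fun w => \col_i g i w).
  move=> i; under eq_fun do rewrite mxE.
  by under [X in _ /\ P.-integrable _ X]eq_fun do rewrite mxE; exact: (gP i).1.
split=> //; under eq_fun do rewrite integral_dist//.
apply: cvg_EFin; first exact: nearW.
by apply: cvg_sum0 => i; under [X in X @ _]eq_fun do under [X in norm2 _ X]eq_fun do rewrite mxE;
  exact: (gP i).2.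
Qed.

Lemma ms_cvg_norm2 x Z i : ms_cvg x Z ->
  norm2 P (fun w => S n x w i 0 - Z w i 0) @[n --> \oo] --> (0 : R).
Proof.
move=> [hZ]; under eq_fun do rewrite integral_dist//.
move=> /fine_cvg h.
apply: (@squeeze_cvgr _ _ _ _ (fun=> 0) (fun n => \sum_i norm2 P (fun w => S n x w i 0 - Z w i 0))).
- apply: nearW => n; rewrite norm2_ge0/= (bigD1 i)//= lerDl sumr_ge0// => k _; exact: norm2_ge0.
- exact: cvg_cst.
- exact: h.
Qed.

(** A mean is an inner product with the constant 1, so [cvg_inner] applies with a constant second
    sequence. *)
Lemma ms_cvg_mean x Z i : ms_cvg x Z -> Expe P (fun w => Z w i 0) = 0.
Proof.
move=> hZ; have one2 : L2 P (fun=> 1) by apply: L2_bmf; exact: bmf_cst.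
have := @cvg_inner _ _ _ P (fun n w => S n x w i 0) (fun _ _ => 1) (fun w => Z w i 0) (fun=> 1)
  (fun n => S_L2 n x i) (fun=> one2) (hZ.1 i) one2 (ms_cvg_norm2 i hZ).
have -> : (fun n : nat => norm2 P (fun w : T => 1 - 1 : R)) = (fun=> 0).
  by apply/funext => n; rewrite /norm2 subrr expr0n /= Expe_cst.
move=> /(_ (cvg_cst _)).
have -> : (fun n => Expe P (fun w => S n x w i 0 * 1)) = (fun=> 0).
  by apply/funext => n; under [X in Expe P X]eq_fun do rewrite mulr1; exact: S_mean.
under [X in Expe P X]eq_fun do rewrite mulr1.
move=> h; exact: (cvg_unique _ h (cvg_cst _)).
Qed.

Lemma ms_cvg_cov x y Z Z' i k : ms_cvg x Z -> ms_cvg y Z' ->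
  series (coef x y i k) @ \oo --> covmx P Z Z' i k.
Proof.
move=> hZ hZ'; rewrite mxE.
under [X in Expe P X]eq_fun do rewrite (ms_cvg_mean i hZ) (ms_cvg_mean k hZ') !subr0.
have -> : series (coef x y i k) = (fun n => Expe P (fun w => S n x w i 0 * S n y w k 0)).
  by apply/funext => n; rewrite S_inner.
exact: (cvg_inner (fun n => S_L2 n x i) (fun n => S_L2 n y k) (hZ.1 i) (hZ'.1 k)
  (ms_cvg_norm2 i hZ) (ms_cvg_norm2 k hZ')).
Qed.

Lemma term_uncorrelated n n' x y : n <> n' -> covmx P (term n x) (term n' y) = 0.
Proof.
move=> /eqP nn'; apply/matrixP => i k; rewrite !mxE.
under [X in Expe P X]eq_fun do rewrite !term_mean !subr0.
by rewrite term_inner (negbTE nn') mul0r.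
Qed.

End RandomField.

(** A mean-square limit is determined only almost surely, so existence is stated separately and the
    properties are claimed for every family of limits. *)
Theorem theorem1 (R : realType) (K : tph_kind) (d m : nat)
  (dT : measure_display) (T : measurableType dT) (P : probability T R)
  (V : nat -> T -> 'cV[R]_m) (U : T -> tph_point R K d) (B : nat -> 'M[R]_m) :
  valid_dim K d ->
  (forall n, rvec_L2 P (V n)) ->
  indep_family P (fun n : nat => sigma_rvec (V n)) ->
  (forall n, Evec P (V n) = 0) ->
  (forall n, covmx P (V n) (V n) = (a_const (alpha K d) (beta K d) n) ^+ 2 *: 1%:M) ->
  random_element rho U ->
  uniform_el P rho U ->
  indep2 P (sigma_el rho U) (<<s \bigcup_n sigma_rvec (V n) >>) ->
  (forall n, sym_nnd (B n)) ->
  (forall i j, exists l : R,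
     series (fun n => B n i j * jacobiP n (alpha K d) (beta K d) 1) @ \oo --> l) ->
  let term := fun (n : nat) (x : tph_point R K d) (w : T) =>
    jacobiP n (alpha K d) (beta K d) (cos (rho x (U w))) *: (msqrt (B n) *m V n w) in
  let S := fun (N : nat) (x : tph_point R K d) (w : T) => \sum_(n < N) term n x w in
  let ms_limit := fun Z : tph_point R K d -> T -> 'cV[R]_m =>
    forall x, rvec_L2 P (Z x) /\
      (fun N => \int[P]_w ((\sum_i (S N x w i 0 - Z x w i 0) ^+ 2)%:E))%E @ \oo --> 0%E in
  (exists Z, ms_limit Z) /\
  (forall Z, ms_limit Z ->
     [/\ (forall x, Evec P (Z x) = 0),
         (exists mu, forall x, Evec P (Z x) = mu)
           /\ (exists C : R -> 'M[R]_m,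
                 forall x1 x2, covmx P (Z x1) (Z x2) = C (rho x1 x2))
       & forall x1 x2 i j,
           series (fun n => B n i j * jacobiP n (alpha K d) (beta K d) (cos (rho x1 x2)))
             @ \oo --> covmx P (Z x1) (Z x2) i j]) /\
  (forall i j, i <> j -> forall x1 x2,
     covmx P (term i x1) (term j x2) = 0).
Proof.
move=> vd VL2 Vind V0 Vcov Uel Uun UVind Bnnd Bcvg term S ms_limit.
have cov Z x y i k : ms_limit Z -> series (fun n => B n i k *
    jacobiP n (alpha K d) (beta K d) (cos (rho x y))) @ \oo --> covmx P (Z x) (Z y) i k.
  by move=> hZ; apply: (ms_cvg_cov vd VL2 Vind V0 Vcov Uel Uun UVind Bnnd); exact: hZ.
split; last split.
- have /choice[Z hZ] := ms_cvg_exists vd VL2 Vind V0 Vcov Uel Uun UVind Bnnd Bcvg.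
  by exists Z.
- move=> Z hZ.
  have mean x : Evec P (Z x) = 0.
    apply/matrixP => i k; rewrite !mxE.
    exact: (ms_cvg_mean VL2 V0 Uel UVind i (hZ x)).
  split=> //; last by move=> x y i k; exact: cov.
  split; first by exists 0.
  (* The witness is used only at r = rho x y, where [cov] gives convergence of the series and so
     identifies [lim]. *)
  exists (fun r => \matrix_(i, k) lim (series (fun n => B n i k *
    jacobiP n (alpha K d) (beta K d) (cos r)) @ \oo)) => x y.
  by apply/matrixP => i k; rewrite [RHS]mxE; apply/esym/cvg_lim => //; exact: cov.
- move=> i j ij x y.
  exact: (term_uncorrelated vd VL2 Vind V0 Vcov Uel Uun UVind Bnnd).
Qed.
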